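(* Let $(\mathcal{F}(\Omega),\|\cdot\|,\tau)$ be a semi-Montel Saks space of $\mathbb{K}$-valued functions on a non-empty set $\Omega$ such that $\tau_{\mathrm{p}}\le\tau$, let $E$ be a complete locally convex Hausdorff space over $\mathbb{K}$, and set $\mathcal{F}(\Omega)_\gamma:=(\mathcal{F}(\Omega),\gamma)$ where $\gamma=\gamma(\|\cdot\|,\tau)$ is the mixed topology. Then the map \[ \chi\colon \mathcal{F}(\Omega)_\gamma\,\varepsilon\, E\to(\mathcal{F}(\Omega,E)_\sigma,\gamma^E_{\sigma,\mathrm{s}}),\quad \chi(u):=u\circ\Delta=[x\mapsto u(\Delta(x))], \] is a topological isomorphism. In particular, $(\mathcal{F}(\Omega,E)_\sigma,\gamma^E_{\sigma,\mathrm{s}})$ is complete. If $E$ is a Banach space, then $(\mathcal{F}(\Omega,E)_\sigma,\|\cdot\|_\sigma^E,\tau_\sigma^E)$ is a complete Saks space.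
   Context: $\mathbb{K}\in\{\mathbb{R},\mathbb{C}\}$; for topologies, $\le$ means ''coarser than (or equal to)''. Saks spaces. Let $(X,\|\cdot\|)$ be a normed space and $\tau\le\tau_{\|\cdot\|}$ a locally convex Hausdorff topology on $X$. The mixed topology $\gamma(\|\cdot\|,\tau)$ is the finest linear topology on $X$ that coincides with $\tau$ on $\|\cdot\|$-bounded sets and satisfies $\tau\le\gamma\le\tau_{\|\cdot\|}$; it is locally convex Hausdorff. $(X,\|\cdot\|,\tau)$ is a Saks space if there is a directed system $\Gamma_\tau$ of continuous seminorms generating $\tau$ with $\|x\|=\sup_{q\in\Gamma_\tau}q(x)$ for all $x$. A Saks space is complete (resp. semi-Montel) if $(X,\gamma)$ is complete (resp. a semi-Montel space, i.e. bounded sets are relatively compact). If $(X,\|\cdot\|,\tau)$ is a semi-Montel Saks space, then $(X,\|\cdot\|)$ is a Banach space. The submixed topology $\gamma_{\mathrm{s}}(\|\cdot\|,\tau)$ is generated by the seminorms $x\mapsto\sup_{n\in\mathbb{N}}q_n(x)a_n$ with $(q_n)_{n\in\mathbb{N}}\subset\Gamma_\tau$ and $(a_n)_{n\in\mathbb{N}}\in c_0^+$ (real non-negative null-sequences); for a semi-Montel Saks space $\gamma_{\mathrm{s}}=\gamma$. $\tau_{\mathrm{p}}$ is the topology of pointwise convergence on $\mathcal{F}(\Omega)\subset\mathbb{K}^\Omega$. For $x\in\Omega$, $\Delta(x)\colon\mathcal{F}(\Omega)\to\mathbb{K}$, $\Delta(x)(f):=f(x)$; since $\tau_{\mathrm p}\le\tau\le\gamma$,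 $\Delta(x)$ belongs to the dual of $\mathcal{F}(\Omega)_\gamma$. $\varepsilon$-product. $Y\varepsilon E:=L_e(Y'_\kappa,E)$ is the space of continuous linear maps $Y'_\kappa\to E$ with the topology of uniform convergence on equicontinuous subsets of $Y'$, where $Y'_\kappa$ is $Y'$ with the topology of uniform convergence on absolutely convex compact subsets of $Y$. Weak vector-valued functions. Let $\Gamma_E$ be a directed system of seminorms generating the topology of $E$, and for $p\in\Gamma_E$ let $U_p:=\{x\in E: p(x)<1\}$ with polar $U_p^\circ\subset E'$. Set $\mathcal{F}(\Omega,E)_\sigma:=\{f\colon\Omega\to E : e'\circ f\in\mathcal{F}(\Omega)\text{ for all }e'\in E'\}$. The topology $\gamma^E_{\sigma,\mathrm{s}}$ on $\mathcal{F}(\Omega,E)_\sigma$ is the locally convex Hausdorff topology generated by the seminorms $f\mapsto\sup_{e'\in U_p^\circ}\sup_{n\in\mathbb{N}}q_n(e'\circ f)a_n$ for $p\in\Gamma_E$, $(q_n)_{n\in\mathbb{N}}\subset\Gamma_\tau$, $(a_n)_{n\in\mathbb{N}}\in c_0^+$ (these are finite). If $(E,\|\cdot\|_E)$ is normed, with closed dual unit ball $B_{\|\cdot\|_{E^*}}$, then $\|f\|_\sigma^E:=\sup_{e^*\in B_{\|\cdot\|_{E^*}}}\|e^*\circ f\|$ (a finite norm on $\mathcal{F}(\Omega,E)_\sigma$) and $\tau_\sigma^E$ is the locally convex topology on $\mathcal{F}(\Omega,E)_\sigma$ generated by the seminorms $q_\sigma^E(f):=\sup_{e^*\in B_{\|\cdot\|_{E^*}}}q(e^*\circ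 f)$, $q\in\Gamma_\tau$. *)

(* Defs.v *)
From HB Require Import structures.
From mathcomp Require Import all_boot all_order all_algebra.
From mathcomp Require Import all_classical all_reals all_analysis.
From mathcomp Require Import complex.

Set Implicit Arguments.
Unset Strict Implicit.
Unset Printing Implicit Defensive.

Import Order.TTheory GRing.Theory Num.Theory.
Import numFieldNormedType.Exports.

Local Open Scope classical_set_scope.
Local Open Scope ring_scope.

Inductive scalar_kind := RealScalars | ComplexScalars.

Definition scalars (R : realType) (k : scalar_kind) : numFieldType :=
  match k with
  | RealScalars => R : numFieldType
  | ComplexScalars => R[i]%C : numFieldType
  end.

(* In MathComp the norm of [z : R[i]] is an element of [R[i]]; the suprema
   below need it as an element of [R]. *)
Definition modulus (R : realType) (k : scalar_kind) : scalars R k -> R :=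
  match k with
  | RealScalars => fun x : R => `|x|
  | ComplexScalars => fun z : R[i]%C => complex.Re `|z|
  end.

(* Several topologies on one vector space have to be compared, so a topology
   is a record, and [X \with t] is a copy of [X] carrying [t] as its canonical
   structure, on which the library's topological notions are available. *)
Record topology (X : Type) := Topology {
  opens : set (set X);
  opens_setT : opens setT;
  opens_setI : setI_closed opens;
  opens_bigcup : forall (I : Type) (f : I -> set X),
    (forall i, opens (f i)) -> opens (\bigcup_i f i) }.

Definition coarser (X : Type) (s t : topology X) := opens s `<=` opens t.

Lemma coarser_trans (X : Type) (s t u : topology X) :
  coarser s t -> coarser t u -> coarser s u.
Proof. by move=> st tu A /st /tu. Qed.

Definition with_topology (X : Type) (t : topology X) : Type := X.
Notation "X \with t" := (@with_topology X t) (at level 50, no associativity).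

HB.instance Definition _ (X : choiceType) (t : topology X) :=
  Choice.on (X \with t).
HB.instance Definition _ (X : choiceType) (t : topology X) :=
  isOpenTopological.Build (X \with t) (@opens_setT X t) (@opens_setI X t)
    (@opens_bigcup X t).
HB.instance Definition _ (K : numDomainType) (X : lmodType K) (t : topology X) :=
  GRing.Lmodule.on (X \with t).

Definition topology_of (T : topologicalType) : topology T :=
  @Topology T open openT openI
    (fun I f fo => @bigcup_open T I setT f (fun i _ => fo i)).

Section tvs.
Context (K : numFieldType).
Implicit Types X Y : preTopologicalLmodType K.

Definition linear_topology X :=
  continuous (fun x : X * X => x.1 + x.2) /\
  continuous (fun z : K^o * X => z.1 *: z.2).

Definition locally_convex_topology X :=
  linear_topology X /\
  exists2 B : set_system X, (forall b, b \in B -> convex_set b) & basis B.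

(* Completeness for the translation-invariant uniformity. [tvsType] carries a
   uniformity that is only required to induce the topology, so the library's
   [cauchy] is not the right notion here. *)
Definition complete_tvs X :=
  forall F : set_system X, ProperFilter F ->
    (forall U, nbhs (0 : X) U ->
       exists2 A, F A & forall x y, A x -> A y -> U (x - y)) ->
    exists x : X, F --> x.

Definition topological_isomorphism X Y (f : X -> Y) :=
  [/\ linear f, continuous f &
      exists g : Y -> X, [/\ cancel f g, cancel g f & continuous g]].

End tvs.

Definition subspace_type (K : pzRingType) (V : lmodType K)
    (S : submodClosed V) : Type := {x : V | x \in S}.

HB.instance Definition _ (K : pzRingType) (V : lmodType K)
    (S : submodClosed V) := SubChoice.on (subspace_type S).
HB.instance Definition _ (K : pzRingType) (V : lmodType K)
    (S : submodClosed V) := [SubChoice_isSubLmodule of subspace_type S by <:].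

Section continuous_linear_maps.
Context (K : numFieldType) (X : preTopologicalLmodType K)
        (Y : topologicalLmodType K).

Definition continuous_linear : {pred X -> Y} :=
  fun f => `[< linear f /\ continuous f >].

Lemma continuous_linear_closed : submod_closed continuous_linear.
Proof.
split.
  apply/asboolP; split; first by move=> a x y; rewrite scaler0 addr0.
  by move=> x; exact: cvg_cst.
move=> a f g /asboolP[lf cf] /asboolP[lg cg]; apply/asboolP; split.
  move=> b x y; change (a *: f (b *: x + y) + g (b *: x + y) =
     b *: (a *: f x + g x) + (a *: f y + g y)).
  by rewrite lf lg !scalerDr !scalerA (mulrC a b) addrACA.
move=> x; have scale_f : (fun x => a *: f x) @ x --> a *: f x.
  apply: (@cvg_comp _ _ _ (fun x => (a, f x)) (fun z : K^o * Y => z.1 *: z.2));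
    last exact: (@scale_continuous K Y (a, f x)).
  exact: (cvg_pair (@cvg_cst K^o a X (nbhs x) _) (cf x)).
apply: (@cvg_comp _ _ _ (fun x => (a *: f x, g x)) (fun z : Y * Y => z.1 + z.2));
  last exact: (@add_continuous Y (a *: f x, g x)).
exact: (cvg_pair scale_f (cg x)).
Qed.

HB.instance Definition _ :=
  GRing.isSubmodClosed.Build K (X -> Y) continuous_linear
    continuous_linear_closed.

Definition clin : Type := subspace_type continuous_linear.
HB.instance Definition _ := GRing.Lmodule.on clin.

Definition clin_fun (u : clin) : X -> Y := \val u.
Coercion clin_fun : clin >-> Funclass.

End continuous_linear_maps.

Definition dual (K : numFieldType) (X : preTopologicalLmodType K) : Type :=
  clin X K^o.
Identity Coercion dual_clin : dual >-> clin.
HB.instance Definition _ (K : numFieldType) (X : preTopologicalLmodType K) :=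
  GRing.Lmodule.on (dual X).

Section uniform_convergence.
Context (K : numFieldType) (M D : Type) (Y : preTopologicalLmodType K)
        (ev : M -> D -> Y) (S : set (set D)).

Definition uniform_opens : set (set M) :=
  [set U | forall u, U u -> exists (B : set (set D)) (V : set Y),
     [/\ finite_set B, B `<=` S, nbhs (0 : Y) V &
         [set v | forall A, B A -> forall x, A x -> V (ev v x - ev u x)]
           `<=` U]].

Lemma uniform_opens_setT : uniform_opens setT.
Proof.
by move=> u _; exists set0, setT; split => //; exact: filterT.
Qed.

Lemma uniform_opens_setI : setI_closed uniform_opens.
Proof.
move=> U1 U2 o1 o2 u [/o1[B1 [V1 [f1 s1 n1 h1]]] /o2[B2 [V2 [f2 s2 n2 h2]]]].
exists (B1 `|` B2), (V1 `&` V2); split.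
- by rewrite finite_setU; split.
- by rewrite subUset; split.
- exact: filterI.
- move=> v hv; split.
    by apply: h1 => A BA x Ax; case: (hv A (or_introl BA) x Ax).
  by apply: h2 => A BA x Ax; case: (hv A (or_intror BA) x Ax).
Qed.

Lemma uniform_opens_bigcup (I : Type) (f : I -> set M) :
  (forall i, uniform_opens (f i)) -> uniform_opens (\bigcup_i f i).
Proof.
move=> fo u [i _ /fo[B [V [fB sB nV h]]]]; exists B, V; split => //.
by move=> v /h; exists i.
Qed.

Definition uniform_convergence_topology : topology M :=
  Topology uniform_opens_setT uniform_opens_setI uniform_opens_bigcup.

End uniform_convergence.

Section with_scalars.
Context (R : realType) (k : scalar_kind).
Local Notation K := (scalars R k).

Definition seminorm (X : lmodType K) (q : X -> R) :=
  (forall x y, q (x + y) <= q x + q y) /\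
  (forall (a : K) x, q (a *: x) = modulus a * q x).

Definition is_norm (X : lmodType K) (q : X -> R) :=
  seminorm q /\ forall x, q x = 0 -> x = 0.

Definition directed (X : Type) (G : set (X -> R)) :=
  G !=set0 /\
  forall q1 q2, G q1 -> G q2 ->
    exists2 q, G q & forall x, q1 x <= q x /\ q2 x <= q x.

Section seminorm_topology.
Context (X : lmodType K) (G : set (X -> R)).

Definition seminorm_opens : set (set X) :=
  [set U | forall x, U x -> exists (B : set (X -> R)) (e : R),
     [/\ finite_set B, B `<=` G, 0 < e &
         [set y | forall q, B q -> q (y - x) < e] `<=` U]].

Lemma seminorm_opens_setT : seminorm_opens setT.
Proof. by move=> x _; exists set0, 1; split => //; exact: ltr01. Qed.

Lemma seminorm_opens_setI : setI_closed seminorm_opens.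
Proof.
move=> U1 U2 o1 o2 x [/o1[B1 [e1 [f1 s1 n1 h1]]] /o2[B2 [e2 [f2 s2 n2 h2]]]].
exists (B1 `|` B2), (Num.min e1 e2); split.
- by rewrite finite_setU; split.
- by rewrite subUset; split.
- by rewrite lt_min n1 n2.
- move=> y hy; split.
    by apply: h1 => q Bq; have := hy q (or_introl Bq); rewrite lt_min => /andP[].
  by apply: h2 => q Bq; have := hy q (or_intror Bq); rewrite lt_min => /andP[].
Qed.

Lemma seminorm_opens_bigcup (I : Type) (f : I -> set X) :
  (forall i, seminorm_opens (f i)) -> seminorm_opens (\bigcup_i f i).
Proof.
move=> fo x [i _ /fo[B [e [fB sB e0 h]]]]; exists B, e; split => //.
by move=> y /h; exists i.
Qed.

Definition seminorm_topology : topology X :=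
  Topology seminorm_opens_setT seminorm_opens_setI seminorm_opens_bigcup.

End seminorm_topology.

Definition norm_topology (X : lmodType K) (nrm : X -> R) : topology X :=
  seminorm_topology [set nrm].

Definition generating_seminorms (X : lmodType K) (t : topology X)
    (G : set (X -> R)) :=
  [/\ directed G, forall q, G q -> seminorm q &
      opens t = opens (seminorm_topology G)].

Section saks.
Context (X : lmodType K).
Implicit Types (nrm : X -> R) (t g : topology X) (G : set (X -> R)).

Definition coincide_on (B : set X) (s t : topology X) :=
  [set U `&` B | U in opens s] = [set U `&` B | U in opens t].

Definition mixed_candidate nrm t g :=
  [/\ linear_topology (X \with g),
      forall B : set X, (exists C : R, forall x, B x -> nrm x <= C) ->
        coincide_on B g t,
      coarser t g & coarser g (norm_topology nrm)].

(* The mixed topology is the greatest candidate, hence unique. *)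
Definition is_mixed_topology nrm t g :=
  mixed_candidate nrm t g /\
  forall s, mixed_candidate nrm t s -> coarser s g.

Lemma mixed_coarser nrm t g : is_mixed_topology nrm t g -> coarser t g.
Proof. by case=> -[]. Qed.

(* The norm is recovered by an extended-real supremum, so an unbounded family
   [q x] is excluded rather than given a default value. *)
Definition saks_system nrm t G :=
  [/\ generating_seminorms t G,
      forall q, G q -> continuous (q : X \with t -> R^o) &
      forall x, ((nrm x)%:E = ereal_sup [set (q x)%:E | q in G])%E].

Definition two_topology_space nrm t :=
  [/\ is_norm nrm, locally_convex_topology (X \with t),
      hausdorff_space (X \with t) & coarser t (norm_topology nrm)].

Definition saks_space nrm t :=
  two_topology_space nrm t /\ exists G, saks_system nrm t G.

Definition complete_saks_space nrm t :=
  saks_space nrm t /\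
  exists2 g, is_mixed_topology nrm t g & complete_tvs (X \with g).

End saks.

Definition tvs_bounded (X : preTopologicalLmodType K) (B : set X) :=
  forall U, nbhs (0 : X) U -> exists2 r : R, 0 < r &
    forall a : K, r <= modulus a -> B `<=` [set a *: x | x in U].

Definition semi_Montel (X : preTopologicalLmodType K) :=
  forall B : set X, tvs_bounded B -> precompact B.

Definition absolutely_convex (X : lmodType K) (A : set X) :=
  forall x y (a b : K), A x -> A y -> modulus a + modulus b <= 1 ->
    A (a *: x + b *: y).

Definition kappa_topology (X : preTopologicalLmodType K) :
    topology (dual X) :=
  uniform_convergence_topology (@clin_fun K X K^o)
    [set A : set X | absolutely_convex A /\ compact A].

Definition dual_kappa (X : preTopologicalLmodType K) : Type :=
  dual X \with kappa_topology X.
HB.instance Definition _ (X : preTopologicalLmodType K) :=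
  PreTopologicalLmodule.on (dual_kappa X).

Definition eps_topology (X : preTopologicalLmodType K)
    (E : topologicalLmodType K) : topology (clin (dual_kappa X) E) :=
  uniform_convergence_topology (@clin_fun K (dual_kappa X) E)
    [set H : set (dual X) | equicontinuous H (@clin_fun K X K^o)].

Definition eps_product (X : preTopologicalLmodType K)
    (E : topologicalLmodType K) : Type :=
  clin (dual_kappa X) E \with eps_topology X E.
HB.instance Definition _ (X : preTopologicalLmodType K)
    (E : topologicalLmodType K) :=
  PreTopologicalLmodule.on (eps_product X E).

Section function_spaces.
Context (Omega : Type) (F : submodClosed (Omega -> K^o)).

Local Notation FO := (subspace_type F).

Definition feval (f : FO) : Omega -> K^o := \val f.

Definition pointwise_topology : topology FO :=
  topology_of (initial_topology (feval : FO -> {ptws Omega -> K^o})).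

Lemma evaluation_continuous_linear (g : topology FO)
    (pg : coarser pointwise_topology g) (x : Omega) :
  (fun f : FO \with g => feval f x : K^o) \in
    @continuous_linear K (FO \with g) K^o.
Proof.
apply/asboolP; split; first by [].
apply/continuousP => A oA; apply: pg.
exists ((fun h : {ptws Omega -> K^o} => h x) @^-1` A); last by [].
have px : continuous (fun h : {ptws Omega -> K^o} => h x).
  exact: (@proj_continuous {classic Omega} (fun _ => K^o) x).
by move/continuousP: px; apply.
Qed.

Definition Delta (g : topology FO) (pg : coarser pointwise_topology g)
    (x : Omega) : dual (FO \with g) :=
    exist (fun u => u \in @continuous_linear K (FO \with g) K^o) _
    (evaluation_continuous_linear pg x).

Section weak_functions.
Context (E : topologicalLmodType K).

Definition weak_function : {pred Omega -> E} :=
  fun f => `[< forall e : dual E, (e \o f : Omega -> K^o) \in F >].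

Lemma weak_function_closed : submod_closed weak_function.
Proof.
split.
  apply/asboolP => e; have /asboolP[le _] := valP e.
  have -> : e \o (0 : Omega -> E) = 0 :> (Omega -> K^o).
    by apply/funext => x /=; have := le (-1) 0 0; rewrite scaler0 addr0 scaleN1r addNr.
  exact: rpred0.
move=> a f g /asboolP hf /asboolP hg; apply/asboolP => e.
have /asboolP[le _] := valP e.
have -> : e \o (a *: f + g) = a *: (e \o f) + (e \o g) :> (Omega -> K^o).
  by apply/funext => x; exact: le.
by apply: rpredD; [apply: rpredZ; exact: hf | exact: hg].
Qed.

HB.instance Definition _ :=
  GRing.isSubmodClosed.Build K (Omega -> E) weak_function
    weak_function_closed.

Definition weak_space : Type := subspace_type weak_function.
HB.instance Definition _ := GRing.Lmodule.on weak_space.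

Definition weval (f : weak_space) : Omega -> E := \val f.

Lemma dual_comp_subproof (e : dual E) (f : weak_space) :
  (e \o weval f : Omega -> K^o) \in F.
Proof. by have /asboolP := valP f; exact. Qed.

Definition dual_comp (e : dual E) (f : weak_space) : FO :=
  exist (fun h => h \in F) _ (dual_comp_subproof e f).

Definition polar (U : set E) : set (dual E) :=
  [set e | forall x, U x -> modulus (e x : K) <= 1].

(* [sup] is the real supremum, with value 0 on unbounded sets. All suprema of
   seminorms below are over bounded sets when [q n <= nrm], [a] tends to 0 and
   [FO] is a semi-Montel Saks space for [nrm]. *)
Definition gamma_sigma_s_seminorm (p : E -> R) (q : nat -> FO -> R)
    (a : nat -> R) (f : weak_space) : R :=
  sup [set sup [set q n (dual_comp e f) * a n | n in [set: nat]]
      | e in polar [set x | p x < 1]].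

Definition gamma_sigma_s (GE : set (E -> R)) (G : set (FO -> R)) :
    topology weak_space :=
  seminorm_topology
    [set N | exists p q a, [/\ GE p, forall n, G (q n),
       (forall n, 0 <= a n), (a : nat -> R^o) @ \oo --> (0 : R^o) &
       N = gamma_sigma_s_seminorm p q a]].

End weak_functions.

Section normed_target.
Context (E : normedModType K).

Definition dual_norm (e : dual E) : R :=
  sup [set modulus (e x : K) | x in [set x : E | `|x| <= 1]].

Definition dual_ball : set (dual E) := [set e | dual_norm e <= 1].

(* Used both for the norm of [F] and for the seminorms generating [tau]. *)
Definition sigma_sup (q : FO -> R) (f : weak_space E) : R :=
  sup [set q (dual_comp e f) | e in dual_ball].

Definition tau_sigma (G : set (FO -> R)) : topology (weak_space E) :=
  seminorm_topology [set sigma_sup q | q in G].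

End normed_target.

End function_spaces.

End with_scalars.

(* Main.v *)
(* Put X = F_gamma. By the Montel property the balls of X are compact, and a
   Banach-Dieudonne argument shows that gamma is generated by the submixed
   seminorms N = sup_n q_n a_n and that X'_kappa is X' with the dual norm.
   Hahn-Banach and the compactness of the balls yield (X'_kappa)' = X. Hence, for
   u : X'_kappa -> E and e in E', the form e \o u is the evaluation at a point of
   X, which must be e \o chi u:
     e (u y) = y (e \o chi u)   for all y in X'.
   This identity shows that chi is well defined and injective and, since the
   equicontinuous subsets of X' are those dominated by some N, that it matches
   the two families of seminorms. For surjectivity, a nested-ball argument bounds
   the norm of e \o f on each polar, so that y |-> (the point of E representing
   e |-> y (e \o f)) is Lipschitz on the dense span of the point evaluations and
   extends to X' because E is complete. The epsilon-product is complete: null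
   sequences of X' are equicontinuous, so the limit of a Cauchy filter is bounded
   on them.

   In a Saks space the mixed topology is generated by the seminorms that are
   tau-continuous on the unit ball; infimal convolutions of seminorms show that it
   is the finest candidate, and that a Cauchy filter stays close to some ball, on
   which the mixed topology and tau agree. For Banach E this reduces completeness
   to convergence in the coarser topology gamma_sigma_s. *)
Require Import Defs.
From HB Require Import structures.
From mathcomp Require Import all_boot all_order all_algebra.
From mathcomp Require Import all_classical all_reals all_analysis.
From mathcomp Require Import complex ring lra.

Set Implicit Arguments.
Unset Strict Implicit.
Unset Printing Implicit Defensive.

Import Order.TTheory GRing.Theory Num.Theory.
Import numFieldNormedType.Exports.

Local Open Scope classical_set_scope.
Local Open Scope ring_scope.

(** The mixed topology is characterised only as the greatest of the linear candidates, so a family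
    of seminorms describing it must also beat candidates that are not locally convex. This is why
    the Banach-Dieudonne argument is run for a set [W] without any convexity; it rests on compact
    balls. The space of E-valued functions has no compact balls in general, and there infimal
    convolutions of seminorms take over. The other obstacle is finiteness: [E] is an arbitrary
    complete space, so uniform boundedness is proved not in [E] but in the dual of each [(E, p)],
    which is complete because the scalars are. Since real suprema have a default value, this bound
    has to precede the estimates on [gamma_sigma_s]. Real and complex scalars are treated together:
    [embed] and [modulus] pass between [R] and [K], and few proofs look at the two cases
    separately. *)

Lemma normc_Re (R : realType) (z : R[i]%C) : `|z| = (complex.Re `|z|)%:C%C.
Proof. by rewrite normc_def. Qed.

Lemma normc_ge_ReIm (R : realType) (w : R[i]%C) :
  `|complex.Re w| <= complex.Re `|w| /\ `|complex.Im w| <= complex.Re `|w|.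
Proof.
rewrite normc_def /= -!sqrtr_sqr !ler_sqrt ?addr_ge0 ?sqr_ge0//.
by rewrite lerDl lerDr !sqr_ge0.
Qed.

(** * Real and complex scalars *)

Section scalars_theory.
Context (R : realType) (k : scalar_kind).
Local Notation K := (scalars R k).
Implicit Types (x y : K) (r s : R).

Definition embed : R -> K :=
  match k return R -> scalars R k with
  | RealScalars => id
  | ComplexScalars => fun r => (r%:C)%C
  end.

Definition real_part : K -> R :=
  match k return scalars R k -> R with
  | RealScalars => id
  | ComplexScalars => fun z => complex.Re z
  end.

Lemma embed_is_rmorphism : zmod_morphism embed /\ monoid_morphism embed.
Proof.
rewrite /embed; case: k => /=; first by [].
split; first exact: rmorphB.
by split; [exact: rmorph1 | exact: rmorphM].
Qed.

HB.instance Definition _ :=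
  GRing.isZmodMorphism.Build R K embed embed_is_rmorphism.1.
HB.instance Definition _ :=
  GRing.isMonoidMorphism.Build R K embed embed_is_rmorphism.2.

Lemma embed_le r s : (embed r <= embed s) = (r <= s).
Proof. by rewrite /embed; case: k => //=; rewrite lecR. Qed.

Lemma embed_lt r s : (embed r < embed s) = (r < s).
Proof. by rewrite /embed; case: k => //=; rewrite ltcR. Qed.

Lemma norm_modulus x : `|x| = embed (modulus x).
Proof.
rewrite /embed /modulus; move: x; case: k => [//|] x.
exact: (normc_Re x).
Qed.

Lemma modulus_embed r : modulus (embed r) = `|r|.
Proof.
rewrite /embed /modulus; case: k => [//|].
rewrite [LHS](congr1 (@complex.Re R) (normc_def r%:C%C)) /=.
by rewrite expr0n addr0 sqrtr_sqr.
Qed.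

Lemma embed_inj : injective embed.
Proof. by rewrite /embed; case: k => //=; exact: complexI. Qed.

Lemma modulus_ge0 x : 0 <= modulus x.
Proof. by rewrite -embed_le rmorph0 -norm_modulus normr_ge0. Qed.

Lemma modulus0 : modulus (0 : K) = 0.
Proof. by apply: embed_inj; rewrite -norm_modulus normr0 rmorph0. Qed.

Lemma modulus1 : modulus (1 : K) = 1.
Proof. by apply: embed_inj; rewrite -norm_modulus normr1 rmorph1. Qed.

Lemma modulusN x : modulus (- x) = modulus x.
Proof. by apply: embed_inj; rewrite -!norm_modulus normrN. Qed.

Lemma modulusM x y : modulus (x * y) = modulus x * modulus y.
Proof. by apply: embed_inj; rewrite rmorphM /= -!norm_modulus normrM. Qed.

Lemma modulusV x : modulus x^-1 = (modulus x)^-1.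
Proof. by apply: embed_inj; rewrite fmorphV /= -!norm_modulus normfV. Qed.

Lemma modulusD x y : modulus (x + y) <= modulus x + modulus y.
Proof. by rewrite -embed_le rmorphD /= -!norm_modulus ler_normD. Qed.

Lemma modulus_eq0 x : modulus x = 0 -> x = 0.
Proof.
by move=> x0; apply/eqP; rewrite -normr_eq0 norm_modulus x0 rmorph0.
Qed.

Lemma embed_modulus x : 0 <= x -> embed (modulus x) = x.
Proof. by move=> x0; rewrite -norm_modulus ger0_norm. Qed.

Lemma nbhs_scalar x (U : set K^o) :
  nbhs (x : K^o) U <->
  exists2 e : R, 0 < e & forall y, modulus (y - x) < e -> U y.
Proof.
split.
  move=> /nbhs_ballP[e /= e0 eU]; exists (modulus e).
    by rewrite -embed_lt rmorph0 embed_modulus// ltW.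
  move=> y yx; apply: eU; rewrite -ball_normE /= distrC norm_modulus.
  by rewrite -(embed_modulus (ltW e0)) embed_lt.
move=> [e e0 eU]; apply/nbhs_ballP; exists (embed e) => /=.
  by rewrite -(rmorph0 embed) embed_lt.
move=> y; rewrite -ball_normE /= distrC norm_modulus embed_lt; exact: eU.
Qed.

(* A nested-ball form of completeness; the factor 2 comes from treating the
   real and imaginary parts separately. *)
Lemma scalars_complete (z : nat -> K) (r : nat -> R) :
  (forall n m, (n <= m)%N -> modulus (z m - z n) <= r n) ->
  exists x, forall n, modulus (x - z n) <= 2 * r n.
Proof.
have real_case (u : nat -> R) :
    (forall n m, (n <= m)%N -> `|u m - u n| <= r n) ->
    exists t : R, forall n, `|t - u n| <= r n.
  (* The intervals of centre [u n] and radius [r n] need not be nested, but every left end lies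
     below every right end, so the supremum of the left ends lies in all of them. *)
  move=> h; pose A := range (fun n => u n - r n).
  have ub n : ubound A (u n + r n).
    move=> _ [m _ <-]; case: (leqP m n) => [mn|/ltnW nm].
      have := h _ _ mn; have := h _ _ (leqnn n); rewrite !ler_norml; lra.
    have := h _ _ nm; have := h _ _ (leqnn m); rewrite !ler_norml; lra.
  exists (sup A) => n.
  have lo : u n - r n <= sup A.
    by apply: ub_le_sup; [exists (u n + r n); exact: ub | exists n].
  have hi : sup A <= u n + r n.
    by apply: ge_sup; [exists (u 0%N - r 0%N); exists 0%N | exact: ub].
  by rewrite ler_norml; apply/andP; split; lra.
move: z; rewrite /modulus; case: k => /= z hz.
  have [x hx] := real_case _ hz; exists x => n.
  by have := hx n; have := normr_ge0 (x - z n); lra.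
have [|a ha] := real_case (fun n => complex.Re (z n)).
  by move=> n m /hz; apply: le_trans; have [] := normc_ge_ReIm (z m - z n);
    case: (z m) (z n) => ? ? [].
have [|b hb] := real_case (fun n => complex.Im (z n)).
  by move=> n m /hz; apply: le_trans; have [] := normc_ge_ReIm (z m - z n);
    case: (z m) (z n) => ? ? [].
exists (Complex a b) => n.
have -> : Complex a b - z n =
    (a - complex.Re (z n))%:C%C + 'i%C * (b - complex.Im (z n))%:C%C.
  case: (z n) => c d; apply/eqP; rewrite eq_complex /=.
  by apply/andP; split; apply/eqP; simpc.
have reD (v w : R[i]%C) : complex.Re (v + w) = complex.Re v + complex.Re w.
  by case: v; case: w.
set v := (a - _)%:C%C; set w := 'i%C * _.
have : complex.Re `|v + w| <= complex.Re `|v| + complex.Re `|w|.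
  by rewrite -reD; have := ler_normD v w; rewrite lecE => /andP[].
rewrite /v /w {v w}.
rewrite normrM !normc_def /= !expr0n !expr1n /=.
rewrite !addr0 !add0r sqrtr1 !sqrtr_sqr !mul1r /=.
have := ha n; have := hb n. 
by set t := Num.sqrt _; lra.
Qed.

Lemma real_part_le x : real_part x <= modulus x.
Proof.
rewrite /real_part /modulus; move: x; case: k => x; first exact: ler_norm.
exact: le_trans (ler_norm _) (normc_ge_ReIm (x : R[i]%C)).1.
Qed.

End scalars_theory.

(** * Seminorms, infima and quotients *)

Section seminorm_theory.
Context (R : realType) (k : scalar_kind).
Local Notation K := (scalars R k).
Context (V : lmodType K).
Implicit Types (x y : V) (q : V -> R).

(** For [a != 0] the reverse inequality is the given one for the inverse of [a]. *)
Lemma le_seminorm q :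
  (forall x y, q (x + y) <= q x + q y) ->
  (forall (a : K) x, q (a *: x) <= modulus a * q x) -> seminorm q.
Proof.
move=> qD qZ; split=> // a x; apply/eqP; rewrite eq_le qZ /=.
have [->|a0] := eqVneq a 0.
  by rewrite modulus0 mul0r scale0r; have := qD 0 0; rewrite addr0; lra.
have ma : 0 < modulus a.
  by rewrite lt_neqAle modulus_ge0 andbT eq_sym; apply: contra_neq a0 => /modulus_eq0.
rewrite mulrC -ler_pdivlMr// -modulusV mulrC.
by have := qZ a^-1 (a *: x); rewrite scalerA mulVf// scale1r.
Qed.

Section one_seminorm.
Context (q : V -> R) (sq : seminorm q).

Lemma seminormD x y : q (x + y) <= q x + q y. Proof. by case: sq. Qed.
Lemma seminormZ (a : K) x : q (a *: x) = modulus a * q x. Proof. by case: sq. Qed.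
Lemma seminorm0 : q 0 = 0.
Proof. by rewrite -(scale0r 0) seminormZ modulus0 mul0r. Qed.
Lemma seminormN x : q (- x) = q x.
Proof. by rewrite -scaleN1r seminormZ modulusN modulus1 mul1r. Qed.
Lemma seminorm_ge0 x : 0 <= q x.
Proof. by have := seminormD x (- x); rewrite subrr seminorm0 seminormN; lra. Qed.
Lemma seminormB x y : q (x - y) <= q x + q y.
Proof. by rewrite -(seminormN y) seminormD. Qed.
Lemma seminorm_distC x y : q (x - y) = q (y - x).
Proof. by rewrite -seminormN opprB. Qed.
Lemma seminorm_triangle z x y : q (x - y) <= q (x - z) + q (z - y).
Proof. by rewrite -{1}(subrK z x) -addrA seminormD. Qed.
Lemma seminorm_sub x y : q x - q y <= q (x - y).
Proof. by have := seminormD (x - y) y; rewrite subrK; lra. Qed.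
Lemma seminormZe r x : 0 <= r -> q (embed k r *: x) = r * q x.
Proof. by move=> r0; rewrite seminormZ modulus_embed ger0_norm. Qed.

(** Rescale [x] into the ball [q < e]. As [q x] may vanish, the scaling uses [q x + d] and [d] is
    then made small. *)
Lemma seminorm_bound (r : V -> R) (e c : R) : seminorm r -> 0 < e ->
  (forall x, q x < e -> r x <= c) -> forall x, r x <= c / e * q x.
Proof.
move=> sr e0 h x.
have rc d : 0 < d -> r x <= c / e * (q x + d).
  move=> d0; have qd : 0 < q x + d by have := seminorm_ge0 x; lra.
  have ed : 0 < e / (q x + d) by exact: divr_gt0.
  have := h (embed k (e / (q x + d)) *: x).
  rewrite (seminormZe _ (ltW ed)) (sr.2) modulus_embed ger0_norm ?(ltW ed)//.
  have -> : (e / (q x + d) * q x < e).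
    by rewrite mulrAC ltr_pdivrMr// ltr_pM2l//; lra.
  move=> /(_ isT); rewrite mulrAC ler_pdivrMr// => H.
  by rewrite mulrAC ler_pdivlMr// mulrC.
have [ce|ce] := ltP 0 (c / e).
  apply/ler_addgt0Pr => d d0; have := rc (d / (c / e)) (divr_gt0 d0 ce).
  by rewrite mulrDr (mulrC _ (d / _)) divfK// gt_eqF.
by have := rc 1 ltr01; rewrite mulrDr; lra.
Qed.

End one_seminorm.

Lemma seminorm_max q1 q2 : seminorm q1 -> seminorm q2 ->
  seminorm (fun x => Num.max (q1 x) (q2 x)).
Proof.
move=> s1 s2; split=> [x y|a x].
  rewrite ge_max; apply/andP; split.
    by apply: (le_trans (seminormD s1 x y)); rewrite lerD// le_max lexx.
  by apply: (le_trans (seminormD s2 x y)); rewrite lerD// le_max lexx orbT.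
by rewrite !seminormZ// maxr_pMr// modulus_ge0.
Qed.

Lemma seminorm_scale q (c : R) : 0 <= c -> seminorm q ->
  seminorm (fun x => c * q x).
Proof.
move=> c0 sq; split=> [x y|a x].
  by rewrite -mulrDr ler_wpM2l// seminormD.
by rewrite seminormZ// mulrCA.
Qed.

Section infimum.
Context (rel : V -> R -> Prop) (f : V -> R)
  (rel_ex : forall x, exists c, rel x c)
  (rel_lb : forall x c, rel x c -> f x <= c)
  (rel_add : forall x y c d, rel x c -> rel y d ->
     exists2 e, rel (x + y) e & e <= c + d).

(** One infimum serves four constructions: quotient seminorms, the lowering of a sublinear
    functional, lower bounds of chains in Zorn's lemma, and infimal convolutions. The lower bound
    [f] ensures that [inf] is a genuine infimum. *)
Definition inf_rel x := inf [set c | rel x c].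

Lemma inf_rel_le x c : rel x c -> inf_rel x <= c.
Proof. by move=> xc; apply: ge_inf => //; exists (f x) => d /rel_lb. Qed.

Lemma inf_rel_lt x d : inf_rel x < d -> exists2 c, rel x c & c < d.
Proof.
move=> /inf_lt[|c xc cd]; last by exists c.
by have [c xc] := rel_ex x; exists c.
Qed.

Lemma inf_relD x y : inf_rel (x + y) <= inf_rel x + inf_rel y.
Proof.
apply/ler_addgt0Pr => e e0.
have [c xc ce] : exists2 c, rel x c & c < inf_rel x + e / 2.
  by apply: inf_rel_lt; lra.
have [d yd de] : exists2 c, rel y c & c < inf_rel y + e / 2.
  by apply: inf_rel_lt; lra.
have [g xyg gcd] := rel_add xc yd.
by have := inf_rel_le xyg; lra.
Qed.

Lemma inf_relZ (a : K) (m : R) x : 0 <= m ->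
  (forall c, rel x c -> exists2 e, rel (a *: x) e & e <= m * c) ->
  inf_rel (a *: x) <= m * inf_rel x.
Proof.
move=> m0 h; apply/ler_addgt0Pr => e e0.
have [c xc ce] : exists2 c, rel x c & c < inf_rel x + e / (m + 1).
  by apply: inf_rel_lt; rewrite ltrDl divr_gt0//; lra.
have [g axg gc] := h _ xc.
apply: (le_trans (inf_rel_le axg)); apply: (le_trans gc).
apply: (@le_trans _ _ (m * (inf_rel x + e / (m + 1)))).
  by rewrite ler_wpM2l// ltW.
rewrite mulrDr lerD2l mulrCA ger_pMr// ler_pdivrMr; lra.
Qed.

End infimum.

Lemma inf_rel_seminorm (rel : V -> R -> Prop) :
  (forall x, exists c, rel x c) -> (forall x c, rel x c -> 0 <= c) ->
  (forall x y c d, rel x c -> rel y d -> exists2 e, rel (x + y) e & e <= c + d) ->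
  (forall (a : K) x c, rel x c ->
     exists2 e, rel (a *: x) e & e <= modulus a * c) ->
  seminorm (inf_rel rel).
Proof.
move=> ex lb add sc; apply: le_seminorm.
  exact: (inf_relD (f := fun=> 0)).
move=> a x; apply: (inf_relZ (f := fun=> 0)) => //; first exact: modulus_ge0.
by move=> c; exact: sc.
Qed.

Section quotient_seminorm.
Context (q : V -> R) (L : set V).
Hypotheses (sq : seminorm q) (L0 : L 0).
Hypothesis Llin : forall (a : K) x y, L x -> L y -> L (a *: x + y).

Definition quotient_rel x c := exists2 l, L l & c = q (x - l).
Definition quotient_seminorm := inf_rel quotient_rel.

Let ex x : exists c, quotient_rel x c.
Proof. by exists (q (x - 0)), 0. Qed.
Let lb x c : quotient_rel x c -> 0 <= c.
Proof. by move=> [l _ ->]; exact: seminorm_ge0. Qed.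

Lemma quotient_seminormP : seminorm quotient_seminorm.
Proof.
apply: inf_rel_seminorm => //.
  move=> x y _ _ [l Ll ->] [m Lm ->]; exists (q (x + y - (l + m))).
    by exists (l + m) => //; rewrite -(scale1r l); exact: Llin.
  by rewrite opprD addrACA seminormD.
move=> a x _ [l Ll ->]; exists (q (a *: x - a *: l)).
  by exists (a *: l) => //; rewrite -(addr0 (a *: l)); exact: Llin.
by rewrite -scalerBr seminormZ.
Qed.

Lemma quotient_seminorm_le x : quotient_seminorm x <= q x.
Proof. by apply: (inf_rel_le lb); exists 0 => //; rewrite subr0. Qed.

Lemma quotient_seminorm_eq0 x : L x -> quotient_seminorm x = 0.
Proof.
move=> Lx; apply/eqP; rewrite eq_le (seminorm_ge0 quotient_seminormP) andbT.
by apply: (inf_rel_le lb); exists x => //; rewrite subrr seminorm0.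
Qed.

Lemma quotient_seminorm_lt x c : quotient_seminorm x < c ->
  exists2 l, L l & q (x - l) < c.
Proof. by move=> /(inf_rel_lt ex)[_ [l Ll ->]]; exists l. Qed.

End quotient_seminorm.

(** * The Hahn-Banach theorem *)

(** Only positive real multiples are considered; the scalars of [K] come back in
    [linear_of_real_part]. *)
Definition real_sublinear (s : V -> R) :=
  (forall x y, s (x + y) <= s x + s y) /\
  (forall r x, 0 < r -> s (embed k r *: x) <= r * s x).

Section sublinear.
Context (s : V -> R) (ss : real_sublinear s).

Lemma real_sublinearZ r x : 0 < r -> s (embed k r *: x) = r * s x.
Proof.
move=> r0; apply/eqP; rewrite eq_le ss.2//= mulrC -ler_pdivlMr// mulrC.
have := ss.2 r^-1 (embed k r *: x); rewrite scalerA -rmorphM mulVf ?gt_eqF//.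
by rewrite rmorph1 scale1r invr_gt0; exact.
Qed.

Lemma real_sublinear0 : s 0 = 0.
Proof. by have := @real_sublinearZ 2 0 (ltr0Sn _ _); rewrite scaler0; lra. Qed.

Lemma real_sublinear_ge x : - s (- x) <= s x.
Proof. by have := ss.1 x (- x); rewrite subrr real_sublinear0; lra. Qed.

(* [x |-> inf_(t >= 0) s (x + t w) - t s w] is the usual way to lower [s]
   until it is linear in the direction [w]. *)
Definition lower_rel w x c :=
  exists2 t, 0 <= t & c = s (x + embed k t *: w) - t * s w.

Lemma lower_sublinear w : exists s', [/\ real_sublinear s',
  forall x, s' x <= s x & s' (- w) <= - s w].
Proof.
have sZ t x : 0 <= t -> s (embed k t *: x) = t * s x.
  rewrite le_eqVlt => /orP[/eqP<-|]; last exact: real_sublinearZ.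
  by rewrite rmorph0 scale0r real_sublinear0 mul0r.
have ex x : exists c, lower_rel w x c.
  by exists (s (x + embed k 0 *: w) - 0 * s w), 0.
have lb x c : lower_rel w x c -> - s (- x) <= c.
  move=> [t t0 ->]; have := ss.1 (x + embed k t *: w) (- x).
  by rewrite addrAC subrr add0r sZ//; lra.
exists (inf_rel (lower_rel w)); split.
- split.
    apply: (inf_relD ex lb) => // x y _ _ [t t0 ->] [u u0 ->].
    exists (s (x + y + embed k (t + u) *: w) - (t + u) * s w).
      by exists (t + u) => //; exact: addr_ge0.
    have := ss.1 (x + embed k t *: w) (y + embed k u *: w).
    by rewrite addrACA -scalerDl -rmorphD; lra.
  move=> r x r0; apply: (inf_relZ ex lb) => //; first exact: ltW.
  move=> _ [t t0 ->].
  exists (s (embed k r *: x + embed k (r * t) *: w) - r * t * s w).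
    by exists (r * t) => //; rewrite mulr_ge0// ltW.
  by rewrite rmorphM -scalerA -scalerDr sZ ?(ltW r0)// mulrBr mulrA.
- move=> x; apply: (inf_rel_le lb); exists 0 => //.
  by rewrite rmorph0 scale0r addr0 mul0r subr0.
- apply: (inf_rel_le lb); exists 1 => //.
  by rewrite rmorph1 scale1r addNr real_sublinear0; lra.
Qed.

End sublinear.

(** Zorn's lemma for the reversed pointwise order. The infimum of a chain is finite because each
    member [a] satisfies [- p (- x) <= a x]; it is subadditive because, of two members, the smaller
    one bounds both terms. *)
Lemma minimal_sublinear p : real_sublinear p ->
  exists m, [/\ real_sublinear m, forall x, m x <= p x &
    forall s, real_sublinear s -> (forall x, s x <= m x) -> s = m].
Proof.
move=> sp.
pose T := {s : V -> R | real_sublinear s /\ forall x, s x <= p x}.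
pose rel (a b : T) := `[< forall x, sval b x <= sval a x >].
have [||||[m [sm mp]] mmin] := @Zorn T rel.
- by move=> t; apply/asboolP.
- move=> a b c /asboolP ab /asboolP bc; apply/asboolP => x.
  exact: le_trans (bc x) (ab x).
- move=> [a pa] [b pb] /asboolP ab /asboolP ba; apply: eq_exist.
  by apply/funext => x; apply/eqP; rewrite eq_le ba ab.
- move=> A totA; have [[a0 Aa0]|A0] := pselect (exists a, A a); last first.
    exists (exist _ p (conj sp (fun=> lexx _))) => a Aa.
    by case: A0; exists a.
  pose rl x c := exists2 a, A a & c = sval a x.
  have ex x : exists c, rl x c by exists (sval a0 x), a0.
  have lb x c : rl x c -> - p (- x) <= c.
    move=> [[a [sa ap]] _ ->] /=; apply: le_trans (real_sublinear_ge sa x).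
    by rewrite lerN2.
  have si : real_sublinear (inf_rel rl).
    split.
      apply: (inf_relD ex lb) => // x y _ _ [a Aa ->] [b Ab ->].
      have [/asboolP ab|/asboolP ba] := totA _ _ Aa Ab.
        exists (sval b (x + y)); first by exists b.
        by apply: (le_trans ((svalP b).1.1 x y)); rewrite lerD2r.
      exists (sval a (x + y)); first by exists a.
      by apply: (le_trans ((svalP a).1.1 x y)); rewrite lerD2l.
    move=> r x r0; apply: (inf_relZ ex lb) => //; first exact: ltW.
    move=> _ [a Aa ->]; exists (sval a (embed k r *: x)); first by exists a.
    exact: (svalP a).1.2.
  have ip x : inf_rel rl x <= p x.
    apply: le_trans ((svalP a0).2 x).
    by apply: (inf_rel_le lb); exists a0.
  exists (exist _ (inf_rel rl) (conj si ip) : T) => a Aa; apply/asboolP => x /=.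
  by apply: (inf_rel_le lb); exists a.
exists m; split=> // s ss sm'.
have sp' x : s x <= p x by exact: le_trans (sm' x) (mp x).
have : rel (exist _ m (conj sm mp) : T) (exist _ s (conj ss sp') : T).
  by apply/asboolP.
by move=> /mmin /(congr1 sval).
Qed.

(** In the complex case a functional is recovered from its real part as [m x - i m (i x)]. *)
Lemma linear_of_real_part (m : V -> R) : (forall x y, m (x + y) = m x + m y) ->
  (forall r x, m (embed k r *: x) = r * m x) ->
  exists psi : V -> K^o, linear psi /\ forall x, real_part (psi x) = m x.
Proof.
move: V m; rewrite /embed /real_part; case: k => /= W m mD mZ.
  by exists m; split => // a x y; rewrite mD mZ.
have mN (x : W) : m (- x) = - m x.
  by have := mZ (-1) x; rewrite rmorphN rmorph1 scaleN1r mulN1r.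
exists (fun x : W => Complex (m x) (- m ('i%C *: x))); split=> // [[c d]] x y.
have aE (z : W) : Complex c d *: z = c%:C%C *: z + d%:C%C *: ('i%C *: z).
  by rewrite scalerA -scalerDl; congr (_ *: _); apply/eqP;
    rewrite eq_complex /=; apply/andP; split; apply/eqP; simpc.
have iE (z : W) : 'i%C *: (Complex c d *: z) = c%:C%C *: ('i%C *: z) - d%:C%C *: z.
  rewrite aE scalerDr !scalerA -scaleNr; congr (_ *: _ + _ *: _).
    by rewrite mulrC.
  by apply/eqP; rewrite eq_complex /=; apply/andP; split; apply/eqP; simpc.
rewrite scalerDr !iE !mD aE mD mN !mZ.
apply/eqP; rewrite eq_complex /=; apply/andP; split; apply/eqP; ring.
Qed.

(** A minimal sublinear functional cannot be lowered in any direction, so it is odd, and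
    subadditivity then makes it additive. Lowering [q] in the direction [v] beforehand forces the
    value at [v] to reach [q v]. *)
Theorem hahn_banach q v : seminorm q ->
  exists psi : V -> K^o, [/\ linear psi,
    forall x, modulus (psi x) <= q x & modulus (psi v) = q v].
Proof.
move=> sq; have rq : real_sublinear q.
  split; first exact: seminormD.
  by move=> r x r0; rewrite seminormZe//; exact: ltW.
have [p [sp pq pv]] := lower_sublinear rq v.
have [m [sm mp mmin]] := minimal_sublinear sp.
have mN w : m (- w) = - m w.
  have [s [ss sm' sw]] := lower_sublinear sm w.
  have := real_sublinear_ge sm w; have := sw; rewrite (mmin s ss sm').
  by move=> *; apply/eqP; rewrite eq_le; apply/andP; split; lra.
have mD x y : m (x + y) = m x + m y.
  have := sm.1 x y; have := sm.1 (- x) (- y); rewrite -opprD !mN => *.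
  by apply/eqP; rewrite eq_le; apply/andP; split; lra.
have mZ r x : m (embed k r *: x) = r * m x.
  case: (ltgtP r 0) => [r0|r0|->].
  - rewrite -(opprK r) rmorphN scaleNr mN real_sublinearZ ?oppr_gt0//.
    by rewrite !mulNr.
  - exact: real_sublinearZ.
  - by rewrite rmorph0 scale0r mul0r real_sublinear0.
have [psi [lpsi psim]] := linear_of_real_part mD mZ.
have psiq x : modulus (psi x) <= q x.
  have [px0|px0] := eqVneq (psi x) 0.
    by rewrite px0 modulus0 seminorm_ge0.
  have mp0 : 0 < modulus (psi x).
    rewrite lt_neqAle modulus_ge0 andbT eq_sym.
    by apply: contra_neq px0 => /modulus_eq0.
  (* Multiplying by this [a] of modulus 1 turns [psi x] into a nonnegative real, which is controlled
     by the real part alone. *)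
  pose a : K := embed k (modulus (psi x)) / psi x.
  have a1 : modulus a = 1.
    rewrite /a modulusM modulusV modulus_embed ger0_norm ?(ltW mp0)//.
    by rewrite mulfV// gt_eqF.
  have psia : psi (a *: x) = embed k (modulus (psi x)).
    have := lpsi a x 0; rewrite addr0 => ->.
    have -> : psi 0 = 0 by have := lpsi (-1) 0 0; rewrite scaler0 addr0 scaleN1r addNr.
    by rewrite addr0 /a /GRing.scale /= divfK.
  have re_embed (r : R) : real_part (embed k r) = r.
    by rewrite /real_part /embed; case: (k).
  rewrite -[leLHS]re_embed -psia psim.
  apply: le_trans (mp _) _; apply: le_trans (pq _) _.
  by rewrite seminormZ// a1 mul1r.
exists psi; split=> //; apply/eqP; rewrite eq_le psiq /=.
apply: le_trans (real_part_le _); rewrite psim.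
by have := mp (- v); rewrite mN; lra.
Qed.

End seminorm_theory.

(** * Topologies generated by directed families of seminorms *)

Section generated.
Context (R : realType) (k : scalar_kind).
Local Notation K := (scalars R k).

(** A neighbourhood must contain a ball of a single member of [P], with no finite intersection;
    directed families provide this, and it shortens every later estimate. *)
Definition generated_by (X : preTopologicalLmodType K) (P : set (X -> R)) :=
  (forall p, P p -> seminorm p) /\
  forall (x : X) (U : set X), nbhs x U <->
    exists p (e : R), [/\ P p, 0 < e & forall y, p (y - x) < e -> U y].

Lemma directed_finite (T : Type) (G B : set (T -> R)) :
  directed G -> finite_set B -> B `<=` G ->
  exists2 q, G q & forall b, B b -> forall x, b x <= q x.
Proof.
move=> [[g Gg] dG] /finite_seqP[s ->]; elim: s => [|a s IHs] sG.
  by exists g.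
have [|q Gq qb] := IHs; first by move=> b bs; apply: sG; rewrite /= in_cons bs orbT.
have [|q' Gq' qq'] := dG a q _ Gq; first by apply: sG; rewrite /= mem_head.
exists q' => // b; rewrite /= in_cons => /orP[/eqP->|bs] x.
  by have [] := qq' x.
by apply: le_trans (qb _ bs x) _; have [] := qq' x.
Qed.

Lemma generated_by_open (X : preTopologicalLmodType K) (G : set (X -> R)) :
  directed G -> (forall q, G q -> seminorm q) ->
  open = opens (seminorm_topology G) :> set (set X) -> generated_by G.
Proof.
move=> dG sG oE; split=> // x U; rewrite nbhsE; split.
  move=> [A [oA Ax] AU]; move: oA; rewrite oE => /(_ _ Ax)[B [e [fB BG e0 hB]]].
  have [q Gq qB] := directed_finite dG fB BG.
  exists q, e; split=> // y yx; apply/AU/hB => b Bb.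
  by apply: le_lt_trans (qB b Bb _) yx.
move=> [p [e [Gp e0 pU]]]; exists [set y | p (y - x) < e] => //.
have sp := sG _ Gp.
split; last by rewrite /= subrr seminorm0.
rewrite oE => y /= yx; exists [set p], (e - p (y - x)); split.
- exact: finite_set1.
- by move=> _ ->.
- by rewrite subr_gt0.
- move=> z /(_ p erefl) zy /=.
  by apply: (le_lt_trans (seminorm_triangle sp y _ _)); lra.
Qed.

Lemma generated_seminorm_topology (V : lmodType K) (G : set (V -> R)) :
  directed G -> (forall q, G q -> seminorm q) ->
  generated_by (G : set (V \with seminorm_topology G -> R)).
Proof. by move=> dG sG; apply: generated_by_open. Qed.

Lemma generated_scalars :
  generated_by ([set @modulus R k] : set (K^o -> R)).
Proof.
split=> [_ ->|x U].
  by split; [exact: modulusD | move=> a y; exact: modulusM].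
rewrite nbhs_scalar; split=> [[e e0 eU]|[p [e [-> e0 pU]]]].
  by exists (@modulus R k), e.
by exists e.
Qed.

Section one_space.
Context (X : preTopologicalLmodType K) (P : set (X -> R)).
Hypothesis XP : generated_by P.

Lemma nbhs_ball_generated p (x : X) (e : R) : P p -> 0 < e ->
  nbhs x [set y | p (y - x) < e].
Proof. by move=> Pp e0; apply/XP.2; exists p, e. Qed.

Lemma nbhs_generated (x : X) U : nbhs x U ->
  exists p (e : R), [/\ P p, 0 < e & forall y, p (y - x) < e -> U y].
Proof. by move/XP.2. Qed.

Lemma closed_ge_generated (r p : X -> R) (M c : R) :
  P p -> seminorm r -> (forall x, r x <= M * p x) -> closed [set x | c <= r x].
Proof.
move=> Pp sr rp x clx /=; rewrite leNgt; apply/negP => rx.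
(* [M] may be negative or zero; this constant is positive and at least [M]. *)
have M0 : 0 < `|M| + 1 by have := normr_ge0 M; lra.
have [|y [/= cy yx]] := clx [set y | p (y - x) < (c - r x) / (`|M| + 1)].
  by apply: nbhs_ball_generated; rewrite // divr_gt0 ?subr_gt0.
move: yx; rewrite ltr_pdivlMr// => yx.
have := seminorm_sub sr y x; have := rp (y - x).
have := seminorm_ge0 (XP.1 _ Pp) (y - x).
by have := ler_norm M; nra.
Qed.

Lemma closed_ball_generated (r p : X -> R) (M c : R) (a : X) :
  P p -> seminorm r -> (forall x, r x <= M * p x) ->
  closed [set x | r (x - a) <= c].
Proof.
move=> Pp sr rp x clx /=; rewrite leNgt; apply/negP => rx.
have M0 : 0 < `|M| + 1 by have := normr_ge0 M; lra.
have [|y [/= cy yx]] := clx [set y | p (y - x) < (r (x - a) - c) / (`|M| + 1)].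
  by apply: nbhs_ball_generated; rewrite // divr_gt0 ?subr_gt0.
move: yx; rewrite ltr_pdivlMr// => yx.
have := seminorm_triangle sr y x a; have := rp (y - x).
rewrite (seminorm_distC sr x y).
have := seminorm_ge0 (XP.1 _ Pp) (y - x).
by have := ler_norm M; nra.
Qed.

Lemma closed_le_generated (r p : X -> R) (M c : R) :
  P p -> seminorm r -> (forall x, r x <= M * p x) -> closed [set x | r x <= c].
Proof.
move=> Pp sr rp; have := closed_ball_generated (c := c) (a := 0) Pp sr rp.
by under eq_set do rewrite subr0.
Qed.

Lemma generated_hausdorff :
  (forall x, (forall p, P p -> p x = 0) -> x = 0) -> hausdorff_space X.
Proof.
move=> sep x y clxy; apply/eqP; rewrite -subr_eq0; apply/eqP/sep => p Pp.
have sp := XP.1 _ Pp.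
apply/eqP; rewrite eq_le (seminorm_ge0 sp) andbT.
apply/ler_addgt0Pr => e e0; have e20 : 0 < e / 2 by lra.
have [z [/= zx zy]] := clxy _ _ (nbhs_ball_generated x Pp e20)
  (nbhs_ball_generated y Pp e20).
rewrite (seminorm_distC sp) in zx.
by have := seminorm_triangle sp z x y; lra.
Qed.

Lemma generated_linear : linear_topology X.
Proof.
split.
  move=> [x y] U /= /nbhs_generated[p [e [Pp e0 pU]]].
  have e20 : 0 < e / 2 by lra.
  exists ([set z | p (z - x) < e / 2], [set z | p (z - y) < e / 2]).
    by split; exact: nbhs_ball_generated.
  move=> [z w] /= [zx wy]; apply: pU => /=; rewrite opprD addrACA.
  by have := seminormD (XP.1 _ Pp) (z - x) (w - y); lra.
move=> [a x] U /= /nbhs_generated[p [e [Pp e0 pU]]].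
have sp := XP.1 _ Pp.
have px := seminorm_ge0 sp x; have ma := modulus_ge0 (a : K).
(* The increment is at most [d] times [modulus a + d + p x]; the summand [e] in the denominator
   gives [d < 1]. *)
pose d := e / 2 / (p x + modulus (a : K) + 1 + e).
have d0 : 0 < d by rewrite /d !divr_gt0//; lra.
have d1 : d < 1 by rewrite /d ltr_pdivrMr; lra.
have dE : d * (p x + modulus (a : K) + 1 + e) = e / 2.
  by rewrite /d divfK// gt_eqF//; lra.
exists ([set b : K^o | modulus (b - a : K) < d], [set z | p (z - x) < d]).
  split; last exact: nbhs_ball_generated.
  by apply/nbhs_scalar; exists d.
move=> [b y] /= [ba yx]; apply: pU => /=.
have -> : b *: y - a *: x = b *: (y - x) + (b - a) *: x.
  by rewrite scalerBr scalerBl addrA subrK.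
apply: (le_lt_trans (seminormD sp _ _)); rewrite !seminormZ//.
have mb : modulus (b : K) <= modulus (a : K) + d.
  by rewrite -{1}(subrK a b) addrC; apply: le_trans (modulusD _ _) _; lra.
have py := seminorm_ge0 sp (y - x); have mba := modulus_ge0 (b - a : K).
by nra.
Qed.

Lemma generated_locally_convex : locally_convex_topology X.
Proof.
split; first exact: generated_linear.
exists [set B | open B /\ convex_set B]; first by move=> b; rewrite inE => -[].
split; first by move=> B [].
move=> x U /nbhs_generated[p [e [Pp e0 pU]]]; have sp := XP.1 _ Pp.
exists [set y | p (y - x) < e] => //; split; last by rewrite /= subrr seminorm0.
split.
  rewrite openE => y /= yx; rewrite /interior.
  apply: filterS (@nbhs_ball_generated p y (e - p (y - x)) Pp _);
    last by rewrite subr_gt0.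
  by move=> z /= zy; apply: (le_lt_trans (seminorm_triangle sp y _ _)); lra.
apply/convex_setW => y z; rewrite !inE /= => yx zx t t0 t1.
rewrite inE; change (p (t%:num *: (y : X) + (1 - t%:num) *: (z : X) - x) < e).
move: t0 t1; move: (t%:num : K) => s t0 t1.
have -> : s *: (y : X) + (1 - s) *: (z : X) - x =
    s *: (y - x : X) + (1 - s) *: (z - x : X).
  rewrite !scalerBr addrACA; congr (_ + _).
  by rewrite -opprD -scalerDl addrCA subrr addr0 scale1r.
apply: (le_lt_trans (seminormD sp _ _)); rewrite !seminormZ//.
(* In the order of [K], positive scalars are real, so the moduli of [s] and [1 - s] add up to 1 in
   the complex case too. *)
have t1' : 0 < 1 - s by rewrite subr_gt0.
have mt : 0 < modulus (s : K).
  by rewrite -(embed_lt k) rmorph0 embed_modulus// ltW.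
have -> : modulus (1 - s : K) = 1 - modulus (s : K).
  apply: (@embed_inj _ k).
  by rewrite rmorphB rmorph1 /= !embed_modulus ?(ltW t0) ?(ltW t1').
have mt1 : modulus (s : K) < 1.
  by rewrite -(embed_lt k) rmorph1 embed_modulus// ltW.
by nra.
Qed.

Lemma generated_cvg (F : set_system X) (x : X) : Filter F ->
  (forall p e, P p -> 0 < e -> F [set y | p (y - x) < e]) <-> F --> x.
Proof.
move=> FF; split=> [h U /nbhs_generated[p [e [Pp e0 pU]]]|h p e Pp e0].
  exact: filterS (h _ _ Pp e0).
by apply: h; exact: nbhs_ball_generated.
Qed.

Lemma generated_complete :
  (forall F : set_system X, ProperFilter F ->
     (forall p e, P p -> 0 < e ->
        exists2 A, F A & forall x y, A x -> A y -> p (x - y) < e) ->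
     exists x, forall p e, P p -> 0 < e -> F [set y | p (y - x) < e]) <->
  complete_tvs X.
Proof.
split=> [h F PF Fc|h F PF Fc].
  have [p e Pp e0|x hx] := h F PF.
    have [A FA hA] := Fc _ (nbhs_ball_generated 0 Pp e0).
    by exists A => // x y Ax Ay; have /= := hA x y Ax Ay; rewrite subr0.
  by exists x; apply/generated_cvg.
have [U /nbhs_generated[p [e [Pp e0 pU]]]|x Fx] := h F PF.
  have [A FA hA] := Fc p e Pp e0; exists A => // x y Ax Ay; apply: pU.
  by rewrite subr0; exact: hA.
by exists x => p e Pp e0; apply: Fx; exact: nbhs_ball_generated.
Qed.

End one_space.

Lemma generated_continuous (X Y : preTopologicalLmodType K)
    (P : set (X -> R)) (Q : set (Y -> R)) (f : X -> Y) :
  generated_by P -> generated_by Q -> linear f ->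
  (forall q, Q q -> exists p M, P p /\ forall x, q (f x) <= M * p x) <->
  continuous f.
Proof.
move=> XP YQ lf.
have fB x y : f (x - y) = f x - f y.
  by rewrite addrC -scaleN1r lf scaleN1r addrC.
split=> [h x U /(nbhs_generated YQ)[q [e [Qq e0 qU]]]|cf q Qq].
  have [p [M [Pp hM]]] := h _ Qq.
  have M0 : 0 < `|M| + 1 by have := normr_ge0 M; lra.
  have eM : 0 < e / (`|M| + 1) by rewrite divr_gt0.
  apply: filterS (nbhs_ball_generated XP x Pp eM) => y /=.
  rewrite ltr_pdivlMr// => yx; apply: qU; rewrite -fB.
  have := hM (y - x); have := seminorm_ge0 (XP.1 _ Pp) (y - x).
  by have := ler_norm M; nra.
have sq := YQ.1 _ Qq.
have f0 : f 0 = 0 by rewrite -(subrr (0 : X)) fB subrr.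
have [p [e [Pp e0 pq]]] := nbhs_generated XP
  (cf 0 _ (nbhs_ball_generated YQ (f 0) Qq ltr01)).
exists p, (1 / e); split=> //; apply: (seminorm_bound (XP.1 _ Pp)) => //.
  split=> [x y|a x].
    by rewrite -{1}(scale1r x) lf scale1r seminormD.
  by rewrite -(addr0 (a *: x)) lf f0 addr0 seminormZ.
by move=> x xe; have /= := pq x; rewrite f0 !subr0 => /(_ xe)/ltW.
Qed.

(** The last two hypotheses compare [N] with the seminorms [sup_A q] in both directions. They use
    upper bounds [c] in place of suprema, so that no finiteness has to be known. This serves both
    the dual and the epsilon-product. *)
Lemma generated_uniform (M : lmodType K) (D : Type)
    (Y : preTopologicalLmodType K) (ev : M -> D -> Y) (S : set (set D))
    (Q : set (Y -> R)) (N : set (M -> R)) :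
  generated_by Q -> (forall x, linear (ev^~ x)) ->
  directed N -> directed Q -> (forall nu, N nu -> seminorm nu) ->
  (forall A q, S A -> Q q -> exists nu C, [/\ N nu, 0 < C &
     forall v x, A x -> q (ev v x) <= C * nu v]) ->
  (forall nu, N nu -> exists A q C, [/\ S A, Q q, 0 < C &
     forall v c, 0 <= c -> (forall x, A x -> q (ev v x) <= c) ->
       nu v <= C * c]) ->
  generated_by (N : set (M \with uniform_convergence_topology ev S -> R)).
Proof.
move=> YQ lev dN dQ sN hA hN.
have evB u v x : ev (u - v) x = ev u x - ev v x.
  by rewrite addrC -scaleN1r lev scaleN1r addrC.
have hB (s : seq (set D)) q : [set` s] `<=` S -> Q q -> exists nu C,
    [/\ N nu, 0 < C &
     forall A v x, A \in s -> A x -> q (ev v x) <= C * nu v].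
  move=> + Qq; elim: s => [_|A s IHs sS].
    by have [[nu Nnu] _] := dN; exists nu, 1; split.
  have [|nu1 [C1 [N1 C10 h1]]] := IHs.
    by move=> B Bs; apply: sS; rewrite /= in_cons Bs orbT.
  have [|nu2 [C2 [N2 C20 h2]]] := hA A q _ Qq.
    by apply: sS; rewrite /= mem_head.
  have [nu Nnu le_nu] := dN.2 _ _ N1 N2.
  exists nu, (C1 + C2); split=> //; first lra.
  move=> B v x; have nuv := seminorm_ge0 (sN _ Nnu) v.
  have [nu1v nu2v] := le_nu v.
  have nu1v0 := seminorm_ge0 (sN _ N1) v; have nu2v0 := seminorm_ge0 (sN _ N2) v.
  rewrite in_cons => /orP[/eqP->|Bs] Bx.
    by have := h2 v x Bx; nra.
  by have := h1 _ v x Bs Bx; nra.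
split=> // u U; rewrite nbhsE; split.
  move=> [W [oW Wu] WU]; have [B [V [/finite_seqP[s ->] sS V0 hV]]] := oW u Wu.
  have [q [e [Qq e0 qV]]] := nbhs_generated YQ V0.
  have [nu [C [Nnu C0 hC]]] := hB s q sS Qq.
  exists nu, (e / C); split=> //; first by rewrite divr_gt0.
  move=> v; rewrite ltr_pdivlMr// mulrC => vu; apply/WU/hV => A As x Ax.
  by apply: qV; rewrite subr0 -evB; exact: le_lt_trans (hC A _ x As Ax) vu.
move=> [nu [e [Nnu e0 hnu]]]; have snu := sN _ Nnu.
exists [set v | nu (v - u) < e] => //; split; last by rewrite /= subrr seminorm0.
move=> w /= wu; have [A [q [C [SA Qq C0 hC]]]] := hN _ Nnu.
pose d := (e - nu (w - u)) / 2 / C.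
have d0 : 0 < d by rewrite /d !divr_gt0// subr_gt0.
have dC : C * d = (e - nu (w - u)) / 2 by rewrite /d mulrC divfK// gt_eqF.
exists [set A], [set y | q (y - 0) < d]; split.
- exact: finite_set1.
- by move=> _ ->.
- exact: (nbhs_ball_generated YQ).
- move=> v /(_ A erefl) /= hv.
  have : nu (v - w) <= C * d.
    apply: hC; first exact: ltW.
    by move=> x Ax; rewrite evB -[_ - _]subr0 ltW// hv.
  by rewrite dC; have := seminorm_triangle snu w v u; lra.
Qed.

Lemma complete_isomorphism (X Y : preTopologicalLmodType K) (f : X -> Y) :
  topological_isomorphism f -> complete_tvs X -> complete_tvs Y.
Proof.
move=> [lf cf [g [fg gf cg]]] cX F PF Fc.
have fB x y : f (x - y) = f x - f y.
  by rewrite addrC -scaleN1r lf scaleN1r addrC.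
have gB x y : g (x - y) = g x - g y by rewrite -(gf x) -(gf y) -fB !fg.
have g0 : g 0 = 0 by rewrite -(subrr (0 : Y)) gB subrr.
have [U U0|x Fx] := cX (g @ F) (fmap_proper_filter g PF).
  have [A FA hA] : exists2 A, F A & forall x y, A x -> A y -> U (g (x - y)).
    by apply: (Fc (g @^-1` U)); apply: (cg 0 U); rewrite g0.
  exists (f @^-1` A); first by apply: (@filterS _ F _ A) => // y Ay /=; rewrite gf.
  by move=> x y /= Ax Ay; have := hA _ _ Ax Ay; rewrite -fB fg.
exists (f x) => U /cf /Fx FU.
by apply: (@filterS _ F _ _ _ _ FU) => y /=; rewrite gf.
Qed.

Section compactness.
Context (T : topologicalType).

(** The finite intersection property for a directed family: the sets [C] meet [A i] form a filter
    base, and a cluster point in [C] lies in each closed [A i]. *)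
Lemma compact_directed_meet (I : Type) (D : set I) (C : set T)
    (A : I -> set T) :
  compact C -> D !=set0 ->
  (forall i j, D i -> D j -> exists2 l, D l & A l `<=` A i `&` A j) ->
  (forall i, D i -> closed (A i)) -> (forall i, D i -> C `&` A i !=set0) ->
  exists2 x, C x & forall i, D i -> A i x.
Proof.
move=> cC [i0 Di0] dA clA mA.
have PF : ProperFilter (filter_from D (fun i => C `&` A i)).
  apply: filter_from_proper; last exact: mA.
  apply: filter_from_filter; first by exists i0.
  move=> i j Di Dj; have [l Dl lA] := dA i j Di Dj.
  by exists l => // x [Cx /lA[]].
have [|x [Cx clx]] := cC _ PF; first by exists i0 => // x [].
exists x => // i Di; apply: clA => // U Ux.
have [|y [[_ Ay] Uy]] := clx (C `&` A i) U _ Ux; first by exists i.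
by exists y.
Qed.

End compactness.
End generated.

(** * Mixed and submixed topologies *)

Section null_sequences.
Context (R : realType).

Lemma null_sequenceP (a : nat -> R) : (forall n, 0 <= a n) ->
  (a : nat -> R^o) @ \oo --> (0 : R^o) <->
  forall e, 0 < e -> exists n0, forall n, (n0 <= n)%N -> a n < e.
Proof.
move=> a0; split=> [/cvgrPdist_lt h e e0|h].
  have [n0 _ hn] := h e e0; exists n0 => n nn0.
  by have := hn n nn0; rewrite /= sub0r normrN ger0_norm.
apply/cvgrPdist_lt => e e0; have [n0 hn] := h e e0.
by exists n0 => // n /hn; rewrite /= sub0r normrN ger0_norm.
Qed.

Lemma null_sequence_harmonic :
  ((fun n => n.+1%:R^-1) : nat -> R^o) @ \oo --> (0 : R^o).
Proof.
apply/null_sequenceP => // e e0.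
have [n hn] : exists n : nat, e^-1 < n%:R.
  by exists (Num.truncn e^-1).+1; rewrite truncnS_gt.
exists n => m nm; rewrite invf_plt ?posrE//.
by apply: (lt_trans hn); rewrite ltr_nat ltnS.
Qed.

Lemma null_sequence_interleave (a b : nat -> R) :
  (forall n, 0 <= a n) -> (forall n, 0 <= b n) ->
  (a : nat -> R^o) @ \oo --> (0 : R^o) -> (b : nat -> R^o) @ \oo --> (0 : R^o) ->
  ((fun n => if odd n then b n./2 else a n./2) : nat -> R^o) @ \oo --> (0 : R^o).
Proof.
move=> a0 b0 /(null_sequenceP a0) ha /(null_sequenceP b0) hb.
apply/null_sequenceP => [n|e e0]; first by case: ifP.
have [n1 h1] := ha e e0; have [n2 h2] := hb e e0.
exists (n1 + n2)%N.*2 => n hn.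
have hn2 : (n1 + n2 <= n./2)%N by rewrite -(doubleK (n1 + n2)%N) half_leq.
case: ifP => _; first by apply/h2/(leq_trans _ hn2)/leq_addl.
by apply/h1/(leq_trans _ hn2)/leq_addr.
Qed.

End null_sequences.

Section coarser_generated.
Context (R : realType) (k : scalar_kind).
Local Notation K := (scalars R k).
Context (V : lmodType K).
Implicit Types s t : topology V.

Lemma opensP t (U : set V) :
  opens t U <-> forall x, U x -> nbhs (x : V \with t) U.
Proof.
have -> : opens t U = open (U : set (V \with t)) by [].
by rewrite openE.
Qed.

Lemma closed_coarser s t (A : set V) : coarser s t ->
  closed (A : set (V \with s)) -> closed (A : set (V \with t)).
Proof. by move=> st; rewrite -!openC; exact: st. Qed.

Lemma coarser_generated s t (P Q : set (V -> R)) :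
  generated_by (P : set (V \with s -> R)) ->
  generated_by (Q : set (V \with t -> R)) ->
  (forall p, P p -> exists q M, Q q /\ forall x, p x <= M * q x) ->
  coarser s t.
Proof.
move=> sP tQ h U /opensP hU; apply/opensP => x /hU.
move=> /(nbhs_generated sP)[p [e [Pp e0 pU]]].
have [q [M [Qq hM]]] := h p Pp.
have M0 : 0 < `|M| + 1 by have := normr_ge0 M; lra.
have eM : 0 < e / (`|M| + 1) by rewrite divr_gt0.
apply: filterS (nbhs_ball_generated tQ x Qq eM) => y /=.
rewrite ltr_pdivlMr// => yx; apply: pU.
have := hM (y - x); have := seminorm_ge0 (tQ.1 _ Qq) (y - x).
by have := ler_norm M; nra.
Qed.

End coarser_generated.

Section saks.
Context (R : realType) (k : scalar_kind).
Local Notation K := (scalars R k).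
Context (V : lmodType K) (nrm : V -> R) (G : set (V -> R)).
Hypotheses (snrm : seminorm nrm) (dG : directed G)
  (sG : forall q, G q -> seminorm q)
  (Gle : forall q, G q -> forall x, q x <= nrm x)
  (Gsup : forall x c, c < nrm x -> exists2 q, G q & c < q x).

Definition nball (c : R) := [set x | nrm x <= c].

(** Continuity on the unit ball is asked at 0 only. Differences of points of a ball stay in a larger
    ball, so by scaling this controls [r] on all bounded sets. *)
Definition mixed_seminorm (r : V -> R) := seminorm r /\
  forall e, 0 < e -> exists q d, [/\ G q, 0 < d &
    forall x, nrm x <= 1 -> q x < d -> r x < e].

Lemma mixed_seminorm_bounded r c e : mixed_seminorm r -> 0 < c -> 0 < e ->
  exists q d, [/\ G q, 0 < d & forall x, nrm x <= c -> q x < d -> r x < e].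
Proof.
move=> [sr hr] c0 e0; have [q [d [Gq d0 h]]] := hr (e / c) (divr_gt0 e0 c0).
exists q, (c * d); split; rewrite ?mulr_gt0// => x xc qx.
have c0' := ltW c0; have ci : 0 <= c^-1 by rewrite invr_ge0.
have := h (embed k c^-1 *: x); rewrite !seminormZe//; last exact: sG.
rewrite ![c^-1 * _]mulrC ler_pdivrMr// mul1r ltr_pdivrMr// (mulrC d).
by rewrite ltr_pM2r ?invr_gt0//; exact.
Qed.

Lemma mixed_seminorm_le r : mixed_seminorm r ->
  exists M, forall x, r x <= M * nrm x.
Proof.
move=> [sr hr]; have [q [d [Gq d0 h]]] := hr 1 ltr01.
exists (1 / Num.min 1 d); apply: seminorm_bound => //.
  by rewrite lt_min ltr01.
move=> x; rewrite lt_min => /andP[x1 xd]; apply/ltW/h; first exact: ltW.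
by apply: le_lt_trans xd; exact: Gle.
Qed.

Lemma mixed_seminorm_generating q : G q -> mixed_seminorm q.
Proof. by move=> Gq; split; [exact: sG | move=> e e0; exists q, e]. Qed.

Lemma norm_topology_generated :
  generated_by ([set nrm] : set (V \with norm_topology nrm -> R)).
Proof.
apply: generated_seminorm_topology => [|_ ->//].
by split; [exists nrm | move=> _ _ -> ->; exists nrm].
Qed.

Lemma mixed_candidate_seminorms (t : topology V) (P : set (V -> R)) :
  generated_by (G : set (V \with t -> R)) ->
  directed P -> (forall p, P p -> mixed_seminorm p) ->
  (forall q, G q -> exists p M, P p /\ forall x, q x <= M * p x) ->
  mixed_candidate nrm t (seminorm_topology P).
Proof.
move=> tG dP mP GP.
have gP : generated_by (P : set (V \with seminorm_topology P -> R)).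
  by apply: generated_seminorm_topology => // p /mP[].
have tP : coarser t (seminorm_topology P) by apply: coarser_generated tG gP GP.
split=> //.
- exact: generated_linear gP.
- move=> B [C hC]; apply/seteqP; split=> _ [U oU <-]; last first.
    by exists U => //; exact: tP.
  (* [W] collects the points, in [B] or not, having a ball of some [q] in [G] whose trace on [B]
     lies in [U]. Halving radii shows that [W] is open for [t], and it has the same trace on [B] as
     [U]. *)
  pose W := [set x : V | exists q d, [/\ G q, 0 < d &
    forall y, B y -> q (y - x) < d -> U y]].
  exists W; last first.
    apply/seteqP; split=> x [Wx Bx]; split=> //.
      move: Wx => [q [d [Gq d0]]]; apply=> //.
      by rewrite subrr seminorm0//; exact: sG.
    move/opensP: oU => /(_ x Wx) /(nbhs_generated gP)[p [e [Pp e0 pU]]].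
    have C0 : 0 < C + C + 1.
      by have := hC x Bx; have := seminorm_ge0 snrm x; lra.
    have [q [d [Gq d0 h]]] := mixed_seminorm_bounded (mP _ Pp) C0 e0.
    exists q, d; split=> // y By yx; apply/pU/h => //.
    apply: le_trans (seminormB snrm _ _) _.
    by have := hC x Bx; have := hC y By; lra.
  apply/opensP => x [q [d [Gq d0 h]]]; apply/(tG.2); exists q, (d / 2).
  split; rewrite ?divr_gt0// => y yx; exists q, (d / 2).
  split; rewrite ?divr_gt0// => z Bz zy; apply: h => //.
  by apply: (le_lt_trans (seminorm_triangle (sG Gq) y _ _)); lra.
- apply: coarser_generated gP norm_topology_generated _.
  move=> p /mP/mixed_seminorm_le[M hM].
  by exists nrm, M.
Qed.

(** ** The submixed seminorms *)

Definition submixed (q : nat -> V -> R) (a : nat -> R) (x : V) : R :=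
  sup [set q n x * a n | n in [set: nat]].

Definition submixed_data (q : nat -> V -> R) (a : nat -> R) :=
  [/\ forall n, G (q n), forall n, 0 <= a n &
      (a : nat -> R^o) @ \oo --> (0 : R^o)].

Definition submixed_seminorms : set (V -> R) :=
  [set N | exists2 qa, submixed_data qa.1 qa.2 & N = submixed qa.1 qa.2].

Section one_submixed.
Context (q : nat -> V -> R) (a : nat -> R) (qa : submixed_data q a).

(** The head of the sequence is controlled by one member of [G]; the tail, where [a n] is small, is
    controlled by the norm. [submixed_bound] and [submixed_mixed] both use this split. *)
Lemma submixed_finite n0 : exists p M, [/\ G p, 0 <= M &
  forall n x, (n < n0)%N -> q n x * a n <= M * p x].
Proof.
have [Gq a0 _] := qa; elim: n0 => [|n0 [p [M [Gp M0 h]]]].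
  by exists (q 0%N), 0; split.
have [p' Gp' pp'] := dG.2 _ _ Gp (Gq n0).
exists p', (M + a n0); split=> //; first by rewrite addr_ge0.
move=> n x; have [px qx] := pp' x; have p0 := seminorm_ge0 (sG Gp) x.
have q0 := seminorm_ge0 (sG (Gq n0)) x; have := a0 n0.
rewrite ltnS leq_eqVlt => + /orP[/eqP->|nn0]; first by nra.
by have := h n x nn0; nra.
Qed.

Lemma submixed_bound : exists2 M, 0 <= M & forall n x, q n x * a n <= M * nrm x.
Proof.
have [Gq a0 /(null_sequenceP a0) an] := qa.
have [n0 hn] := an 1 ltr01; have [p [M [Gp M0 h]]] := submixed_finite n0.
exists (M + 1) => [|n x]; first by rewrite addr_ge0.
have px := Gle Gp x; have p0 := seminorm_ge0 (sG Gp) x.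
have qx := Gle (Gq n) x; have q0 := seminorm_ge0 (sG (Gq n)) x.
case: (ltnP n n0) => [/(h n x)|/hn]; first by nra.
by have := a0 n; nra.
Qed.

Lemma submixed_ge n x : q n x * a n <= submixed q a x.
Proof.
have [M _ hM] := submixed_bound; apply: ub_le_sup; last by exists n.
by exists (M * nrm x) => _ [m _ <-].
Qed.

Lemma submixed_le x c : (forall n, q n x * a n <= c) -> submixed q a x <= c.
Proof.
by move=> h; apply: ge_sup => [|_ [n _ <-]//]; exists (q 0%N x * a 0%N), 0%N.
Qed.

Lemma submixed_seminorm : seminorm (submixed q a).
Proof.
have [Gq a0 _] := qa; apply: le_seminorm => [x y|b x]; apply: submixed_le => n.
  have := submixed_ge n x; have := submixed_ge n y; have := a0 n.
  by have := seminormD (sG (Gq n)) x y; nra.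
rewrite (seminormZ (sG (Gq n))) -mulrA ler_wpM2l ?modulus_ge0//.
exact: submixed_ge.
Qed.

Lemma submixed_mixed : mixed_seminorm (submixed q a).
Proof.
split=> [|e e0]; first exact: submixed_seminorm.
have [Gq a0 /(null_sequenceP a0) an] := qa; have e20 : 0 < e / 2 by lra.
have [n0 hn] := an _ e20; have [p [M [Gp M0 h]]] := submixed_finite n0.
have M1 : 0 < M + 1 by lra.
exists p, (e / 2 / (M + 1)); split; rewrite ?divr_gt0// => x x1.
rewrite ltr_pdivlMr// => px.
apply: (@le_lt_trans _ _ (e / 2)); last lra.
apply: submixed_le => n; have p0 := seminorm_ge0 (sG Gp) x.
have qx := Gle (Gq n) x; have q0 := seminorm_ge0 (sG (Gq n)) x.
case: (ltnP n n0) => [/(h n x)|/hn]; first by nra.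
by have := a0 n; nra.
Qed.

End one_submixed.

Lemma submixed_dominates q : G q ->
  exists2 N, submixed_seminorms N & forall x, q x <= N x.
Proof.
move=> Gq; have qa : submixed_data (fun=> q) (fun n => n.+1%:R^-1).
  by split=> //; exact: null_sequence_harmonic.
exists (submixed (fun=> q) (fun n => n.+1%:R^-1)).
  by exists (fun=> q, fun n => n.+1%:R^-1).
by move=> x; have := submixed_ge qa 0 x; rewrite invr1 mulr1.
Qed.

Lemma submixed_interleave q1 a1 q2 a2 :
  submixed_data q1 a1 -> submixed_data q2 a2 ->
  exists q a, submixed_data q a /\ forall x,
    submixed q1 a1 x <= submixed q a x /\ submixed q2 a2 x <= submixed q a x.
Proof.
move=> d1 d2; have [G1 a10 n1] := d1; have [G2 a20 n2] := d2.
exists (fun n => if odd n then q2 n./2 else q1 n./2).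
exists (fun n => if odd n then a2 n./2 else a1 n./2).
have dd : submixed_data (fun n => if odd n then q2 n./2 else q1 n./2)
    (fun n => if odd n then a2 n./2 else a1 n./2).
  split.
  - by move=> n; case: (odd n).
  - by move=> n; case: (odd n).
  - exact: null_sequence_interleave.
split=> // x; split; apply: submixed_le => n.
  by have := submixed_ge dd n.*2 x; rewrite odd_double doubleK.
by have := submixed_ge dd n.*2.+1 x; rewrite /= odd_double /= uphalf_double.
Qed.

Lemma submixed_directed : directed submixed_seminorms.
Proof.
split.
  by have [q /submixed_dominates[N NN _]] := dG.1; exists N.
move=> _ _ [[q1 a1] d1 ->] [[q2 a2] d2 ->].
have [q [a [d h]]] := submixed_interleave d1 d2.
by exists (submixed q a) => //; exists (q, a).
Qed.

(* The Banach-Dieudonne argument: the seminorms [q n] are chosen one at a time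
   so that the sets [{q 0 <= e, q 1 <= 1, ..., q n <= n}] meet the ball of
   radius [n + 1] inside [W]. *)
Section banach_dieudonne.
Context (t : topology V).
Hypotheses (nrm0 : forall x, nrm x = 0 -> x = 0)
  (clG : forall q c, G q -> closed ([set x | q x <= c] : set (V \with t)))
  (cball : forall c, compact (nball c : set (V \with t))).

Lemma banach_dieudonne (W : set V) : W 0 ->
  (forall c, closed (nball c `\` W : set (V \with t))) ->
  exists2 N, submixed_seminorms N & forall x, N x < 1 -> W x.
Proof.
move=> W0 clW.
(* If every [A i] contained a point of the ball outside [W], compactness would produce such a point
   common to all [A i]. *)
have meet0 (I : Type) (D : set I) (A : I -> set V) c : D !=set0 ->
    (forall i j, D i -> D j -> exists2 l, D l & A l `<=` A i `&` A j) ->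
    (forall i, D i -> closed (A i : set (V \with t))) ->
    (forall x, nrm x <= c -> ~ W x -> ~ forall i, D i -> A i x) ->
    exists2 i, D i & forall x, A i x -> nrm x <= c -> W x.
  move=> D0 dA clA h; apply: contrapT => hn.
  have cW : compact (nball c `\` W : set (V \with t)).
    rewrite -(setIid (nball c)) -setIDA.
    exact: (@compact_closedI (V \with t) _ _ (@cball c) (clW c)).
  have mA i : D i -> (nball c `\` W) `&` A i !=set0.
    move=> Di; apply: contrapT => hi; apply: hn; exists i => // x Ax xc.
    by apply: contrapT => nWx; apply: hi; exists x.
  have [x [xc nWx] xA] := compact_directed_meet cW D0 dA clA mA.
  exact: h xA.
have [[q0 e0] /= [Gq0 e00] h0] : exists2 qe : (V -> R) * R, G qe.1 /\ 0 < qe.2 &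
    forall x, qe.1 x <= qe.2 -> nrm x <= 1 -> W x.
  apply: (meet0 _ [set qe : (V -> R) * R | G qe.1 /\ 0 < qe.2]
    (fun qe => [set x | qe.1 x <= qe.2])).
  - by have [q Gq] := dG.1; exists (q, 1).
  - move=> [q d] [p e] /= [Gq d0] [Gp e0].
    have [r Gr qpr] := dG.2 _ _ Gq Gp.
    exists (r, Num.min d e) => /=; first by rewrite lt_min d0.
    move=> x /=; rewrite le_min => /andP[rd re]; have [qr pr] := qpr x.
    by split; [exact: le_trans rd | exact: le_trans re].
  - by move=> [q d] /= [Gq _]; exact: clG.
  - move=> x x1 nWx h; apply: nWx; suff -> : x = 0 by [].
    apply: nrm0; apply/eqP; rewrite eq_le (seminorm_ge0 snrm) andbT leNgt.
    apply/negP => /Gsup[q Gq qx].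
    by have := h (q, q x / 2); rewrite /= => /(_ (conj Gq _)); lra.
pose good (C : set V) n := closed (C : set (V \with t)) /\
  forall x, C x -> nrm x <= n.+1%:R -> W x.
(* The step is defined for every pair, with an arbitrary seminorm when [C] is not good; [choice]
   then gives a total function to iterate. *)
have step (Cn : set V * nat) : exists q, good Cn.1 Cn.2 ->
    G q /\ good (Cn.1 `&` [set x | q x <= Cn.2.+1%:R]) Cn.2.+1.
  case: Cn => C n /=; have [[clC hC]|ng] := pselect (good C n); last first.
    by have [q _] := dG.1; exists q.
  have [q Gq hq] : exists2 q, G q & forall x,
      (C `&` [set x | q x <= n.+1%:R]) x -> nrm x <= n.+2%:R -> W x.
    apply: (meet0 _ G (fun q => C `&` [set x | q x <= n.+1%:R])).
    - exact: dG.1.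
    - move=> q p Gq Gp; have [r Gr qpr] := dG.2 _ _ Gq Gp; exists r => //.
      move=> x [Cx /= rx]; have [qr pr] := qpr x.
      by split; split=> //=; [exact: le_trans rx | exact: le_trans rx].
    - by move=> q Gq; apply: closedI => //; exact: clG.
    (* A point in all these sets has [q x <= n + 1] for every [q] in [G], hence norm at most
       [n + 1], where the previous stage already places it in [W]. *)
    - move=> x x2 nWx h; apply/nWx/hC; first by have [q /h[]] := dG.1.
      rewrite leNgt; apply/negP => /Gsup[q Gq qx].
      by have [_ /=] := h q Gq; rewrite leNgt qx.
  by exists q => _; split=> //; split=> //; apply: closedI => //; exact: clG.
have [Q hQ] := choice step.
pose C := fix C n := if n is n'.+1 then
  C n' `&` [set x | Q (C n', n') x <= n'.+1%:R] else [set x | q0 x <= e0].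
have gC n : good (C n) n.
  elim: n => [|n IHn]; first by split => //; exact: clG.
  by have /= [] := hQ (C n, n) IHn.
pose q n := if n is n'.+1 then Q (C n', n') else q0.
(* Reciprocals of the thresholds [e0, 1, 2, ...], so that [submixed q a x < 1] puts [x] in every
   [C n]. *)
pose a n : R := if n is n'.+1 then n'.+1%:R^-1 else e0^-1.
have qa : submixed_data q a.
  split.
  - by move=> [|n] //=; have /= [] := hQ (C n, n) (gC n).
  - by move=> [|n] /=; rewrite invr_ge0 ?ltW.
  - apply/null_sequenceP => [[|n]|e e_gt0] /=; rewrite ?invr_ge0 ?(ltW e00)//.
    have hpos n : 0 <= n.+1%:R^-1 :> R by rewrite invr_ge0.
    have [n0 hn] := (null_sequenceP hpos).1 (@null_sequence_harmonic R) e e_gt0.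
    by exists n0.+1 => -[|n]//; rewrite ltnS => /hn.
exists (submixed q a); first by exists (q, a).
move=> x Nx; have qx n : q n x * a n < 1 by apply: le_lt_trans (submixed_ge qa n x) Nx.
have Cx n : C n x.
  elim: n => [|n IHn] /=.
    by have /= := qx 0%N; rewrite ltr_pdivrMr// mul1r => /ltW.
  by split=> //=; have /= := qx n.+1; rewrite ltr_pdivrMr// mul1r => /ltW.
have [n xn] : exists n : nat, nrm x <= n.+1%:R.
  by exists (Num.truncn (nrm x)); rewrite ltW// truncnS_gt.
exact: (gC n).2.
Qed.

End banach_dieudonne.
End saks.

(** * The mixed topology of a Saks space *)

Section infimal_convolution.
Context (R : realType) (k : scalar_kind).
Local Notation K := (scalars R k).
Context (V : lmodType K) (m : nat -> V -> R).
Hypothesis sm : forall n, seminorm (m n).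

(** The [i]-th piece of [x] is charged by [m i]. The resulting infimum is the largest seminorm below
    all the [m i]. *)
Definition decomposition x c := exists n (u : nat -> V),
  x = \sum_(i < n) u i /\ c = \sum_(i < n) m i (u i).

Definition infimal_convolution := inf_rel decomposition.

Let pad (T : nmodType) n n' (u : nat -> T) : (n <= n')%N ->
  \sum_(i < n) u i = \sum_(i < n') (if (i < n)%N then u i else 0).
Proof. by move=> nn'; rewrite (big_ord_widen _ _ nn') big_mkcond. Qed.

Let lb x c : decomposition x c -> 0 <= c.
Proof.
by move=> [n [u [_ ->]]]; apply: sumr_ge0 => i _; exact: (seminorm_ge0 (sm i)).
Qed.

Lemma decomposition_single i x : decomposition x (m i x).
Proof.
exists i.+1, (fun j => if j == i then x else 0); split.
  rewrite big_ord_recr /= eqxx big1 ?add0r// => j _.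
  by rewrite ltn_eqF.
rewrite big_ord_recr /= eqxx big1 ?add0r// => j _.
by rewrite ltn_eqF// (seminorm0 (sm j)).
Qed.

Lemma infimal_convolution_seminorm : seminorm infimal_convolution.
Proof.
apply: inf_rel_seminorm => //.
- by move=> x; exists (m 0%N x); exact: decomposition_single.
- move=> x y _ _ [n [u [-> ->]]] [n' [u' [-> ->]]].
  pose w (v : nat -> V) p i := if (i < p)%N then v i else 0.
  exists (\sum_(i < n + n') m i (w u n i + w u' n' i)).
    exists (n + n')%N, (fun i => w u n i + w u' n' i); split=> //.
    by rewrite big_split /= -!pad ?leq_addl ?leq_addr.
  rewrite (pad (fun i => m i (u i)) (leq_addr n' n)).
  rewrite (pad (fun i => m i (u' i)) (leq_addl n n')) -big_split /=.
  apply: ler_sum => i _; apply: le_trans (seminormD (sm i) _ _) _.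
  by rewrite /w; apply: lerD; case: ifP => _ //; rewrite (seminorm0 (sm i)).
- move=> a x _ [n [u [-> ->]]]; exists (\sum_(i < n) m i (a *: u i)).
    by exists n, (fun i => a *: u i); rewrite scaler_sumr.
  by rewrite mulr_sumr; apply: ler_sum => i _; rewrite (seminormZ (sm i)).
Qed.

Lemma infimal_convolution_le i x : infimal_convolution x <= m i x.
Proof. by apply: (inf_rel_le lb); exact: decomposition_single. Qed.

Lemma infimal_convolution_lt x c : infimal_convolution x < c ->
  exists n (u : nat -> V), x = \sum_(i < n) u i /\ \sum_(i < n) m i (u i) < c.
Proof.
move=> /inf_rel_lt[y|_ [n [u [-> ->]]] h]; last by exists n, u.
by exists (m 0%N y); exact: decomposition_single.
Qed.

End infimal_convolution.

Section mixed_topology.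
Context (R : realType) (k : scalar_kind).
Local Notation K := (scalars R k).
Context (V : lmodType K) (nrm : V -> R) (G : set (V -> R)).
Hypotheses (snrm : seminorm nrm) (dG : directed G)
  (sG : forall q, G q -> seminorm q)
  (Gle : forall q, G q -> forall x, q x <= nrm x)
  (Gsup : forall x c, c < nrm x -> exists2 q, G q & c < q x).

Local Notation MS := [set r : V -> R | mixed_seminorm nrm G r].

Lemma mixed_seminorm_scale c r : 0 < c -> MS r -> MS (fun x => c * r x).
Proof.
move=> c0 [sr hr]; split; first by apply: seminorm_scale => //; exact: ltW.
move=> e e0; have [q [d [Gq d0 h]]] := hr (e / c) (divr_gt0 e0 c0).
by exists q, d; split=> // x x1 /(h x x1); rewrite ltr_pdivlMr// mulrC.
Qed.

Lemma mixed_seminorm_max r1 r2 : MS r1 -> MS r2 ->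
  MS (fun x => Num.max (r1 x) (r2 x)).
Proof.
move=> [s1 h1] [s2 h2]; split; first exact: seminorm_max.
move=> e e0; have [q1 [d1 [G1 d10 hd1]]] := h1 e e0.
have [q2 [d2 [G2 d20 hd2]]] := h2 e e0; have [q Gq hq] := dG.2 _ _ G1 G2.
exists q, (Num.min d1 d2); split; rewrite ?lt_min ?d10// => x x1.
rewrite lt_min => /andP[qd1 qd2]; have [q1q q2q] := hq x.
by rewrite gt_max hd1 ?hd2//; [exact: le_lt_trans qd2 | exact: le_lt_trans qd1].
Qed.

Lemma mixed_seminorms_directed : directed MS.
Proof.
split.
  by have [[q Gq] _] := dG; exists q; exact: mixed_seminorm_generating.
move=> r1 r2 h1 h2; exists (fun x => Num.max (r1 x) (r2 x)).
  exact: mixed_seminorm_max.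
by move=> x; rewrite !le_max !lexx orbT.
Qed.

Lemma mixed_generated :
  generated_by (MS : set (V \with seminorm_topology MS -> R)).
Proof.
apply: generated_seminorm_topology; first exact: mixed_seminorms_directed.
by move=> r [].
Qed.

Section layers.
Context (s : nat -> V -> R).
Hypothesis hs : forall n, MS (s n).

(** Its unit ball is the part of the norm ball of radius [2 ^+ n] where [s n] is at most 1. Sums of
    such pieces are the classical neighbourhoods of 0 in a mixed topology. *)
Definition layer n x := Num.max (nrm x / 2 ^+ n) (s n x).

Lemma layer_seminorm n : seminorm (layer n).
Proof.
apply: seminorm_max; last by case: (hs n).
have := @seminorm_scale _ _ _ nrm (2 ^+ n)^-1 _ snrm.
by under [fun x => nrm x / _]eq_fun do rewrite mulrC; apply; rewrite invr_ge0 ltW.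
Qed.

(** The infimal convolution lies below each layer, and on the unit ball layer [n] is at most the
    maximum of [2 ^- n] and [s n]; one [n] with [2 ^- n < e] is enough. *)
Lemma layers_mixed : MS (infimal_convolution layer).
Proof.
split; first by apply: infimal_convolution_seminorm; exact: layer_seminorm.
move=> e e0; have [n hn] : exists n : nat, (2 ^+ n)^-1 < e.
  exists (Num.truncn e^-1).+1; rewrite invf_plt ?posrE//.
  apply: lt_trans (truncnS_gt _) _; rewrite -natrX ltr_nat; exact: ltn_expl.
have [q [d [Gq d0 h]]] := (hs n).2 e e0; exists q, d; split=> // x x1 qd.
apply: le_lt_trans (infimal_convolution_le layer_seminorm n x) _.
rewrite gt_max h// andbT; apply: le_lt_trans hn.
by rewrite ler_pdivrMr// mulVf// gt_eqF.
Qed.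

Lemma layers_decompose x : infimal_convolution layer x < 1 ->
  exists n (u : nat -> V), [/\ x = \sum_(i < n) u i,
    \sum_(i < n) (nrm (u i) / 2 ^+ i) < 1, \sum_(i < n) s i (u i) < 1 &
    forall i, (i < n)%N -> nrm (u i) <= 2 ^+ i /\ s i (u i) < 1].
Proof.
move=> /(infimal_convolution_lt layer_seminorm)[n [u [xE hu]]].
have l0 i := seminorm_ge0 (layer_seminorm i) (u i).
exists n, u; split=> //.
- by apply: le_lt_trans hu; apply: ler_sum => i _; rewrite le_max lexx.
- by apply: le_lt_trans hu; apply: ler_sum => i _; rewrite le_max lexx orbT.
- move=> i ni; have : layer i (u i) < 1.
    apply: le_lt_trans hu; rewrite (bigD1 (Ordinal ni))//= lerDl.
    by apply: sumr_ge0 => j _.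
  rewrite gt_max ltr_pdivrMr// mul1r => /andP[/ltW ? ?]; by split.
Qed.

(** The pieces of index below [n] add up to [d]: their norms carry weights at least [2 ^- n] and the
    weighted sum is below 1. On the other pieces [s n <= s i]. *)
Lemma layers_split x n : {homo s : i j / (i <= j)%N >-> forall y, i y <= j y} ->
  infimal_convolution layer x < 1 ->
  exists2 d, nrm d <= 2 ^+ n & s n (x - d) < 1.
Proof.
move=> mono /layers_decompose[N [u [-> h1 h2 _]]].
have pos i : 0 <= nrm (u i) / 2 ^+ i.
  by rewrite divr_ge0 ?(seminorm_ge0 snrm)// ltW.
have spos i := seminorm_ge0 (hs i).1 (u i).
exists (\sum_(i < N | (i < n)%N) u i).
  apply: (@le_trans _ _ (\sum_(i < N | (i < n)%N) nrm (u i))).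
    elim/big_ind2 : _ => [|x1 x2 y1 y2 h h'|//]; first by rewrite (seminorm0 snrm).
    by apply: le_trans (seminormD snrm _ _) _; exact: lerD.
  apply: (@le_trans _ _ (2 ^+ n * \sum_(i < N | (i < n)%N) (nrm (u i) / 2 ^+ i))).
    rewrite mulr_sumr; apply: ler_sum => i /ltnW ilen.
    rewrite mulrCA ler_peMr ?(seminorm_ge0 snrm)//.
    by rewrite ler_pdivlMr// mul1r ler_eXn2l// ltr1n.
  rewrite ger_pMr//; apply: le_trans (ltW h1).
  by rewrite [leRHS](bigID (fun i : 'I_N => (i < n)%N)) /= lerDl sumr_ge0.
rewrite (bigID (fun i : 'I_N => (i < n)%N)) /= addrC addrK.
apply: (@le_lt_trans _ _ (\sum_(i < N | ~~ (i < n)%N) s i (u i))).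
  apply: (@le_trans _ _ (\sum_(i < N | ~~ (i < n)%N) s n (u i))).
    elim/big_ind2 : _ => [|x1 x2 y1 y2 h h'|//]; first by rewrite (seminorm0 (hs n).1).
    by apply: le_trans (seminormD (hs n).1 _ _) _; exact: lerD.
  by apply: ler_sum => i; rewrite -leqNgt => ni; exact: mono.
apply: le_lt_trans h2.
by rewrite [leRHS](bigID (fun i : 'I_N => (i < n)%N)) /= lerDr sumr_ge0.
Qed.

End layers.

(** A competing candidate [g] is merely linear, so a neighbourhood of 0 is refined to a sequence
    with [Un n.+1 + Un n.+1] inside [Un n]. As [g] and [t] agree on the ball of radius [2 ^+ n], a
    mixed seminorm [r n] cuts out a part of that ball inside [Un n.+1]; the layers of [r] reassemble
    these parts. *)
Lemma mixed_topologyP (t : topology V) :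
  generated_by (G : set (V \with t -> R)) ->
  is_mixed_topology nrm t (seminorm_topology MS).
Proof.
move=> tG; split.
  apply: (mixed_candidate_seminorms snrm sG Gle tG mixed_seminorms_directed) => //.
  move=> q Gq; exists q, 1; split; first exact: mixed_seminorm_generating.
  by move=> x; rewrite mul1r.
move=> g [lg cg tg gn] U oU; apply/opensP => x Ux; apply/(mixed_generated.2).
pose nb0 (W : set V) := nbhs (0 : V \with g) W.
have shrink W : nb0 W -> exists2 W', nb0 W' & forall y z, W' y -> W' z -> W (y + z).
  move=> W0; have := lg.1 (0, 0) W; rewrite /= addr0 => /(_ W0)[[A B] /= [A0 B0] AB].
  exists (A `&` B); first exact: filterI.
  by move=> y z [Ay _] [_ Bz]; exact: (AB (y, z)).
have hq W n : nb0 W -> exists2 r, MS r &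
    forall z, nrm z <= 2 ^+ n -> r z < 1 -> W z.
  rewrite /nb0 nbhsE => -[A [oA A0] AW].
  have hB : exists C : R, forall z, nball nrm (2 ^+ n) z -> nrm z <= C.
    by exists (2 ^+ n).
  have : [set U `&` nball nrm (2 ^+ n) | U in opens t] (A `&` nball nrm (2 ^+ n)).
    by rewrite -(cg _ hB); exists A.
  move=> [T oT TA].
  have B0 : nball nrm (2 ^+ n) 0 by rewrite /nball /= (seminorm0 snrm) exprn_ge0.
  have T0 : T 0.
    have : (A `&` nball nrm (2 ^+ n)) 0 by [].
    by rewrite -TA => -[].
  have /opensP/(_ _ T0)/(nbhs_generated tG)[q [e [Gq e0 qT]]] := oT.
  exists (fun z => e^-1 * q z).
    apply: mixed_seminorm_scale; rewrite ?invr_gt0//.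
    exact: mixed_seminorm_generating.
  move=> z zn; rewrite mulrC ltr_pdivrMr// mul1r => qz; apply: AW.
  have : (T `&` nball nrm (2 ^+ n)) z by split=> //; apply: qT; rewrite subr0.
  by rewrite TA => -[].
have Sh (W : {W | nb0 W}) : exists W' : {W | nb0 W}, forall y z,
    sval W' y -> sval W' z -> sval W (y + z).
  by have [W' W'0 h] := shrink _ (svalP W); exists (exist _ W' W'0).
have [sh shP] := choice Sh.
have W0 : nb0 [set y | U (y + x)].
  have /opensP : opens g [set y | U (y + x)].
    apply/opensP => y /= Uyx; move/opensP: oU => /(_ _ Uyx) oU.
    have [[A B] /= [Ay Bx] AB] := lg.1 (y, x) U oU.
    apply: filterS Ay => z Az; apply: (AB (z, x)); split=> //.
    exact: nbhs_singleton Bx.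
  by apply; rewrite /= add0r.
pose Un n : {W | nb0 W} := iter n sh (exist _ _ W0).
have hr n : exists r, MS r /\ forall z, nrm z <= 2 ^+ n -> r z < 1 -> sval (Un n.+1) z.
  by have [r Mr h] := hq _ n (svalP (Un n.+1)); exists r.
have [r rP] := choice hr.
exists (infimal_convolution (layer r)), 1; split=> //.
  by apply: layers_mixed => n; exact: (rP n).1.
move=> y /layers_decompose-/(_ (fun n => (rP n).1))[n [u [yE _ _ hu]]].
have Us i : (i < n)%N -> sval (Un i.+1) (u i).
  by move=> /hu[h1 h2]; exact: (rP i).2.
(* The term [u j] and, by induction, the sum of the later terms both lie in [Un j.+1], so their sum
   lies in [Un j]. *)
have sumU p j : (j + p <= n)%N -> sval (Un j) (\sum_(j <= i < j + p) u i).
  elim: p j => [|p IHp] j jn.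
    by rewrite addn0 big_geq//; exact: nbhs_singleton (svalP (Un j)).
  have jp : (j < j + p.+1)%N by rewrite addnS ltnS leq_addr.
  rewrite big_ltn//; apply: (shP (Un j)); first by apply: Us; exact: leq_trans jn.
  by rewrite -addSnnS; apply: IHp; rewrite addSnnS.
have := sumU n 0%N (leqnn n); rewrite add0n big_mkord -yE /=.
by rewrite subrK.
Qed.

Lemma mixed_complete :
  (forall F : set_system V, ProperFilter F ->
     (forall r e, MS r -> 0 < e ->
        exists2 A, F A & forall x y, A x -> A y -> r (x - y) < e) ->
     exists x, forall q e, G q -> 0 < e -> F [set y | q (y - x) < e]) ->
  complete_tvs (V \with seminorm_topology MS).
Proof.
move=> hlim; apply/(generated_complete mixed_generated) => F PF Fc.
have [f hf] := hlim F PF Fc; exists f.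
(* If every ball failed, the running maxima of the offending seminorms would give layers, hence one
   mixed seminorm. A set of [F] that is small for it lies near [a] plus the ball of radius [2 ^+ m],
   where [nrm a <= 2 ^+ m]; the exponent [n.+1] leaves room for this sum. *)
have [n hn] : exists n : nat, forall A r, F A -> MS r ->
    exists a d, [/\ A a, nrm d <= 2 ^+ n.+1 & r (a - d) < 1].
  apply: contrapT => hn.
  have bad n : exists Ar : set V * (V -> R), [/\ F Ar.1, MS Ar.2 &
      forall a d, Ar.1 a -> nrm d <= 2 ^+ n.+1 -> 1 <= Ar.2 (a - d)].
    apply: contrapT => hb; apply: hn; exists n => A r FA Mr.
    apply: contrapT => had; apply: hb; exists (A, r); split=> // a d Aa dn.
    by rewrite leNgt; apply/negP => rad; apply: had; exists a, d.
  have [Ar ArP] := choice bad.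
  pose s := fix s n : V -> R := if n is n'.+1 then
    fun x => Num.max (s n' x) ((Ar n'.+1).2 x) else (Ar 0%N).2.
  have Ms i : MS (s i).
    elim: i => [|i IHi] /=; first by have [] := ArP 0%N.
    by apply: mixed_seminorm_max => //; have [] := ArP i.+1.
  have mono : {homo s : i j / (i <= j)%N >-> forall y, i y <= j y}.
    move=> i j; elim: j => [|j IHj]; first by rewrite leqn0 => /eqP-> y.
    rewrite leq_eqVlt => /orP[/eqP->//|]; rewrite ltnS => /IHj h y /=.
    by rewrite le_max h.
  have Ars i y : (Ar i).2 y <= s i y by case: i => [//|i] /=; rewrite le_max lexx orbT.
  have [A FA hA] := Fc _ _ (layers_mixed Ms) ltr01.
  have [a Aa] := filter_ex FA.
  pose m := (Num.truncn (nrm a)).+1.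
  have am : nrm a <= 2 ^+ m.
    apply: le_trans (ltW (truncnS_gt _)) _; rewrite -natrX ler_nat.
    by apply: ltnW; exact: ltn_expl.
  have [FAm _ hAm] := ArP m.
  have [b [Ab Amb]] := filter_ex (filterI FA FAm).
  have [d dm sd] := layers_split Ms m mono (hA b a Ab Aa).
  suff: (Ar m).2 (b - a - d) < 1.
    rewrite ltNge => /negP; apply; rewrite -addrA -opprD; apply: hAm => //.
    apply: le_trans (seminormD snrm _ _) _; rewrite exprS.
    by move: am dm; lra.
  exact: le_lt_trans (Ars _ _) sd.
have c0 : 0 < 2 ^+ n.+1 :> R by rewrite exprn_gt0.
have fc : nrm f <= 2 ^+ n.+1.
  rewrite leNgt; apply/negP => /Gsup[q Gq qf]; have sq := sG Gq.
  pose e := (q f - 2 ^+ n.+1) / 2; have e0 : 0 < e by rewrite divr_gt0// subr_gt0.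
  have ei : 0 < e^-1 by rewrite invr_gt0.
  have [a [d [/= af dn]]] := hn _ _ (hf q e Gq e0)
    (mixed_seminorm_scale ei (mixed_seminorm_generating nrm sG Gq)).
  rewrite mulrC ltr_pdivrMr// mul1r => ad.
  have := seminorm_sub sq f d; have := seminorm_triangle sq a f d.
  rewrite (seminorm_distC sq f a); have := le_trans (Gle Gq d) dn.
  by rewrite /e in af ad; lra.
move=> r e Mr e0; have sr := Mr.1.
have e30 : 0 < e / 3 by lra.
have [q [d [Gq d0 hqd]]] := mixed_seminorm_bounded snrm sG Mr (addr_gt0 c0 c0) e30.
have [A FA hA] := Fc r _ Mr e30; have sq := sG Gq.
have d20 : 0 < d / 2 by lra.
have d2i : 0 < (d / 2)^-1 by rewrite invr_gt0.
have e3i : 0 < (e / 3)^-1 by rewrite invr_gt0.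
(* A maximum of rescaled seminorms makes the same point [b] of the ball close to [a] for both [q]
   and [r]: [q] brings [b] near [f], where boundedness applies, and [r] gives the estimate. *)
have [a [b [[Aa /= af] bn]]] := hn _ _ (filterI FA (hf q _ Gq d20))
  (mixed_seminorm_max (mixed_seminorm_scale d2i (mixed_seminorm_generating nrm sG Gq))
     (mixed_seminorm_scale e3i Mr)).
rewrite gt_max => /andP[]; rewrite mulrC ltr_pdivrMr// mul1r => qab.
rewrite mulrC ltr_pdivrMr// mul1r => rab.
have rbf : r (b - f) < e / 3.
  apply: hqd.
    by apply: le_trans (seminormB snrm _ _) _; exact: lerD.
  apply: le_lt_trans (seminorm_triangle sq a _ _) _.
  by rewrite (seminorm_distC sq b a); lra.
apply: filterS FA => x Ax /=.
have := seminorm_triangle sr a x f; have := seminorm_triangle sr b a f.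
by have := hA x a Ax Aa; lra.
Qed.

End mixed_topology.

(** * Semi-Montel Saks spaces and their duals *)

Section continuous_linear_theory.
Context (K : numFieldType) (X : preTopologicalLmodType K)
        (Y : topologicalLmodType K).
Implicit Types u v : clin X Y.

Lemma clin_linear u : linear u. Proof. by have /asboolP[] := valP u. Qed.

Lemma clin_continuous u : continuous u.
Proof. by have /asboolP[] := valP u. Qed.

Definition mk_clin (f : X -> Y) (lf : linear f) (cf : continuous f) :
    clin X Y :=
  exist (fun f => f \in @continuous_linear K X Y) f (asboolT (conj lf cf)).

Lemma clin_ext u v : (forall x, u x = v x) -> u = v.
Proof. by move=> uv; apply/val_inj/funext. Qed.

Lemma clinD u x y : u (x + y) = u x + u y.
Proof. by rewrite -{1}(scale1r x) clin_linear scale1r. Qed.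

Lemma clinB u x y : u (x - y) = u x - u y.
Proof. by rewrite addrC -scaleN1r clin_linear scaleN1r addrC. Qed.

Lemma clin0 u : u 0 = 0. Proof. by rewrite -(subrr (0 : X)) clinB subrr. Qed.

Lemma clinZ u a x : u (a *: x) = a *: u x.
Proof. by rewrite -(addr0 (a *: x)) clin_linear clin0 addr0. Qed.

Lemma eval_linear (x : X) : linear (fun u : clin X Y => u x).
Proof. by []. Qed.

End continuous_linear_theory.

Lemma dual_comp_is_linear (K : numFieldType) (V : lmodType K)
    (Y : topologicalLmodType K) (f : V -> Y) (e : dual Y) :
  linear f -> linear (fun x => e (f x)).
Proof. by move=> lf a x y; rewrite lf; exact: clin_linear. Qed.

Section dual_theory.
Context (K : numFieldType) (X : preTopologicalLmodType K).
Implicit Types y z : dual X.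

Lemma dual_addE y z x : clin_fun (y + z) x = y x + z x. Proof. by []. Qed.
Lemma dual_subE y z x : clin_fun (y - z) x = y x - z x. Proof. by []. Qed.
Lemma dual_scaleE a y x : clin_fun (a *: y) x = (a * (y x : K) : K). Proof. by []. Qed.
Lemma dual_linearE y a x x' : y (a *: x + x') = (a * (y x : K) + y x' : K).
Proof. exact: clin_linear. Qed.
Lemma dual_eval_linear x : linear (fun y : dual X => y x). Proof. by []. Qed.

End dual_theory.

Lemma dual_seminorm (R : realType) (k : scalar_kind)
    (X : preTopologicalLmodType (scalars R k)) (y : dual X) :
  seminorm (fun x : X => modulus (y x : scalars R k)).
Proof.
split=> [x z|a x]; first by rewrite clinD; exact: modulusD.
by rewrite clinZ; exact: modulusM.
Qed.

(* Stated through the topological structure of [dual_kappa X]: the two paths to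
   its module structure are convertible, but comparing them is slow. *)
Lemma linear_dual_kappa (R : realType) (k : scalar_kind)
    (X : preTopologicalLmodType (scalars R k)) (Y : lmodType (scalars R k))
    (f : dual X -> Y) :
  linear (f : (dual_kappa X : preTopologicalLmodType _) -> Y) -> linear f.
Proof. by move=> lf a y z; exact: (lf a y z). Qed.

Lemma eps_linear (R : realType) (k : scalar_kind)
    (X : preTopologicalLmodType (scalars R k))
    (E : topologicalLmodType (scalars R k)) (u : clin (dual_kappa X) E) :
  linear (fun y : dual X => clin_fun u y).
Proof. by apply: linear_dual_kappa; exact: clin_linear. Qed.

Section saks_system_theory.
Context (R : realType) (k : scalar_kind).
Local Notation K := (scalars R k).
Context (V : lmodType K) (nrm : V -> R) (tau : topology V) (G : set (V -> R)).
Hypotheses (G_saks : saks_system nrm tau G).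

Lemma saks_directed : directed G. Proof. by have [[]] := G_saks. Qed.

Lemma saks_seminorm q : G q -> seminorm q.
Proof. by have [[_ h _] _ _] := G_saks; exact: h. Qed.

Lemma saks_le q : G q -> forall x, q x <= nrm x.
Proof.
move=> Gq x; have [_ _ h] := G_saks; rewrite -lee_fin h.
by apply: ereal_sup_ubound; exists q.
Qed.

Lemma saks_sup x c : c < nrm x -> exists2 q, G q & c < q x.
Proof.
have [_ _ h] := G_saks; rewrite -lte_fin h => /ereal_sup_gt[_ [q Gq <-]].
by rewrite lte_fin; exists q.
Qed.

Lemma saks_generated : generated_by (G : set (V \with tau -> R)).
Proof.
have [[dG sG oE] _ _] := G_saks.
exact: generated_by_open.
Qed.

End saks_system_theory.

Lemma eps_subE (R : realType) (k : scalar_kind)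
    (X : preTopologicalLmodType (scalars R k))
    (E : topologicalLmodType (scalars R k)) 
    (u v : (eps_product X E : preTopologicalLmodType _)) (y : dual X) :
  clin_fun (u - v) y = clin_fun u y - clin_fun v y.
Proof. by []. Qed.

Definition montel_saks (R : realType) (k : scalar_kind)
    (V : lmodType (scalars R k)) (nrm : V -> R) (tau gamma : topology V)
    (G : set (V -> R)) :=
  [/\ two_topology_space nrm tau, saks_system nrm tau G,
      is_mixed_topology nrm tau gamma & semi_Montel (V \with gamma)].

Section montel.
Context (R : realType) (k : scalar_kind).
Local Notation K := (scalars R k).
Context (V : lmodType K) (nrm : V -> R) (tau gamma : topology V)
  (G : set (V -> R)).
Hypothesis H : montel_saks nrm tau gamma G.

Local Notation X := (V \with gamma).
Local Notation NS := (submixed_seminorms G).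

Let G_saks : saks_system nrm tau G. Proof. by case: H. Qed.
Let gamma_mixed : is_mixed_topology nrm tau gamma. Proof. by case: H. Qed.
Let gamma_Montel : semi_Montel X. Proof. by case: H. Qed.

Lemma montel_norm : seminorm nrm. Proof. by case: H => -[[]]. Qed.
Let snrm := montel_norm.

Lemma montel_norm_eq0 x : nrm x = 0 -> x = 0.
Proof. by case: H => -[[_ h]] _ _ _ _ _ _ /h. Qed.
Let nrm0 := montel_norm_eq0.

Let dG := saks_directed G_saks.
Let sG := saks_seminorm G_saks.
Let Gle := saks_le G_saks.
Let Gsup := saks_sup G_saks.

Lemma closed_le_mixed q c : G q -> closed ([set x | q x <= c] : set X).
Proof.
move=> Gq; apply: closed_coarser (mixed_coarser gamma_mixed) _.
apply: (@closed_le_generated _ _ _ _ (saks_generated G_saks) q q 1 c Gq).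
  exact: sG.
by move=> x; rewrite mul1r.
Qed.

Lemma ball_closed c : closed (nball nrm c : set X).
Proof.
have -> : nball nrm c = \bigcap_(q in G) [set x | q x <= c].
  apply/seteqP; split=> x /=.
    by move=> xc q Gq; apply: le_trans xc; exact: Gle.
  move=> h; rewrite /nball /= leNgt; apply/negP => /Gsup[q Gq].
  by rewrite ltNge; apply/negP; rewrite negbK; exact: h.
by apply: (@closed_bigI X) => q Gq; exact: closed_le_mixed.
Qed.

(** Balls are bounded for [gamma] because it is coarser than the norm topology; the Montel property
    makes them precompact, and they are closed. *)
Lemma ball_compact c : compact (nball nrm c : set X).
Proof.
rewrite -(precompact_closed (@ball_closed c)); apply: gamma_Montel => U U0.
have [[_ _ _ gn] _] := gamma_mixed.
have [e e0 eU] : exists2 e, 0 < e & forall x, nrm x < e -> U x.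
  move: U0; rewrite nbhsE => -[A [oA A0] AU].
  have /opensP h := gn A oA.
  have [p [e [pE e0 {}h]]] :=
    nbhs_generated (norm_topology_generated snrm) (h 0 A0).
  rewrite {}pE in h.
  by exists e => // x xe; apply/AU/h; rewrite subr0.
exists ((`|c| + 1) / e) => [|a ha x xc].
  by rewrite divr_gt0//; have := normr_ge0 c; lra.
have c1 : 0 < `|c| + 1 by have := normr_ge0 c; lra.
have ma : 0 < modulus a by apply: lt_le_trans ha; rewrite divr_gt0.
have a0 : a != 0 by apply: contraTneq ma => ->; rewrite modulus0 ltxx.
exists (a^-1 *: x); last by rewrite scalerA mulfV// scale1r.
apply: eU; rewrite (seminormZ snrm) modulusV mulrC ltr_pdivrMr//.
move: ha; rewrite ler_pdivrMr// mulrC; apply: lt_le_trans.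
by apply: (le_lt_trans xc); have := ler_norm c; lra.
Qed.

Lemma translate_open (t : topology V) (U : set V) (x : V) :
  linear_topology (V \with t) -> opens t U -> opens t [set y | U (y + x)].
Proof.
move=> [ct _] /opensP oU; apply/opensP => y /= /oU Uyx.
have [[A B] /= [Ay Bx] AB] := ct (y, x) U Uyx.
apply: filterS Ay => z Az; apply: (AB (z, x)); split=> //.
exact: nbhs_singleton Bx.
Qed.

(** The complement of a translated open set meets every ball in a closed set, so a submixed ball
    fits inside the open set. Conversely the submixed seminorms generate a candidate, and [gamma] is
    the greatest one. *)
Lemma gamma_generated : generated_by (NS : set (X -> R)).
Proof.
have sNS p : NS p -> seminorm p.
  by move=> [qa d ->]; exact: (submixed_seminorm dG sG Gle d).
have dNS : directed NS by exact: (submixed_directed dG sG Gle).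
apply: generated_by_open => //; apply/seteqP; split=> U.
  move=> oU x Ux; pose W := [set y | U (y + x)].
  have oW : opens gamma W.
    by apply: translate_open oU; case: gamma_mixed => -[].
  have [||N NN hN] := banach_dieudonne snrm dG sG Gle Gsup nrm0
    (fun q c => @closed_le_mixed q c) ball_compact (W := W).
  - by rewrite /W /= add0r.
  - move=> c; rewrite setDE; apply: (@closedI X); first exact: ball_closed.
    by rewrite closedC.
  exists [set N], 1; split.
  - exact: finite_set1.
  - by move=> _ ->.
  - exact: ltr01.
  - by move=> y /(_ N erefl)/hN; rewrite /W /= subrK.
have [_ gmax] := gamma_mixed; apply: gmax.
apply: (mixed_candidate_seminorms snrm sG Gle (saks_generated G_saks) dNS).
- by move=> _ [qa d ->]; exact: (submixed_mixed dG sG Gle d).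
- move=> q /(submixed_dominates dG sG Gle)[N NN qN]; exists N, 1; split=> // x.
  by rewrite mul1r.
Qed.
Lemma submixed_le_norm N : NS N -> exists2 M, 0 <= M & forall x, N x <= M * nrm x.
Proof.
move=> [[q a] d ->]; have [M M0 h] := submixed_bound dG sG Gle d.
by exists M => // x; apply: submixed_le => n; exact: h.
Qed.

Lemma dual_bound (y : dual X) : exists N M, [/\ NS N, 0 <= M &
  forall x, modulus (y x : K) <= M * N x].
Proof.
have [_ /(_ (@clin_continuous _ _ _ y) _ erefl)[N [M [NN h]]]] :=
  generated_continuous gamma_generated (generated_scalars R k) (@clin_linear _ _ _ y).
exists N, `|M|; split=> // x; apply: le_trans (h x) _.
by rewrite ler_wpM2r ?ler_norm// (seminorm_ge0 (gamma_generated.1 _ NN)).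
Qed.

Lemma dual_bounded (y : dual X) : exists2 M, 0 <= M &
  forall x, modulus (y x : K) <= M * nrm x.
Proof.
have [N [M [/submixed_le_norm[M' M'0 h'] M0 h]]] := dual_bound y.
exists (M * M') => [|x]; first exact: mulr_ge0.
by apply: le_trans (h x) _; rewrite -mulrA ler_wpM2l.
Qed.

Definition dnorm (y : dual X) : R :=
  sup [set modulus (y x : K) | x in nball nrm 1].

Lemma dnorm_le (y : dual X) c :
  (forall x, nrm x <= 1 -> modulus (y x : K) <= c) -> dnorm y <= c.
Proof.
move=> h; apply: ge_sup => [|_ [x x1 <-]]; last exact: h.
by exists (modulus (y 0 : K)), 0 => //; rewrite /nball /= (seminorm0 snrm).
Qed.

Lemma dnorm_ge1 (y : dual X) x : nrm x <= 1 -> modulus (y x : K) <= dnorm y.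
Proof.
move=> x1; apply: ub_le_sup; last by exists x.
have [M M0 h] := dual_bounded y; exists M => _ [z z1 <-].
by apply: le_trans (h z) _; rewrite -[leRHS]mulr1 ler_wpM2l.
Qed.

Lemma dnorm_ge (y : dual X) x : modulus (y x : K) <= dnorm y * nrm x.
Proof.
have [/nrm0->|nx] := eqVneq (nrm x) 0.
  by rewrite clin0 modulus0 (seminorm0 snrm) mulr0.
have x0 : 0 < nrm x by rewrite lt_neqAle eq_sym nx (seminorm_ge0 snrm).
have := @dnorm_ge1 y (embed k (nrm x)^-1 *: x).
rewrite (seminormZe snrm) ?invr_ge0 ?(ltW x0)// mulVf// lexx => /(_ isT).
rewrite clinZ modulusM modulus_embed ger0_norm ?invr_ge0 ?(ltW x0)//.
by rewrite mulrC ler_pdivrMr.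
Qed.

Lemma dnorm_seminorm : seminorm (dnorm : dual X -> R).
Proof.
apply: le_seminorm => [y z|a y]; apply: dnorm_le => x x1.
  rewrite dual_addE; apply: le_trans (modulusD _ _) _.
  by apply: lerD; exact: dnorm_ge1.
rewrite dual_scaleE modulusM; apply: ler_wpM2l; first exact: modulus_ge0.
exact: dnorm_ge1.
Qed.

(** On an unbounded set, points [x n] and seminorms [q n] with [q n (x n)] above [(n + 1)^2]
    combine, with weights [1 / (n + 1)], to a continuous seminorm that is unbounded on the set. *)
Lemma compact_bounded (A : set X) : compact A ->
  exists2 c, 0 < c & forall x, A x -> nrm x <= c.
Proof.
move=> cA; apply: contrapT => hn.
have hx n : exists x, A x /\ exists2 q, G q & n.+1%:R ^+ 2 < q x.
  apply: contrapT => hx; apply: hn; exists (n.+1%:R ^+ 2) => [|x Ax].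
    by rewrite exprn_gt0.
  rewrite leNgt; apply/negP => /Gsup[q Gq qx]; apply: hx.
    by exists x; split=> //; exists q.
have [x xP] := choice hx.
have hq n : exists q, G q /\ n.+1%:R ^+ 2 < q (x n).
  by have [_ [q Gq qx]] := xP n; exists q.
have [q qP] := choice hq.
have d : submixed_data G q (fun n => n.+1%:R^-1).
  split=> [n|n|]; [exact: (qP n).1 | by rewrite invr_ge0 |].
  exact: null_sequence_harmonic.
pose N := submixed q (fun n => n.+1%:R^-1 : R).
have NN : NS N by exists (q, fun n => n.+1%:R^-1).
have [||||z Az zN] := @compact_directed_meet X nat setT A
  (fun n => [set z | n%:R <= N z]) cA.
- by exists 0%N.
- move=> i j _ _; exists (maxn i j) => // z /= hz.
  by split; apply: le_trans hz; rewrite ler_nat ?leq_maxl ?leq_maxr.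
- move=> n _; apply: (closed_ge_generated gamma_generated (r := N) (M := 1) NN).
    exact: (gamma_generated.1 _ NN).
  by move=> z; rewrite mul1r.
- move=> n _; exists (x n); split; first exact: (xP n).1.
  rewrite /=; apply: le_trans (submixed_ge dG sG Gle d n (x n)).
  rewrite ler_pdivlMr//; apply: le_trans (ltW (qP n).2).
  by rewrite expr2 ler_wpM2r// ler_nat.
have := zN (Num.truncn (N z)).+1 I; rewrite /= leNgt.
by rewrite truncnS_gt.
Qed.

(** Compact sets lie in balls, and balls are themselves absolutely convex and compact. *)
Lemma kappa_generated :
  generated_by ([set dnorm] : set (dual_kappa X -> R)).
Proof.
apply: (generated_uniform (Q := [set @modulus R k])).
- exact: generated_scalars.
- exact: dual_eval_linear.
- by split; [exists dnorm | move=> _ _ -> ->; exists dnorm].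
- by split; [exists (@modulus R k) | move=> _ _ -> ->; exists (@modulus R k)].
- by move=> _ ->; exact: dnorm_seminorm.
- move=> A _ [_ /compact_bounded[c c0 hc]] ->; exists dnorm, c; split=> // y x Ax.
  apply: le_trans (dnorm_ge y x) _; rewrite mulrC ler_wpM2r ?hc//.
  exact: (seminorm_ge0 dnorm_seminorm).
- move=> _ ->; exists (nball nrm 1), (@modulus R k), 1; split=> //.
    split; last exact: ball_compact.
    move=> x y a b x1 y1 ab; apply: le_trans (seminormD snrm _ _) _.
    rewrite !(seminormZ snrm); have := modulus_ge0 a; have := modulus_ge0 b.
    by move: x1 y1; rewrite /nball /=; nra.
  by move=> y c c0 h; rewrite mul1r; apply: dnorm_le.
Qed.

End montel.

(** * Duality *)

Section pairing.
Context (K : fieldType) (V W : lmodType K) (b : W -> V -> K).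
Hypotheses (br : forall w, linear (b w : V -> K^o))
  (bl : forall x, linear (b^~ x : W -> K^o)).

Lemma scalar_linear (U : lmodType K) (f : U -> K) : linear (f : U -> K^o) ->
  [/\ f 0 = 0, forall x y, f (x + y) = f x + f y,
      forall x y, f (x - y) = f x - f y & forall a x, f (a *: x) = a * f x].
Proof.
move=> lf; have fD x y : f (x + y) = f x + f y.
  by have := lf 1 x y; rewrite !scale1r.
have f0 : f 0 = 0 by apply: (addrI (f 0)); rewrite -fD !addr0.
have fZ a x : f (a *: x) = a * f x.
  by have := lf a x 0; rewrite !addr0 f0 [RHS]addr0.
split=> // x y; apply: (addIr (f y)).
by rewrite -fD !subrK.
Qed.

Let brD w x y : b w (x + y) = b w x + b w y.
Proof. by have [] := scalar_linear (br w). Qed.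
Let brB w x y : b w (x - y) = b w x - b w y.
Proof. by have [] := scalar_linear (br w). Qed.
Let brZ w a x : b w (a *: x) = a * b w x.
Proof. by have [] := scalar_linear (br w). Qed.
Let bl0 x : b 0 x = 0. Proof. by have [] := scalar_linear (bl x). Qed.
Let blD u w x : b (u + w) x = b u x + b w x.
Proof. by have [] := scalar_linear (bl x). Qed.
Let blB u w x : b (u - w) x = b u x - b w x.
Proof. by have [] := scalar_linear (bl x). Qed.
Let blZ a w x : b (a *: w) x = a * b w x.
Proof. by have [] := scalar_linear (bl x). Qed.

(* [w] is a linear combination of [ys], expressed through linear forms so that
   no explicit coefficients are needed. *)
Definition in_span (ys : seq W) (w : W) := forall phi : W -> K,
  linear (phi : W -> K^o) ->
  (forall y, y \in ys -> phi y = 0) -> phi w = 0.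

Definition common_kernel (ys : seq W) := [set x | forall y, y \in ys -> b y x = 0].

Lemma common_kernel_cons y ys x : common_kernel ys x -> b y x = 0 ->
  common_kernel (y :: ys) x.
Proof. by move=> h yx z; rewrite in_cons => /orP[/eqP->|/h]. Qed.

Lemma vanishing_in_span (ys : seq W) (psi : V -> K) :
  linear (psi : V -> K^o) ->
  (forall x, common_kernel ys x -> psi x = 0) ->
  exists2 w, in_span ys w & forall x, psi x = b w x.
Proof.
elim: ys psi => [|y ys IHys] psi lpsi h.
  exists 0 => [phi lphi _|x]; last by rewrite bl0 h.
  by have [] := scalar_linear lphi.
have weaken w : in_span ys w -> in_span (y :: ys) w.
  by move=> hw phi lphi h0; apply: hw => // z zys; apply: h0; rewrite in_cons zys orbT.
have [[v [vys yv]]|nv] := pselect (exists v, common_kernel ys v /\ b y v <> 0);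
    last first.
  have [|w /weaken hw wE] := IHys psi lpsi; last by exists w.
  move=> x xys; apply: h; apply: common_kernel_cons => //.
  by apply: contrapT => yx; apply: nv; exists x.
pose c : K := psi v / b y v.
have [_ psiD psiB psiZ] := scalar_linear lpsi.
have [||w hw wE] := IHys (fun x => psi x - c * b y x).
- move=> a x z; rewrite psiD psiZ brD brZ mulrDr opprD addrACA.
  by rewrite mulrCA -mulrBr.
- move=> x xys; pose x' := x - (b y x / b y v) *: v.
  have : psi x' = 0.
    apply: h; apply: common_kernel_cons => [z zys|].
      by rewrite /x' brB brZ (vys z)// mulr0 subr0 xys.
    by rewrite /x' brB brZ divfK ?subrr//; apply/eqP.
  by rewrite /x' psiB psiZ /c mulrAC [_ / _ * b y x]mulrAC [b y x * _]mulrC.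
exists (w + c *: y) => [phi lphi h0|x]; last first.
  by rewrite blD blZ -wE subrK.
have [_ phiD _ phiZ] := scalar_linear lphi.
by rewrite phiD phiZ (h0 y) ?mem_head// mulr0 addr0 (weaken w hw phi).
Qed.

(** The condition at a new [y] is met by moving along a vector on which the earlier forms vanish.
    Without such a vector [b y] depends on the earlier forms, and [phi] inherits the dependence
    through the second hypothesis. *)
Lemma interpolation (ys : seq W) (phi : W -> K) :
  linear (phi : W -> K^o) ->
  (forall w, (forall x, b w x = 0) -> phi w = 0) ->
  exists x, forall y, y \in ys -> b y x = phi y.
Proof.
move=> lphi nd; elim: ys => [|y ys [x hx]]; first by exists 0.
have [[v [vys yv]]|nv] := pselect (exists v, common_kernel ys v /\ b y v <> 0).
  exists (x + ((phi y - b y x) / b y v) *: v) => z.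
  rewrite in_cons brD brZ => /orP[/eqP->|zys].
    by rewrite divfK ?subrKC//; apply/eqP.
  by rewrite (vys z)// mulr0 addr0 hx.
exists x => z; rewrite in_cons => /orP[/eqP->|]; last exact: hx.
have [|w hw wE] := @vanishing_in_span ys (b y) (br y).
  by move=> u uys; apply: contrapT => yu; apply: nv; exists u.
have [_ phiD phiB phiZ] := scalar_linear lphi.
have -> : phi y = phi w.
  apply/eqP; rewrite -subr_eq0 -phiB; apply/eqP/nd => u.
  by rewrite blB wE subrr.
apply/eqP; rewrite wE eq_sym -subr_eq0; apply/eqP.
apply: (hw (fun u => phi u - b u x)) => [a u u'|u uys]; last by rewrite hx// subrr.
by rewrite phiD phiZ blD blZ opprD addrACA -mulrBr.
Qed.

End pairing.

Section mackey_arens.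
Context (R : realType) (k : scalar_kind).
Local Notation K := (scalars R k).
Context (V : lmodType K) (nrm : V -> R) (tau gamma : topology V)
  (G : set (V -> R)).
Hypothesis H : montel_saks nrm tau gamma G.

Local Notation X := (V \with gamma).
Local Notation NS := (submixed_seminorms G).
Local Notation dnorm := (@dnorm _ _ _ nrm gamma).

Let snrm := montel_norm H.

(** Helly's lemma. An algebraic solution [x0] may be changed within the common kernel [L]. A
    functional measuring the distance from [x0] to [L] is a combination [w] of the [ys] with
    [dnorm w <= 1], so this distance is the modulus of [phi w], at most [C]. It need not be
    attained, whence [C + 1]. *)
Lemma helly (phi : dual X -> K^o) C (ys : seq (dual X)) : linear phi -> 0 <= C ->
  (forall y : dual X, modulus (phi y : K) <= C * dnorm y) ->
  exists2 x, nrm x <= C + 1 & forall y : dual X, y \in ys -> y x = phi y.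
Proof.
move=> lphi C0 hphi; pose b (y : dual X) : V -> K := y.
have br w : linear (b w : V -> K^o).
  by move=> a x y; exact: (@clin_linear _ X _ w a x y).
have bl x : linear (b^~ x : dual X -> K^o) by exact: dual_eval_linear.
have phi0 : phi 0 = 0.
  by have := lphi (-1) 0 0; rewrite scaler0 addr0 scaleN1r addNr.
have [|x0 hx0] := interpolation br bl ys lphi.
  move=> w w0; suff -> : w = 0 by [].
  by apply: clin_ext => x; exact: w0.
pose L := common_kernel b ys.
have L0 : L 0 by move=> y _; exact: clin0.
have Ll (a : K) x y : L x -> L y -> L (a *: x + y).
  by move=> Lx Ly z zys; rewrite br Lx// Ly// scaler0 addr0.
have sq := quotient_seminormP snrm L0 Ll.
have [psi [lpsi psiq psix]] := hahn_banach x0 sq.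
have [|w hw wE] := vanishing_in_span br bl (ys := ys) lpsi.
  move=> x Lx; apply: modulus_eq0; apply/eqP.
  rewrite eq_le modulus_ge0 andbT; apply: le_trans (psiq x) _.
  by rewrite (quotient_seminorm_eq0 snrm L0 Ll).
have wx0 : phi w = clin_fun w x0.
  apply/eqP; rewrite -subr_eq0; apply/eqP.
  apply: (hw (fun u => phi u - b u x0)) => [a u u'|u uys].
    have [_ phiD _ phiZ] := scalar_linear lphi.
    have [_ bD _ bZ] := scalar_linear (bl x0).
    by rewrite phiD phiZ bD bZ opprD addrACA -mulrBr.
  by rewrite hx0// subrr.
have : quotient_seminorm nrm L x0 < C + 1.
  rewrite -psix wE -[b w x0]/(clin_fun w x0) -wx0; apply: le_lt_trans (hphi w) _.
  have : dnorm w <= 1.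
    apply: (dnorm_le H) => x x1; rewrite -[clin_fun w x]/(b w x) -wE.
    apply: le_trans (psiq x) _; apply: le_trans x1.
    exact: (quotient_seminorm_le snrm L0).
  by nra.
move=> /(quotient_seminorm_lt L0)[l Ll' xl].
exists (x0 - l); first exact: ltW.
by move=> y yys; rewrite clinB -[y x0]/(b y x0) hx0// -[y l]/(b y l) Ll'// subr0.
Qed.

(** Finite parts of the system [y g = phi y] have solutions in one fixed ball by [helly];
    compactness of that ball solves the whole system. *)
Lemma mackey_arens (phi : dual X -> K^o) C : linear phi -> 0 <= C ->
  (forall y : dual X, modulus (phi y : K) <= C * dnorm y) ->
  exists g : V, forall y : dual X, phi y = y g.
Proof.
move=> lphi C0 hphi.
have [||||g _ hg] := @compact_directed_meet X (seq (dual X)) setT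
  (nball nrm (C + 1)) (fun ys => [set x | forall y : dual X, y \in ys -> y x = phi y])
  (ball_compact H (c := C + 1)).
- by exists [::].
- move=> s t _ _; exists (s ++ t) => // x h.
  by split=> y ys; apply: h; rewrite mem_cat ys ?orbT.
- move=> s _.
  have -> : [set x | forall y : dual X, y \in s -> y x = phi y] =
      \bigcap_(y in [set` s]) ((clin_fun y : X -> K^o) @^-1` [set phi y]) by [].
  apply: (@closed_bigI X) => y _; apply: closed_comp.
    by move=> x _; exact: (@clin_continuous _ _ _ y).
  apply: accessible_closed_set1; apply: hausdorff_accessible.
  exact: norm_hausdorff.
- by move=> s _; have [x xC hx] := helly s lphi C0 hphi; exists x.
by exists g => y; rewrite (hg [:: y])// mem_head.
Qed.

(** A functional vanishing on [D] and measuring the distance from [y] to [D] is evaluation at some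
    [g]; the separation hypothesis gives [g = 0], so the distance is 0. *)
Lemma dnorm_dense (D : set (dual X)) : D 0 ->
  (forall (a : K) y z, D y -> D z -> D (a *: y + z)) ->
  (forall g : V, (forall y : dual X, D y -> y g = 0) -> g = 0) ->
  forall y e, 0 < e -> exists2 d, D d & dnorm (y - d) < e.
Proof.
move=> D0 Dl sep y e e0; have sd := dnorm_seminorm H.
apply: (quotient_seminorm_lt D0).
have sq := quotient_seminormP sd D0 Dl.
have [psi [lpsi psiq psiy]] := hahn_banach y sq.
have [|g hg] := mackey_arens lpsi ler01.
  move=> z; rewrite mul1r; apply: le_trans (psiq z) _.
  exact: (quotient_seminorm_le sd D0).
have g0 : g = 0.
  apply: sep => d Dd; rewrite -hg; apply: modulus_eq0; apply/eqP.
  rewrite eq_le modulus_ge0 andbT; apply: le_trans (psiq d) _.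
  by rewrite (quotient_seminorm_eq0 sd D0 Dl).
by rewrite -psiy hg g0 clin0 modulus0.
Qed.

(** The Banach-Dieudonne argument for a polar of the sequence: on a fixed ball only finitely many
    [y n] can reach modulus 1, so the part of the ball outside [W] is closed. *)
Lemma dnorm_null_sequence (y : nat -> dual X) :
  (forall n, dnorm (y n) <= n.+1%:R^-1) ->
  exists2 N, NS N & forall n x, modulus (y n x : K) <= N x.
Proof.
move=> hy; pose W := [set x | forall n, modulus (y n x : K) < 1].
have ym n := dual_seminorm (y n).
have [G1 G2 G3 G4] := H.
have [||N NN hN] := @banach_dieudonne _ _ _ _ _ snrm (saks_directed G2)
  (saks_seminorm G2) (saks_le G2) (saks_sup G2) gamma (montel_norm_eq0 H)
  (@closed_le_mixed _ _ _ _ _ _ _ H) (@ball_compact _ _ _ _ _ _ _ H) W.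
- by move=> n; rewrite clin0 modulus0.
- move=> c; pose n0 := (Num.truncn c).+1.
  have -> : nball nrm c `\` W = nball nrm c `&`
      \bigcup_(i in `I_n0) [set x | 1 <= modulus (y i x : K)].
    apply/seteqP; split=> x [xc].
      move=> /existsNP[n /negP]; rewrite -leNgt => yn1; split=> //.
      exists n => //=; rewrite ltnNge; apply/negP => n0n.
      have := le_trans yn1 (dnorm_ge H (y n) x); apply/negP; rewrite -ltNge.
      have x0 := seminorm_ge0 snrm x.
      have cn : c < n.+1%:R.
        by apply: lt_le_trans (truncnS_gt c) _; rewrite ler_nat; exact: leqW.
      apply: (@le_lt_trans _ _ (n.+1%:R^-1 * nrm x)).
        by rewrite ler_wpM2r.
      by rewrite mulrC ltr_pdivrMr// mul1r; apply: le_lt_trans cn.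
    by move=> [i _ /= yi]; split=> // /(_ i); rewrite ltNge yi.
  apply: (@closedI X); first exact: (ball_closed H).
  apply: (@closed_bigcup X); first exact: finite_II.
  move=> i _; have [N [M [NN _ hM]]] := dual_bound H (y i).
  exact: (closed_ge_generated (gamma_generated H) NN (ym i) hM).
exists N => // n x.
rewrite -[N x]mul1r -[1 in leRHS](divr1 1).
apply: (seminorm_bound ((gamma_generated H).1 _ NN) (ym n) ltr01) => z.
by move=> /hN/(_ n)/ltW.
Qed.

End mackey_arens.

(** * Weak vector-valued functions *)

Section target.
Context (R : realType) (k : scalar_kind).
Local Notation K := (scalars R k).
Context (E : topologicalLmodType K) (GE : set (E -> R)).
Hypotheses (gE : generated_by GE).

Lemma polarP p : seminorm p -> forall e : dual E,
  polar (k := k) [set x | p x < 1] e <->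
  forall x, modulus (e x : K) <= p x.
Proof.
move=> sp e; split=> [h x|h x /= px]; last exact: le_trans (h x) (ltW px).
rewrite -[p x]mul1r -[1 in leRHS](divr1 1).
by apply: (seminorm_bound sp (dual_seminorm e) ltr01) => z; exact: h.
Qed.

Lemma dominated_dual p (psi : E -> K^o) (M : R) : GE p -> linear psi ->
  (forall x, modulus (psi x : K) <= M * p x) ->
  exists e : dual E, forall x, e x = psi x.
Proof.
move=> Gp lpsi hpsi; have cpsi : continuous psi.
  apply/(generated_continuous gE (generated_scalars R k) lpsi) => _ ->.
  by exists p, M.
by exists (mk_clin lpsi cpsi).
Qed.

Lemma polar_norming p z : GE p ->
  exists2 e : dual E, polar (k := k) [set x | p x < 1] e & modulus (e z : K) = p z.
Proof.
move=> Gp; have sp := gE.1 _ Gp.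
have [psi [lpsi psip psiz]] := hahn_banach z sp.
have psip1 x : modulus (psi x : K) <= 1 * p x by rewrite mul1r.
have [e he] := dominated_dual Gp lpsi psip1.
exists e; last by rewrite he.
by apply/polarP => // x; rewrite he.
Qed.

Lemma dual_dominated (e : dual E) : exists p M, [/\ GE p, 0 < M &
  forall x, modulus (e x : K) <= M * p x].
Proof.
have [_ /(_ (@clin_continuous _ _ _ e) _ erefl)[p [M [Gp h]]]] :=
  generated_continuous gE (generated_scalars R k) (@clin_linear _ _ _ e).
exists p, (`|M| + 1); split=> // x.
apply: le_trans (h x) _; have := seminorm_ge0 (gE.1 _ Gp) x.
by have := ler_norm M; nra.
Qed.

Lemma hausdorff_seminorms : hausdorff_space E ->
  forall z, (forall p, GE p -> p z = 0) -> z = 0.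
Proof.
move=> hE z hz; apply/esym/hE => A B A0 Bz; exists z; split; last exact: nbhs_singleton.
have [p [e [Gp e0]]] := nbhs_generated gE A0; apply.
by rewrite subr0 hz.
Qed.

Lemma dual_separates : hausdorff_space E ->
  forall z w, (forall e : dual E, e z = e w) -> z = w.
Proof.
move=> hE z w h; apply/eqP; rewrite -subr_eq0; apply/eqP.
apply: (hausdorff_seminorms hE) => p Gp.
have [e _ <-] := polar_norming (z - w) Gp.
by rewrite clinB h subrr modulus0.
Qed.

End target.

Section weak_functions.
Context (R : realType) (k : scalar_kind).
Local Notation K := (scalars R k).
Context (Omega : Type) (F : submodClosed (Omega -> K^o)).
Local Notation FO := (subspace_type F).

Lemma feval_linear x : linear (fun f : FO => feval f x).
Proof. by move=> a f g; rewrite /feval linearP. Qed.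

Lemma feval0 x : feval (0 : FO) x = 0 :> K. Proof. by []. Qed.

Lemma feval_ext (f g : FO) : (forall x, feval f x = feval g x) -> f = g.
Proof. by move=> fg; apply/val_inj/funext. Qed.

Lemma weval_linear (E : topologicalLmodType K) x :
  linear (fun f : weak_space F E => weval f x).
Proof. by move=> a f g; rewrite /weval linearP. Qed.

Lemma weval_ext (E : topologicalLmodType K) (f g : weak_space F E) :
  (forall x, weval f x = weval g x) -> f = g.
Proof. by move=> fg; apply/val_inj/funext. Qed.

Lemma dual_compE (E : topologicalLmodType K) (e : dual E) (f : weak_space F E) x :
  feval (dual_comp e f) x = e (weval f x).
Proof. by []. Qed.

Lemma dual_comp_linearl (E : topologicalLmodType K) (f : weak_space F E) :
  linear (fun e : dual E => dual_comp e f).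
Proof.
move=> a e e'; apply: feval_ext => x; rewrite feval_linear !dual_compE.
exact: dual_eval_linear.
Qed.

Lemma dual_comp_linearr (E : topologicalLmodType K) (e : dual E) :
  linear (fun f : weak_space F E => dual_comp e f).
Proof.
move=> a f g; apply: feval_ext => x; rewrite feval_linear !dual_compE.
by rewrite weval_linear clin_linear.
Qed.

End weak_functions.

(** * Boundedness of weak functions on polars *)

Section isomorphism.
Context (R : realType) (k : scalar_kind).
Local Notation K := (scalars R k).
Context (Omega : Type) (F : submodClosed (Omega -> K^o)).
Local Notation FO := (subspace_type F).
Context (nrm : FO -> R) (tau gamma : topology FO) (G : set (FO -> R)).
Hypotheses (H : montel_saks nrm tau gamma G)
  (pg : coarser (pointwise_topology F) gamma).

Local Notation X := (FO \with gamma).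
Local Notation NS := (submixed_seminorms G).
Local Notation dnorm := (@dnorm _ _ _ nrm gamma).

Let snrm := montel_norm H.

(* The ball is compact, hence closed for pointwise convergence. *)
Lemma norm_lower_semicontinuous (g : FO) c : c < nrm g ->
  exists (s : seq {classic Omega}) d, 0 < d /\ forall h : FO,
    (forall x, x \in s -> modulus (feval h x - feval g x : K) <= d) ->
    c < nrm h.
Proof.
move=> cg; apply: contrapT => hn.
have [||||h hc hg] := @compact_directed_meet X (seq {classic Omega} * nat) setT
  (nball nrm c) (fun sn => [set h : X | forall x, x \in sn.1 ->
     modulus (feval h x - feval g x : K) <= sn.2.+1%:R^-1])
  (ball_compact H (c := c)).
- by exists ([::], 0%N).
- move=> [s n] [t m] _ _; exists (s ++ t, maxn n m) => // h /= hh.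
  by split=> x /= xs; (apply: le_trans (hh x _) _;
    [by rewrite mem_cat xs ?orbT |
     by rewrite lef_pV2 ?posrE// ler_nat ltnS ?leq_maxl ?leq_maxr]).
- move=> [s n] _ /=.
  have -> : [set h : X | forall x, x \in s ->
      modulus (feval h x - feval g x : K) <= n.+1%:R^-1] =
      \bigcap_(x in [set` s]) ((clin_fun (Delta pg x) : X -> K^o) @^-1`
        [set z : K^o | modulus (z - feval g x : K) <= n.+1%:R^-1]) by [].
  apply: (@closed_bigI X) => x _; apply: closed_comp.
    by move=> h _; exact: clin_continuous.
  apply: (closed_ball_generated (generated_scalars R k) (r := @modulus R k)
    (M := 1) erefl); first exact: ((generated_scalars R k).1 _ erefl).
  by move=> z; rewrite mul1r.
- move=> [s n] _; apply: contrapT => /= hs; apply: hn; exists s, n.+1%:R^-1.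
  split=> [|h hh]; first by rewrite invr_gt0.
  by rewrite ltNge; apply/negP => hc; apply: hs; exists h.
have hgE : h = g.
  apply: feval_ext => x; apply/eqP; rewrite -subr_eq0; apply/eqP.
  apply: (@modulus_eq0 R k); apply/eqP; rewrite eq_le modulus_ge0 andbT.
  apply/ler_addgt0Pr => e e0; rewrite add0r.
  have hpos n : 0 <= n.+1%:R^-1 :> R by rewrite invr_ge0.
  have [n hn'] := (null_sequenceP hpos).1 (@null_sequence_harmonic R) e e0.
  apply: le_trans (hg ([:: x : {classic Omega}], n) I x _) (ltW (hn' n (leqnn n))).
  exact: mem_head.
by move: hc; rewrite hgE /nball /= leNgt cg.
Qed.

Section target_space.
Context (E : topologicalLmodType K) (GE : set (E -> R)).
Hypotheses (gE : generated_by GE) (dGE : directed GE).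

Local Notation WE := (weak_space F E).
Local Notation pol p := (polar (k := k) [set x : E | p x < 1]).

(** A pair [gr] is the centre and radius of a ball inside the polar of [p]. If [h \o f] has norm
    above [4 n / r], then [g + (r/4) h] or [g - (r/4) h] composes with [f] to norm above [n], as
    they differ by [(r/2) h]. Lower semicontinuity, a condition at finitely many points, preserves
    this on a small ball. *)
Lemma weak_bounded_step (f : WE) p : GE p ->
  (forall C, exists2 e : dual E, pol p e & C < nrm (dual_comp e f)) ->
  forall (gr : dual E * R) (n : nat), 0 < gr.2 ->
  (forall x, modulus (gr.1 x : K) <= (1 - gr.2) * p x) ->
  exists gr' : dual E * R, [/\ 0 < gr'.2, gr'.2 <= gr.2 / 4,
    (forall x, modulus (gr'.1 x : K) <= (1 - gr'.2) * p x),
    (forall x, modulus (gr'.1 x - gr.1 x : K) <= (gr.2 - gr'.2) * p x) &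
    forall e : dual E,
      (forall x, modulus (e x - gr'.1 x : K) <= 2 * gr'.2 * p x) ->
      n%:R < nrm (dual_comp e f)].
Proof.
move=> Gp hf [g r] n /= r0 gp; have sp := gE.1 _ Gp.
have [h hp hn] := hf (4 / r * n%:R).
have {}hp := (polarP sp h).1 hp.
have r40 : 0 < r / 4 by lra.
pose a : K := embed k (r / 4).
have ma : modulus a = r / 4 by rewrite modulus_embed ger0_norm// ltW.
have [b [mb hb]] : exists b : K, modulus b = r / 4 /\
    n%:R < nrm (dual_comp (b *: h + g) f).
  have hs : n%:R * 2 < nrm (dual_comp (a *: h + g) f) +
      nrm (dual_comp (- a *: h + g) f).
    apply: (@lt_le_trans _ _ (nrm (dual_comp (a *: h + g) f -
        dual_comp (- a *: h + g) f))); last exact: seminormB.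
    have -> : dual_comp (a *: h + g) f - dual_comp (- a *: h + g) f =
        (a + a) *: dual_comp h f.
      have lf := dual_comp_linearl f; rewrite (lf a h g) (lf (- a) h g).
      by rewrite opprD addrACA subrr addr0 -scalerBl opprK.
    have maa : modulus (a + a) = r / 2.
      by rewrite -rmorphD modulus_embed ger0_norm; lra.
    rewrite seminormZ// maa.
    by move: hn; rewrite mulrAC ltr_pdivrMr//; lra.
  have [h1|h1] := ltP n%:R (nrm (dual_comp (a *: h + g) f)).
    by exists a.
  by exists (- a); rewrite modulusN ma; split=> //; lra.
have [s [d [d0 hd]]] := norm_lower_semicontinuous hb.
have [M M0 hM] : exists2 M, 0 < M & forall x : {classic Omega}, x \in s ->
    p (weval f x) <= M.
  elim: (s) => [|x t [M M0 hM]]; first by exists 1.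
  have px := seminorm_ge0 sp (weval f x).
  exists (M + p (weval f x)) => [|y]; first by lra.
  by rewrite in_cons => /orP[/eqP->|/hM]; lra.
have dM0 : 0 < d / (2 * M) by rewrite divr_gt0// mulr_gt0.
(* [M] bounds [p \o f] at the points of [s]. The 2 in the second radius allows for the distance
   [2 * gr'.2], the loss in [scalars_complete]. *)
exists (b *: h + g, Num.min (r / 4) (d / (2 * M))); split=> /=.
- by rewrite lt_min r40.
- by rewrite ge_min lexx.
- move=> x; have px := seminorm_ge0 sp x.
  have rr : Num.min (r / 4) (d / (2 * M)) <= r / 4 by rewrite ge_min lexx.
  apply: (@le_trans _ _ (r / 4 * p x + (1 - r) * p x)); last by nra.
  rewrite dual_addE dual_scaleE; apply: le_trans (modulusD _ _) _.
  by rewrite modulusM mb; apply: lerD => //; apply: ler_wpM2l => //; exact: ltW.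
- move=> x; have px := seminorm_ge0 sp x.
  have rr : Num.min (r / 4) (d / (2 * M)) <= r / 4 by rewrite ge_min lexx.
  rewrite dual_addE dual_scaleE addrK modulusM mb.
  apply: (@le_trans _ _ (r / 4 * p x)); last by nra.
  by apply: ler_wpM2l => //; exact: ltW.
- move=> e he; apply: hd => x xs; rewrite !dual_compE; apply: le_trans (he _) _.
  have rr : Num.min (r / 4) (d / (2 * M)) <= d / (2 * M).
    by rewrite ge_min lexx orbT.
  have px := seminorm_ge0 sp (weval f x); have pM := hM _ xs.
  have rr0 : 0 < Num.min (r / 4) (d / (2 * M)) by rewrite lt_min r40.
  have dE : 2 * (d / (2 * M)) * M = d.
    by rewrite mulrAC mulrC divfK// gt_eqF// mulr_gt0.
  rewrite -[leRHS]dE; apply: ler_pM => //; first by rewrite mulr_ge0// ltW.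
  by rewrite ler_pM2l.
Qed.

(* A closed graph argument by nested balls in the dual of [(E, p)]: if the norms
   of [e \o f] were unbounded, a limit of suitable perturbations would give a
   functional [e] with [e \o f] of infinite norm. *)
Lemma weak_bounded (f : WE) p : GE p ->
  exists2 C, 0 <= C & forall e : dual E, pol p e -> nrm (dual_comp e f) <= C.
Proof.
move=> Gp; have sp := gE.1 _ Gp; apply: contrapT => hn.
have hf C : exists2 e : dual E, pol p e & C < nrm (dual_comp e f).
  apply: contrapT => hC; apply: hn; exists `|C| => // e pe.
  apply: le_trans (ler_norm _); rewrite leNgt; apply/negP => Ce.
  by apply: hC; exists e.
pose good (gr : dual E * R) := 0 < gr.2 /\
  forall x, modulus (gr.1 x : K) <= (1 - gr.2) * p x.
have step (grn : (dual E * R) * nat) : exists gr' : dual E * R, good grn.1 ->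
    [/\ good gr', gr'.2 <= grn.1.2 / 4,
    (forall x, modulus (gr'.1 x - grn.1.1 x : K) <= (grn.1.2 - gr'.2) * p x) &
    forall e : dual E,
      (forall x, modulus (e x - gr'.1 x : K) <= 2 * gr'.2 * p x) ->
      grn.2%:R < nrm (dual_comp e f)].
  case: grn => gr n; have [[r0 hr]|ng] := pselect (good gr); last by exists gr.
  have [gr' [h1 h2 h3 h4 h5]] := weak_bounded_step Gp hf n r0 hr.
  by exists gr' => _; split.
have [Q hQ] := choice step.
pose u := fix u n := if n is n'.+1 then Q (u n', n') else (0 : dual E, 1 : R).
have gu n : good (u n).
  elim: n => [|n IHn] /=; last by have [] := hQ (u n, n) IHn.
  by split=> //= x; rewrite subrr mul0r modulus0.
have ur n : (u n).2 <= n.+1%:R^-1.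
  elim: n => [|n IHn]; first by rewrite invr1.
  have [_ /= h _ _] := hQ (u n, n) (gu n); apply: le_trans h _.
  apply: (@le_trans _ _ (n.+1%:R^-1 / 4)); first by rewrite ler_pM2r.
  rewrite -invfM lef_pV2 ?posrE ?mulr_gt0// -[n.+2%:R]natr1 -[n.+1%:R]natr1.
  by have := ler0n R n; lra.
have um n m x : (n <= m)%N ->
    modulus ((u m).1 x - (u n).1 x : K) <= ((u n).2 - (u m).2) * p x.
  elim: m => [|m IHm]; first by rewrite leqn0 => /eqP->; rewrite !subrr modulus0 mul0r.
  rewrite leq_eqVlt => /orP[/eqP->|]; first by rewrite !subrr modulus0 mul0r.
  rewrite ltnS => /IHm nm; have [_ _ /(_ x) /= h _] := hQ (u m, m) (gu m).
  rewrite -(subrK ((u m).1 x) ((u m.+1).1 x)) -addrA.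
  by apply: le_trans (modulusD _ _) _; move: h nm => /=; lra.
have px x := seminorm_ge0 sp x.
have hlim x : exists l : K, forall n,
    modulus (l - (u n).1 x : K) <= 2 * ((u n).2 * p x).
  apply: scalars_complete => n m nm; apply: le_trans (um _ _ x nm) _.
  by apply: ler_wpM2r => //; have [] := gu m; lra.
have [l hl] := choice hlim.
(* The radii tend to 0, so an identity valid for each centre [(u n).1] up to a multiple of the
   radius is exact for the limit [l]. *)
have squeeze (z : K) C : (forall n, modulus z <= (u n).2 * C) -> z = 0.
  move=> hz; apply: modulus_eq0; apply/eqP; rewrite eq_le modulus_ge0 andbT.
  have C0 : 0 <= C.
    by have := hz 0%N; rewrite /= mul1r; apply: le_trans (modulus_ge0 _).
  apply/ler_addgt0Pr => e e0; rewrite add0r.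
  have hpos n : 0 <= n.+1%:R^-1 :> R by rewrite invr_ge0.
  have eC : 0 < e / (C + 1) by rewrite divr_gt0//; lra.
  have [n hn'] := (null_sequenceP hpos).1 (@null_sequence_harmonic R) _ eC.
  have := hn' n (leqnn n); rewrite ltr_pdivlMr; last lra.
  have := hz n; have := ur n; have [+ _] := gu n.
  by move: (n.+1%:R^-1) => t; nra.
have ll : linear (l : E -> K^o).
  move=> a x y; apply/eqP; rewrite -subr_eq0; apply/eqP.
  apply: (squeeze _ (2 * (p (a *: x + y) + modulus a * p x + p y))) => n.
  have -> : l (a *: x + y) - (a *: (l x : K^o) + l y) =
      (l (a *: x + y) - (u n).1 (a *: x + y)) - (a * (l x - (u n).1 x) +
        (l y - (u n).1 y)) :> K.
    by rewrite clin_linear /GRing.scale /=; ring.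
  apply: le_trans (modulusD _ _) _; rewrite modulusN.
  have := modulusD (a * (l x - (u n).1 x)) (l y - (u n).1 y).
  rewrite modulusM; have := hl (a *: x + y) n; have := hl y n.
  by have := hl x n; have := modulus_ge0 a; nra.
have lp x : modulus (l x : K) <= 2 * p x.
  by have := hl x 0%N; rewrite /= subr0 mul1r.
have [e he] := dominated_dual gE Gp ll lp.
pose m := (Num.truncn (nrm (dual_comp e f))).+1.
have [_ _ _ /(_ e) hm] := hQ (u m, m) (gu m).
have : m%:R < nrm (dual_comp e f).
  by apply: hm => x; rewrite he -mulrA; exact: (hl x m.+1).
by rewrite ltNge ltW// truncnS_gt.
Qed.

End target_space.
End isomorphism.

(** * The seminorms of [gamma_sigma_s] and the map [chi] *)

Section epsilon_product.
Context (R : realType) (k : scalar_kind).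
Local Notation K := (scalars R k).
Context (Omega : Type) (F : submodClosed (Omega -> K^o)).
Local Notation FO := (subspace_type F).
Context (nrm : FO -> R) (tau gamma : topology FO) (G : set (FO -> R)).
Hypotheses (H : montel_saks nrm tau gamma G)
  (pg : coarser (pointwise_topology F) gamma).
Context (E : topologicalLmodType K) (GE : set (E -> R)).
Hypotheses (gE : generated_by GE) (dGE : directed GE).

Local Notation X := (FO \with gamma).
Local Notation NS := (submixed_seminorms G).
Local Notation dnorm := (@dnorm _ _ _ nrm gamma).
Local Notation WE := (weak_space F E).
Local Notation pol p := (polar (k := k) [set x : E | p x < 1]).
Local Notation gsem p q a := (@gamma_sigma_s_seminorm R k Omega F E p q a).

Let snrm := montel_norm H.
Let G_saks : saks_system nrm tau G. Proof. by case: H. Qed.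
Let dG := saks_directed G_saks.
Let sG := saks_seminorm G_saks.
Let Gle := saks_le G_saks.

Section one_seminorm.
Context (p : E -> R) (q : nat -> FO -> R) (a : nat -> R).
Hypotheses (Gp : GE p) (qa : submixed_data G q a).

(** [weak_bounded] supplies the upper bound that makes [sup] a genuine supremum. *)
Lemma gamma_sigma_ge (f : WE) (e : dual E) : pol p e ->
  submixed q a (dual_comp e f) <= gsem p q a f.
Proof.
move=> pe; have [C C0 hC] := weak_bounded H pg gE f Gp.
have [M M0 hM] := submixed_bound dG sG Gle qa.
apply: ub_le_sup; last by exists e.
exists (M * C) => _ [e' pe' <-]; apply: submixed_le => n.
by apply: le_trans (hM _ _) _; apply: ler_wpM2l => //; exact: hC.
Qed.

Lemma gamma_sigma_le (f : WE) c :
  (forall e : dual E, pol p e -> submixed q a (dual_comp e f) <= c) ->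
  gsem p q a f <= c.
Proof.
move=> h; apply: ge_sup => [|_ [e pe <-]]; last exact: h.
exists (submixed q a (dual_comp 0 f)), 0 => //.
by apply/(polarP (gE.1 _ Gp)) => x; rewrite modulus0 (seminorm_ge0 (gE.1 _ Gp)).
Qed.

Lemma gamma_sigma_is_seminorm : seminorm (gsem p q a).
Proof.
have sN := submixed_seminorm dG sG Gle qa.
apply: le_seminorm => [f g|b f]; apply: gamma_sigma_le => e pe.
  have := dual_comp_linearr e 1 f g; rewrite !scale1r => ->.
  by apply: le_trans (seminormD sN _ _) _; apply: lerD; exact: gamma_sigma_ge.
have := dual_comp_linearr e b f 0; rewrite addr0 => ->.
have -> : dual_comp e (0 : WE) = 0.
  by apply: feval_ext => x; rewrite dual_compE feval0 [LHS](@clin0 _ _ _ e).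
rewrite addr0 (seminormZ sN); apply: ler_wpM2l; first exact: modulus_ge0.
exact: gamma_sigma_ge.
Qed.

End one_seminorm.

Definition gamma_sigma_seminorms : set (WE -> R) :=
  [set N | exists p q a, [/\ GE p, forall n, G (q n),
     (forall n, 0 <= a n), (a : nat -> R^o) @ \oo --> (0 : R^o) &
     N = gsem p q a]].

Lemma gamma_sigma_seminormsP N : gamma_sigma_seminorms N <->
  exists p q a, [/\ GE p, submixed_data G q a & N = gsem p q a].
Proof.
split=> [[p [q [a [h1 h2 h3 h4 h5]]]]|[p [q [a [h1 [h2 h3 h4] h5]]]]];
  by exists p, q, a; split.
Qed.

Lemma gamma_sigma_directed : directed gamma_sigma_seminorms.
Proof.
split.
  have [[p Gp] _] := dGE; have [[N [[q a] d NE]] _] := submixed_directed dG sG Gle.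
  by exists (gsem p q a); apply/gamma_sigma_seminormsP; exists p, q, a.
move=> N1 N2 /gamma_sigma_seminormsP[p1 [q1 [a1 [Gp1 d1 ->]]]].
move=> /gamma_sigma_seminormsP[p2 [q2 [a2 [Gp2 d2 ->]]]].
have [p Gp hp] := dGE.2 _ _ Gp1 Gp2.
have [q [a [d hqa]]] := submixed_interleave dG sG Gle d1 d2.
have sp := gE.1 _ Gp; have sp1 := gE.1 _ Gp1; have sp2 := gE.1 _ Gp2.
exists (gsem p q a); first by apply/gamma_sigma_seminormsP; exists p, q, a.
move=> f; split; apply: gamma_sigma_le => // e pe.
  apply: le_trans (hqa _).1 _; apply: gamma_sigma_ge => //.
  by apply/polarP => // x; apply: le_trans ((polarP sp1 e).1 pe x) _; have [] := hp x.
apply: le_trans (hqa _).2 _; apply: gamma_sigma_ge => //.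
by apply/polarP => // x; apply: le_trans ((polarP sp2 e).1 pe x) _; have [] := hp x.
Qed.

Lemma gamma_sigma_generated :
  generated_by (gamma_sigma_seminorms : set (WE \with gamma_sigma_s GE G -> R)).
Proof.
apply: generated_seminorm_topology; first exact: gamma_sigma_directed.
move=> N /gamma_sigma_seminormsP[p [q [a [Gp d ->]]]].
exact: gamma_sigma_is_seminorm.
Qed.

Lemma eps_bounded (u : clin (dual_kappa X) E) p : GE p ->
  exists2 C, 0 <= C & forall y : dual X, p (clin_fun u y) <= C * dnorm y.
Proof.
move=> Gp; have [_ /(_ (@clin_continuous _ _ _ u) _ Gp)[_ [M [-> h]]]] :=
  generated_continuous (kappa_generated H) gE (@clin_linear _ _ _ u).
exists `|M| => // y; apply: le_trans (h y) _.
by apply: ler_wpM2r; rewrite ?ler_norm// (seminorm_ge0 (dnorm_seminorm H)).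
Qed.

Lemma eps_represented (u : clin (dual_kappa X) E) (e : dual E) :
  exists g : FO, forall y : dual X, e (clin_fun u y) = clin_fun y g.
Proof.
have [p [M [Gp M0 hM]]] := dual_dominated gE e.
have [C C0 hC] := eps_bounded u Gp.
apply: (mackey_arens H (phi := fun y : dual X => e (clin_fun u y)) (C := M * C)).
- by apply: dual_comp_is_linear; exact: eps_linear.
- by rewrite mulr_ge0// ltW.
- by move=> y; apply: le_trans (hM _) _; rewrite -mulrA ler_pM2l.
Qed.

Lemma chi_subproof (u : clin (dual_kappa X) E) :
  (fun x => clin_fun u (Delta pg x)) \in @weak_function R k Omega F E.
Proof.
apply/asboolP => e; have [g hg] := eps_represented u e.
have -> : (e \o (fun x => clin_fun u (Delta pg x)) : Omega -> K^o) = feval g.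
  by apply/funext => x; exact: (hg (Delta pg x)).
exact: valP.
Qed.

Definition chi (u : clin (dual_kappa X) E) : WE :=
  exist (fun h => h \in @weak_function R k Omega F E) _ (chi_subproof u).

(** The element [g] representing [e \o u] is a function, and testing it on the evaluations [Delta]
    reads off its values. *)
Lemma chi_pairing (u : clin (dual_kappa X) E) (e : dual E) (y : dual X) :
  e (clin_fun u y) = clin_fun y (dual_comp e (chi u)).
Proof.
have [g hg] := eps_represented u e; rewrite hg; congr (clin_fun y _).
by apply: feval_ext => x; rewrite -[LHS](hg (Delta pg x)).
Qed.

Lemma chi_linear : linear chi.
Proof. by move=> a u v; apply: weval_ext => x; rewrite weval_linear. Qed.

End epsilon_product.

Section estimates.
Context (R : realFieldType).
Implicit Types C e s t M N : R.

(** In [pairing_graph_total], [t1] and [t2] are the distances from [y] to two approximants, [s] is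
    the distance between them and [C] a Lipschitz constant. *)
Lemma cauchy_estimate C e s t1 t2 : 0 <= C -> 0 <= s -> s <= t1 + t2 ->
  t1 < e / 2 / (C + 1) -> t2 < e / 2 / (C + 1) -> C * s < e.
Proof.
move=> C0 s0 st h1 h2; have C10 : 0 < C + 1 by lra.
move: st h1 h2; rewrite -(ler_pM2l C10) !(ltr_pdivlMr _ _ C10); lra.
Qed.

Lemma limit_estimate M N t a b c d : 0 < M -> 0 <= N -> 0 <= d ->
  a <= M * c -> b <= d * N -> c < t / 2 / M -> d < t / 2 / (N + 1) -> a + b <= t.
Proof.
move=> M0 N0 d0 ac bd; have N10 : 0 < N + 1 by lra.
rewrite (ltr_pdivlMr _ _ M0) (ltr_pdivlMr _ _ N10); lra.
Qed.

End estimates.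

Lemma entourage_scalar (R : realType) (k : scalar_kind)
    (U : set ((scalars R k)^o * (scalars R k)^o)) :
  entourage U <-> exists2 e : R, 0 < e &
    forall z w : scalars R k, modulus (z - w) < e -> U (z, w).
Proof.
rewrite -entourage_from_ballE; split=> [[e /= e0 eU]|[e e0 eU]].
  exists (modulus e); first by rewrite -(embed_lt k) rmorph0 embed_modulus// ltW.
  move=> z w zw; apply: eU; rewrite /= -ball_normE /= norm_modulus.
  by rewrite -(embed_modulus (ltW e0)) embed_lt.
exists (embed k e); first by rewrite /= -(rmorph0 (embed k)) embed_lt.
by move=> [z w]; rewrite /= -ball_normE /= norm_modulus embed_lt; exact: eU.
Qed.

(** * Bijectivity of [chi] and comparison of seminorms *)

Section epsilon_isomorphism.
Context (R : realType) (k : scalar_kind).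
Local Notation K := (scalars R k).
Context (Omega : Type) (F : submodClosed (Omega -> K^o)).
Local Notation FO := (subspace_type F).
Context (nrm : FO -> R) (tau gamma : topology FO) (G : set (FO -> R)).
Hypotheses (H : montel_saks nrm tau gamma G)
  (pg : coarser (pointwise_topology F) gamma).
Context (E : tvsType K) (GE : set (E -> R)).
Hypotheses (gE : generated_by GE) (dGE : directed GE)
  (hE : hausdorff_space E) (cE : complete_tvs E).

Local Notation X := (FO \with gamma).
Local Notation NS := (submixed_seminorms G).
Local Notation dnorm := (@dnorm _ _ _ nrm gamma).
Local Notation WE := (weak_space F E).
Local Notation pol p := (polar (k := k) [set x : E | p x < 1]).
Local Notation gsem p q a := (@gamma_sigma_s_seminorm R k Omega F E p q a).
Local Notation chi := (chi H pg gE).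

Let snrm := montel_norm H.
Let G_saks : saks_system nrm tau G. Proof. by case: H. Qed.
Let dG := saks_directed G_saks.
Let sG := saks_seminorm G_saks.
Let Gle := saks_le G_saks.

(** The graph of the preimage of [f] under [chi], kept as a relation until it is known to be
    total. *)
Definition pairing_graph (f : WE) (d : dual X) (z : E) :=
  forall e : dual E, e z = clin_fun d (dual_comp e f) :> K.

(** A functional [e] of the polar that norms [z - z'] turns it into the value of [d - d'] at
    [e \o f], whose norm is bounded over the polar. *)
Lemma pairing_graph_le (f : WE) p : GE p -> exists2 C, 0 <= C &
  forall d z d' z', pairing_graph f d z -> pairing_graph f d' z' ->
    p (z - z') <= C * dnorm (d - d').
Proof.
move=> Gp; have [C C0 hC] := weak_bounded H pg gE f Gp.
exists C => // d z d' z' hz hz'.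
have [e pe <-] := polar_norming gE (z - z') Gp.
rewrite clinB (hz e) (hz' e) /= -dual_subE.
apply: le_trans (dnorm_ge H _ _) _; rewrite mulrC; apply: ler_wpM2r (hC e pe).
exact: (seminorm_ge0 (dnorm_seminorm H)).
Qed.

(* The elements [d] of the dual for which [d (e \o f)] is represented by a point
   of [E] form a dense subspace containing the point evaluations, and it is
   closed because [E] is complete. *)
Lemma pairing_graph_total (f : WE) (y : dual X) : exists z, pairing_graph f y z.
Proof.
pose D := [set d : dual X | exists z, pairing_graph f d z].
have dense := @dnorm_dense _ _ _ _ _ _ _ H D.
have {}dense : forall e, 0 < e -> exists2 d, D d & dnorm (y - d) < e.
  move=> e0; apply: dense.
  - by exists 0 => e; rewrite clin0.
  - move=> a d d' [z hz] [z' hz']; exists (a *: z + z') => e.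
    by rewrite dual_linearE (hz e) (hz' e) dual_addE dual_scaleE.
  - move=> g hg; apply: feval_ext => x; rewrite feval0.
    by apply: (hg (Delta pg x)); exists (weval f x) => e.
have sd := dnorm_seminorm H.
pose A (e : R) := [set z | exists2 d, dnorm (y - d) < e & pairing_graph f d z].
have PF : ProperFilter (filter_from [set e : R | 0 < e] A).
  apply: filter_from_proper; last first.
    by move=> e /= /dense[d [z hz] hd]; exists z, d.
  apply: filter_from_filter; first by exists 1 => /=; exact: ltr01.
  move=> e1 e2 /= e10 e20; exists (Num.min e1 e2); first by rewrite /= lt_min e10.
  move=> z [d + hd]; rewrite lt_min => /andP[d1 d2].
  by split; exists d.
have [p e Gp e0|z hz] := (generated_complete gE).2 cE _ PF.
  have [C C0 hC] := pairing_graph_le f Gp.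
  have C10 : 0 < C + 1 by lra.
  have eC : 0 < e / 2 / (C + 1) by rewrite !divr_gt0.
  exists (A (e / 2 / (C + 1))); first by exists (e / 2 / (C + 1)).
  move=> z z' [d hd gd] [d' hd' gd']; apply: le_lt_trans (hC _ _ _ _ gd gd') _.
  have := seminorm_triangle sd y d d'; rewrite (seminorm_distC sd d y).
  by move=> tri; exact: (cauchy_estimate C0 (seminorm_ge0 sd (d - d')) tri hd hd').
exists z => e /=; have [p [M [Gp M0 hM]]] := dual_dominated gE e.
apply: subr0_eq; apply: (@modulus_eq0 R k); apply/eqP.
rewrite eq_le modulus_ge0 andbT; apply/ler_addgt0Pr => t t0; rewrite add0r.
set g := dual_comp e f; have ng := seminorm_ge0 snrm g.
have g10 : 0 < nrm g + 1 by lra.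
have t1 : 0 < t / 2 / M by rewrite !divr_gt0.
have t2 : 0 < t / 2 / (nrm g + 1) by rewrite !divr_gt0.
have [w [[d hd gd] /= wz]] :
    exists w, A (t / 2 / (nrm g + 1)) w /\ p (w - z) < t / 2 / M.
  apply: (@filter_ex _ (filter_from [set e : R | 0 < e] A)).
  by apply: filterI; [exists (t / 2 / (nrm g + 1)) | exact: hz].
(* [w] represents [d], so [e w] and [d g] cancel. *)
have -> : e z - clin_fun y g = e (z - w) - clin_fun (y - d : dual X) g :> K.
  rewrite clinB (gd e) -/g dual_subE.
  by rewrite /=; ring.
apply: le_trans (modulusD _ _) _; rewrite modulusN.
have := hM (z - w); rewrite (seminorm_distC (gE.1 _ Gp) z w) => hzw.
exact: limit_estimate M0 ng (seminorm_ge0 sd _) hzw (dnorm_ge H (y - d) g) wz hd.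
Qed.

Lemma chi_surjective (f : WE) : exists u, chi u = f.
Proof.
have [v hv] := choice (pairing_graph_total f).
have lv : linear (v : dual X -> E).
  move=> a y y'; apply: (dual_separates gE hE) => e.
  rewrite dual_linearE (hv y e) (hv y' e) (hv (a *: y + y') e).
  by rewrite dual_addE dual_scaleE.
have lv' : linear (v : (dual_kappa X : preTopologicalLmodType _) -> E).
  by move=> a y y'; exact: (lv a y y').
have [cv _] := generated_continuous (kappa_generated H) gE lv'.
have {}cv : continuous (v : (dual_kappa X : preTopologicalLmodType _) -> E).
  apply: cv => p Gp.
  have [C C0 hC] := pairing_graph_le f Gp; exists dnorm, C; split=> // y.
  have v0 : v 0 = 0.
    by have := lv (-1) 0 0; rewrite scaler0 addr0 scaleN1r addNr.
  by have := hC y (v y) 0 (v 0) (hv y) (hv 0); rewrite v0 !subr0.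
exists (mk_clin lv' cv); apply: weval_ext => x.
by apply: (dual_separates gE hE) => e; exact: (hv (Delta pg x) e).
Qed.

Lemma chi_injective : injective chi.
Proof.
move=> u v uv; apply: clin_ext => y; apply: (dual_separates gE hE) => e.
by rewrite !(chi_pairing H pg gE) uv.
Qed.

(** With [gamma_sigma_le_eps] this identifies the seminorm of [chi u] with the supremum of [p (u h)]
    over all [h] dominated by [submixed q a], an equicontinuous set. *)
Lemma eps_le_gamma_sigma p q a (M : R) (h : dual X) : GE p -> submixed_data G q a ->
  0 <= M -> (forall x, modulus (clin_fun h x : K) <= M * submixed q a x) ->
  forall u : clin (dual_kappa X) E, p (clin_fun u h) <= M * gsem p q a (chi u).
Proof.
move=> Gp d M0 hh u; have [e pe <-] := polar_norming gE (clin_fun u h) Gp.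
rewrite (chi_pairing H pg gE); apply: le_trans (hh _) _; apply: ler_wpM2l => //.
exact: (gamma_sigma_ge H pg gE).
Qed.

(** Hahn-Banach yields an [h] dominated by [submixed q a] that attains it at [e \o chi u];
    [chi_pairing] rewrites that value as [e (u h)]. *)
Lemma gamma_sigma_le_eps p q a : GE p -> submixed_data G q a ->
  forall (u : clin (dual_kappa X) E) c, (forall h : dual X,
    (forall x, modulus (clin_fun h x : K) <= submixed q a x) ->
    p (clin_fun u h) <= c) -> gsem p q a (chi u) <= c.
Proof.
move=> Gp d u c hc; apply: (gamma_sigma_le gE) => // e pe.
have sN := submixed_seminorm dG sG Gle d.
have NN : NS (submixed q a) by exists (q, a).
have [psi [lpsi psiN <-]] := hahn_banach (dual_comp e (chi u)) sN.
have lpsi' : linear (psi : (X : preTopologicalLmodType _) -> K^o).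
  by move=> b x y; exact: (lpsi b x y).
have [cpsi _] :=
  generated_continuous (gamma_generated H) (generated_scalars R k) lpsi'.
have {}cpsi : continuous (psi : (X : preTopologicalLmodType _) -> K^o).
  by apply: cpsi => _ ->; exists (submixed q a), 1; split=> // x; rewrite mul1r.
have := hc (mk_clin lpsi' cpsi) psiN; apply: le_trans.
rewrite -[psi _]/(clin_fun (mk_clin lpsi' cpsi) _) -(chi_pairing H pg gE).
exact: ((polarP (gE.1 _ Gp) e).1 pe).
Qed.

(** Equicontinuity at 0 for the unit entourage is enough; homogeneity gives the bound everywhere. *)
Lemma equicontinuous_dominated (A : set (dual X)) :
  equicontinuous A (@clin_fun K X K^o) ->
  exists N M, [/\ NS N, 0 < M &
    forall h : dual X, A h -> forall x, modulus (clin_fun h x : K) <= M * N x].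
Proof.
move=> eA.
have ent : entourage [set zw : K^o * K^o | modulus (zw.1 - zw.2 : K) < 1].
  by apply/entourage_scalar; exists 1.
have [N [e [NN e0 h]]] := nbhs_generated (gamma_generated H) (eA 0 _ ent).
exists N, (1 / e); split=> // [|y Ay x]; first by rewrite divr_gt0.
apply: (seminorm_bound ((gamma_generated H).1 _ NN) (dual_seminorm y) e0) => z ze.
have := h z; rewrite subr0 => /(_ ze y Ay) /=.
by rewrite clin0 sub0r modulusN => /ltW.
Qed.

Lemma dominated_equicontinuous N : NS N ->
  equicontinuous [set h : dual X | forall x, modulus (clin_fun h x : K) <= N x]
    (@clin_fun K X K^o).
Proof.
move=> NN x U /entourage_scalar[e e0 eU].
apply: filterS (nbhs_ball_generated (gamma_generated H) x NN e0) => y /= yx h hh.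
apply: eU.
rewrite -clinB; apply: le_lt_trans (hh _) _.
by rewrite (seminorm_distC ((gamma_generated H).1 _ NN)).
Qed.

(** Taken as pull-backs along [chi]: once they are known to generate the epsilon-product,
    bicontinuity of [chi] is immediate. *)
Definition eps_seminorms : set (clin (dual_kappa X) E -> R) :=
  [set nu | exists2 N, gamma_sigma_seminorms G GE N & nu = N \o chi].

Lemma eps_seminorm_is_seminorm nu : eps_seminorms nu -> seminorm nu.
Proof.
move=> [N NN ->]; have sN := (gamma_sigma_generated H pg gE dGE).1 _ NN.
have lc := chi_linear H pg gE; split=> [u v|a u] /=.
  by have := lc 1 u v; rewrite !scale1r => ->; exact: (seminormD sN).
have c0 : chi 0 = 0 by have := lc (-1) 0 0; rewrite scaler0 addr0 scaleN1r addNr.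
have := lc a u 0; rewrite !addr0 c0 addr0 => ->; exact: (seminormZ sN).
Qed.

Lemma eps_seminorms_directed : directed eps_seminorms.
Proof.
have [[N NN] dGS] := gamma_sigma_directed H pg gE dGE.
split; first by exists (N \o chi), N.
move=> _ _ [N1 h1 ->] [N2 h2 ->]; have [N' h' hN'] := dGS _ _ h1 h2.
by exists (N' \o chi); [exists N' | move=> u; exact: hN'].
Qed.

Lemma eps_generated :
  generated_by (eps_seminorms : set (eps_product X E -> R)).
Proof.
apply: (generated_uniform (M := clin (dual_kappa X) E) gE).
- by move=> y; exact: eval_linear.
- exact: eps_seminorms_directed.
- exact: dGE.
- exact: eps_seminorm_is_seminorm.
- move=> A p eA Gp; have [_ [M [[[q a] /= d ->] M0 hM]]] := equicontinuous_dominated eA.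
  exists (gsem p q a \o chi), M; split=> //.
    by exists (gsem p q a) => //; apply/gamma_sigma_seminormsP; exists p, q, a.
  move=> u h Ah; apply: (eps_le_gamma_sigma Gp d); first exact: ltW.
  exact: hM.
- move=> _ [_ /gamma_sigma_seminormsP[p [q [a [Gp d ->]]]] ->].
  exists [set h : dual X | forall x, modulus (clin_fun h x : K) <= submixed q a x].
  exists p, 1; split=> //.
    by apply: dominated_equicontinuous; exists (q, a).
  by move=> u c c0 hc; rewrite mul1r; apply: gamma_sigma_le_eps.
Qed.

End epsilon_isomorphism.

(** * Completeness of the epsilon-product *)

Section epsilon_completeness.
Context (R : realType) (k : scalar_kind).
Local Notation K := (scalars R k).
Context (Omega : Type) (F : submodClosed (Omega -> K^o)).
Local Notation FO := (subspace_type F).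
Context (nrm : FO -> R) (tau gamma : topology FO) (G : set (FO -> R)).
Hypotheses (H : montel_saks nrm tau gamma G)
  (pg : coarser (pointwise_topology F) gamma).
Context (E : tvsType K) (GE : set (E -> R)).
Hypotheses (gE : generated_by GE) (dGE : directed GE)
  (hE : hausdorff_space E) (cE : complete_tvs E).

Local Notation X := (FO \with gamma).
Local Notation NS := (submixed_seminorms G).
Local Notation dnorm := (@dnorm _ _ _ nrm gamma).
Local Notation gsem p q a := (@gamma_sigma_s_seminorm R k Omega F E p q a).
Local Notation chi := (chi H pg gE).
Local Notation eps_seminorms := (eps_seminorms H pg gE).

Lemma eps_seminorm_dominates p (h : dual X) : GE p ->
  exists nu M, [/\ eps_seminorms nu, 0 <= M & 
     forall u : clin (dual_kappa X) E, p (clin_fun u h) <= M * nu u].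
Proof.
move=> Gp; have [N [M [[[q a] d NE] M0 hM]]] := dual_bound H h; rewrite {}NE /= in d hM.
exists (gsem p q a \o chi), M; split=> //.
  by exists (gsem p q a) => //; apply/gamma_sigma_seminormsP; exists p, q, a.
by move=> u; exact: (eps_le_gamma_sigma H pg gE).
Qed.

Section cauchy_filter.
Local Notation EP := (eps_product X E : preTopologicalLmodType K).
Context (FF : set_system EP) (PF : ProperFilter FF).
Hypothesis FC : forall nu e, eps_seminorms nu -> 0 < e ->
  exists2 A, FF A & forall u v : EP, A u -> A v -> nu (u - v) < e.

Lemma eps_pointwise_limit (h : dual X) : exists z : E,
  forall p e, GE p -> 0 < e -> FF [set u : eps_product X E | p (clin_fun u h - z) < e].
Proof.
pose ev (u : eps_product X E) : E := clin_fun u h.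
have [p e Gp e0|z hz] :=
  (generated_complete gE).2 cE (ev @ FF) (fmap_proper_filter ev PF).
  have [nu [M [Nnu M0 hM]]] := eps_seminorm_dominates h Gp.
  have M10 : 0 < M + 1 by lra.
  have [A FA hA] := FC Nnu (divr_gt0 e0 M10).
  exists (ev @` A); first by apply: (@filterS _ FF _ A) => // u Au; exists u.
  move=> _ _ [u Au <-] [v Av <-]; have := hA u v Au Av.
  rewrite /ev -eps_subE ltr_pdivlMr// => uv; apply: le_lt_trans (hM (u - v)) _.
  have := seminorm_ge0 (eps_seminorm_is_seminorm dGE Nnu) (u - v).
  by move: uv; set t := nu _; lra.
by exists z => p e Gp e0; exact: (hz p e Gp e0).
Qed.

Definition eps_limit (l : dual X -> E) := forall (h : dual X) p e,
  GE p -> 0 < e -> FF [set u : eps_product X E | p (clin_fun u h - l h) < e].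

Lemma eps_limit_linear (l : dual X -> E) :
  eps_limit l ->
  linear l.
Proof.
move=> hl a y z; apply: subr0_eq; apply: (hausdorff_seminorms gE hE) => p Gp.
have sp := gE.1 _ Gp; apply/eqP; rewrite eq_le (seminorm_ge0 sp) andbT.
apply/ler_addgt0Pr => e e0; rewrite add0r.
have ma := modulus_ge0 a.
have e1 : 0 < e / 3 by lra.
have e2 : 0 < e / 3 / (modulus a + 1) by rewrite divr_gt0//; lra.
have [u [[/= h1 h2] h3]] := filter_ex (filterI
  (filterI (hl (a *: y + z) p _ Gp e1) (hl y p _ Gp e2)) (hl z p _ Gp e1)).
rewrite eps_linear in h1.
have -> : l (a *: y + z) - (a *: l y + l z) =
    a *: (clin_fun u y - l y) + (clin_fun u z - l z) -
    (a *: clin_fun u y + clin_fun u z - l (a *: y + z)).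
  by rewrite scalerBr addrACA -opprD opprB [RHS]addrC addrA subrK.
apply: le_trans (seminormB sp _ _) _.
have := seminormD sp (a *: (clin_fun u y - l y)) (clin_fun u z - l z).
rewrite seminormZ//; move: h2; rewrite ltr_pdivlMr; last lra.
have := seminorm_ge0 sp (clin_fun u y - l y).
move: h1 h3 => /=; set A := p _; set B := p _; set C := p _; set D := p _.
by move=> h1 h3 B0 h2 hD; nra.
Qed.

(* On a dominated set the limit is uniform, and null sequences of the dual are
   dominated; so the limit is bounded on null sequences. *)
Lemma eps_limit_uniform (l : dual X -> E) p q a e :
  eps_limit l ->
  GE p -> submixed_data G q a -> 0 < e -> exists2 A, FF A &
    forall (u : eps_product X E) (h : dual X), A u ->
      (forall x, modulus (clin_fun h x : K) <= submixed q a x) ->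
      p (clin_fun u h - l h) <= e.
Proof.
move=> hl Gp d e0; have sp := gE.1 _ Gp.
have Nnu : eps_seminorms (gsem p q a \o chi).
  by exists (gsem p q a) => //; apply/gamma_sigma_seminormsP; exists p, q, a.
have [A FA hA] := FC Nnu e0; exists A => // u h Au hh.
apply/ler_addgt0Pr => t t0.
have [v [/= hv Av]] := filter_ex (filterI (hl h p t Gp t0) FA).
apply: le_trans (seminorm_triangle sp (clin_fun v h) _ _) _.
apply: lerD; last exact: ltW.
rewrite -eps_subE; apply: le_trans (ltW (hA u v Au Av)).
rewrite -[leRHS]mul1r; apply: (eps_le_gamma_sigma H pg gE Gp d) => // x.
by rewrite mul1r.
Qed.

(** An unbounded [l] would be large on a null sequence [y]. This sequence is dominated by one
    submixed seminorm, so some [u] of the filter stays within 1 of [l] on all of it, while [u] is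
    bounded there. *)
Lemma eps_limit_bounded (l : dual X -> E) p :
  eps_limit l ->
  GE p -> exists M, forall y : dual X, p (l y) <= M * dnorm y.
Proof.
move=> hl Gp; have sp := gE.1 _ Gp; have sd := dnorm_seminorm H.
have ll := eps_limit_linear hl; apply: contrapT => hn.
have l0 : l 0 = 0 by have := ll (-1) 0 0; rewrite scaler0 addr0 scaleN1r addNr.
have lZ (b : K) y : l (b *: y) = b *: l y.
  by have := ll b y 0; rewrite !addr0 l0 addr0.
have hy n : exists y : dual X, dnorm y <= n.+1%:R^-1 /\ n%:R < p (l y).
  (* One factor [n + 1] is spent on shrinking the norm to [1 / (n + 1)]; the other leaves a value
     above [n]. *)
  have [y yM] : exists y : dual X, n.+1%:R ^+ 2 * dnorm y < p (l y).
    apply: contrapT => hy; apply: hn; exists (n.+1%:R ^+ 2) => y.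
    by rewrite leNgt; apply/negP => yM; apply: hy; exists y.
  have dy0 : 0 < dnorm y.
    rewrite lt_neqAle eq_sym (seminorm_ge0 sd) andbT; apply/eqP => dy0.
    have y0 : y = 0.
      apply: clin_ext => x; apply: (@modulus_eq0 R k); apply/eqP.
      rewrite eq_le modulus_ge0 andbT; apply: le_trans (dnorm_ge H y x) _.
      by rewrite dy0 mul0r.
    by move: yM; rewrite y0 l0 (seminorm0 sp) (seminorm0 sd) mulr0 ltxx.
  have c0 : 0 < (n.+1%:R * dnorm y)^-1 by rewrite invr_gt0 mulr_gt0.
  exists (embed k (n.+1%:R * dnorm y)^-1 *: y); split.
    by rewrite (seminormZe sd _ (ltW c0)) invfM -mulrA mulVf ?mulr1// gt_eqF.
  rewrite lZ (seminormZe sp _ (ltW c0)) mulrC ltr_pdivlMr ?mulr_gt0//.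
  apply: lt_trans yM; rewrite expr2 -mulrA ltr_pM2r ?mulr_gt0//.
  by rewrite ltr_nat.
have [y yP] := choice hy.
have [N [[q a] d NE] hN] := dnorm_null_sequence H (fun n => (yP n).1).
rewrite {}NE /= in d hN.
have [A FA hA] := eps_limit_uniform hl Gp d ltr01.
have [u Au] := filter_ex FA.
have [C C0 hC] := eps_bounded H gE u Gp.
pose n := (Num.truncn (C + 1)).+1.
have := hA u (y n) Au (hN n); have := hC (y n); have [yn1 yn2] := yP n.
have := seminorm_sub sp (l (y n)) (clin_fun u (y n)).
rewrite (seminorm_distC sp) => h1 h2 h3.
have : n%:R < C + 1.
  have n1 : n.+1%:R^-1 <= 1 :> R by rewrite invf_le1// ler1n.
  have : C * dnorm (y n) <= C * 1 by apply: ler_wpM2l => //; exact: le_trans n1.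
  by move: h1 h2 h3 yn2; set t := p _; set s := p _; set w := p _; lra.
by rewrite ltNge ltW// truncnS_gt.
Qed.

End cauchy_filter.

Lemma eps_complete : complete_tvs (eps_product X E).
Proof.
apply/(generated_complete (eps_generated H pg gE dGE)) => FF PF FC.
have [l hl] := choice (eps_pointwise_limit PF FC).
have ll := eps_limit_linear PF hl.
have ll' : linear (l : (dual_kappa X : preTopologicalLmodType _) -> E).
  by move=> a y y'; exact: (ll a y y').
have [cl _] := generated_continuous (kappa_generated H) gE ll'.
have {}cl : continuous (l : (dual_kappa X : preTopologicalLmodType _) -> E).
  apply: cl => p Gp; have [M hM] := eps_limit_bounded PF FC hl Gp.
  by exists dnorm, M.
exists (mk_clin ll' cl : eps_product X E).
move=> _ e [_ /gamma_sigma_seminormsP[p [q [a [Gp d ->]]]] ->] e0.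
have e20 : 0 < e / 2 by lra.
have [A FA hA] := eps_limit_uniform PF FC hl Gp d e20.
apply: filterS FA => u Au /=; apply: (@le_lt_trans _ _ (e / 2)); last lra.
apply: (gamma_sigma_le_eps H pg gE Gp d) => h hh.
by rewrite eps_subE; exact: hA.
Qed.

Lemma chi_isomorphism : @topological_isomorphism K (eps_product X E)
  (weak_space F E \with gamma_sigma_s GE G) chi.
Proof.
have eG := eps_generated H pg gE dGE; have wG := gamma_sigma_generated H pg gE dGE.
have lchi : linear (chi : eps_product X E -> weak_space F E \with gamma_sigma_s GE G).
  by move=> a u v; exact: (chi_linear H pg gE a u v).
have inj : injective chi by exact: (chi_injective hE).
have [psi psiK] := choice (chi_surjective H pg gE hE cE).
have chiK : cancel chi psi by move=> u; apply: inj; exact: psiK.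
have lpsi : linear (psi : weak_space F E \with gamma_sigma_s GE G -> eps_product X E).
  move=> a f g; apply: inj; rewrite psiK.
  by have := lchi a (psi f) (psi g); rewrite !psiK => ->.
split=> //.
  apply/(generated_continuous eG wG lchi) => N NN; exists (N \o chi), 1.
  by split=> [|u]; [exists N | rewrite mul1r].
exists psi; split=> //.
apply/(generated_continuous wG eG lpsi) => _ [N NN ->]; exists N, 1.
by split=> // f; rewrite mul1r /= psiK.
Qed.

End epsilon_completeness.

(** * Banach space targets *)

Lemma generated_seminorm_continuous (R : realType) (k : scalar_kind)
    (X : preTopologicalLmodType (scalars R k)) (P : set (X -> R)) p :
  generated_by P -> P p -> continuous (p : X -> R^o).
Proof.
move=> XP Pp x U /nbhs_ballP[e /= e0 eU]; have sp := XP.1 _ Pp.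
apply: filterS (nbhs_ball_generated XP x Pp e0) => y /= yx; apply: eU.
rewrite -ball_normE /= ltr_norml; apply/andP; split.
  by have := seminorm_sub sp y x; lra.
by have := seminorm_sub sp x y; rewrite (seminorm_distC sp); lra.
Qed.

Section normed_target.
Context (R : realType) (k : scalar_kind).
Local Notation K := (scalars R k).
Context (E : completeNormedModType K).

(** The norm of [E] takes values in [K]; this is its real-valued form. *)
Definition rnorm (x : E) : R := modulus (`|x| : K).

Lemma embed_rnorm x : embed k (rnorm x) = `|x|.
Proof. by rewrite embed_modulus. Qed.

Lemma rnorm_seminorm : seminorm rnorm.
Proof.
split=> [x y|a x].
  by rewrite -(embed_le k) rmorphD /= !embed_rnorm ler_normD.
apply: (@embed_inj R k); rewrite rmorphM /= !embed_rnorm normrZ.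
by rewrite norm_modulus.
Qed.

Lemma rnorm_generated : generated_by ([set rnorm] : set (E -> R)).
Proof.
split=> [_ ->|x U]; first exact: rnorm_seminorm.
split=> [/nbhs_ballP[e /= e0 eU]|[_ [e [-> e0 eU]]]].
  exists rnorm, (modulus e); split=> //.
    by rewrite -(embed_lt k) rmorph0 embed_modulus// ltW.
  move=> y; rewrite -(embed_lt k) embed_rnorm (embed_modulus (ltW e0)) => yx.
  by apply: eU; rewrite -ball_normE /= distrC.
apply/nbhs_ballP; exists (embed k e) => /=.
  by rewrite -(rmorph0 (embed k)) embed_lt.
move=> y; rewrite -ball_normE /= distrC -embed_rnorm embed_lt; exact: eU.
Qed.

Lemma rnorm_directed : directed ([set rnorm] : set (E -> R)).
Proof. by split; [exists rnorm | move=> _ _ -> ->; exists rnorm]. Qed.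

Lemma banach_complete : complete_tvs E.
Proof.
apply/(generated_complete rnorm_generated) => F PF Fc.
have /cauchy_cvg/cvg_ex[x Fx] : cauchy F.
  apply: cauchy_exP => e e0.
  have e0' : 0 < modulus e by rewrite -(embed_lt k) rmorph0 embed_modulus// ltW.
  have [A FA hA] := Fc rnorm _ erefl e0'; have [x Ax] := filter_ex FA.
  exists x; apply: filterS FA => y Ay; rewrite -ball_normE /= -embed_rnorm.
  by rewrite -(embed_modulus (ltW e0)) embed_lt; exact: hA.
exists x => _ e -> e0; apply: Fx; apply: (nbhs_ball_generated rnorm_generated) => //.
Qed.

(** This makes a Banach space [E] an instance of the general case, with the single seminorm [rnorm]:
    suprema over the dual ball are suprema over a polar. *)
Lemma dual_ballP (e : dual E) :
  dual_ball e <-> polar (k := k) [set x : E | rnorm x < 1] e.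
Proof.
have sr := rnorm_seminorm.
have [_ [M [-> M0 hM]]] := dual_dominated rnorm_generated e.
have n1 x : (`|x| <= 1 :> K) = (rnorm x <= 1).
  by rewrite -(embed_le k) embed_rnorm rmorph1.
rewrite polarP// /dual_ball /dual_norm /=; split=> [h x|h].
  rewrite -[leRHS]mul1r -[1](divr1 1).
  apply: (seminorm_bound sr (dual_seminorm e) ltr01) => z z1; apply: le_trans h.
  apply: ub_le_sup; last by exists z => //=; rewrite n1 ltW.
  exists M => _ [w /= w1 <-]; apply: le_trans (hM w) _.
  by rewrite n1 in w1; rewrite -[leRHS]mulr1 ler_wpM2l// ltW.
apply: ge_sup => [|_ [x /= x1 <-]].
  by exists (modulus (e 0 : K)), 0 => //=; rewrite normr0.
by apply: le_trans (h x) _; rewrite -n1.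
Qed.

End normed_target.

Section banach_target.
Context (R : realType) (k : scalar_kind).
Local Notation K := (scalars R k).
Context (Omega : Type) (F : submodClosed (Omega -> K^o)).
Local Notation FO := (subspace_type F).
Context (nrm : FO -> R) (tau gamma : topology FO) (G : set (FO -> R)).
Hypotheses (H : montel_saks nrm tau gamma G)
  (pg : coarser (pointwise_topology F) gamma).
Context (E : completeNormedModType K).

Local Notation WE := (weak_space F E).
Local Notation ssup q := (@sigma_sup R k Omega F E q).
Local Notation Gs := [set ssup q | q in G].
Local Notation gE := (@rnorm_generated R k E).

Let snrm := montel_norm H.
Let G_saks : saks_system nrm tau G. Proof. by case: H. Qed.
Let dG := saks_directed G_saks.
Let sG := saks_seminorm G_saks.
Let Gle := saks_le G_saks.
Let Gsup := saks_sup G_saks.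

Lemma sigma_ge (q : FO -> R) (f : WE) (e : dual E) :
  (forall g, q g <= nrm g) -> dual_ball e -> q (dual_comp e f) <= ssup q f.
Proof.
move=> qn de; have [C C0 hC] := weak_bounded H pg gE f (p := @rnorm R k E) erefl.
apply: ub_le_sup; last by exists e.
exists C => _ [e' /dual_ballP de' <-]; apply: le_trans (qn _) _.
exact: hC.
Qed.

Lemma dual_ball0 : dual_ball (0 : dual E).
Proof.
apply/dual_ballP/(polarP (@rnorm_seminorm R k E)) => x.
by rewrite modulus0 modulus_ge0.
Qed.

Lemma sigma_le (q : FO -> R) (f : WE) c :
  (forall e : dual E, dual_ball e -> q (dual_comp e f) <= c) -> ssup q f <= c.
Proof.
move=> h; apply: ge_sup => [|_ [e de <-]]; last exact: h.
by exists (q (dual_comp 0 f)), 0 => //; exact: dual_ball0.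
Qed.

Lemma sigma_seminorm (q : FO -> R) : seminorm q -> (forall g, q g <= nrm g) ->
  seminorm (ssup q).
Proof.
move=> sq qn; apply: le_seminorm => [f g|b f]; apply: sigma_le => e de.
  have := dual_comp_linearr e 1 f g; rewrite !scale1r => ->.
  by apply: le_trans (seminormD sq _ _) _; apply: lerD; exact: sigma_ge.
have := dual_comp_linearr e b f 0; rewrite addr0 => ->.
have -> : dual_comp e (0 : WE) = 0.
  by apply: feval_ext => x; rewrite dual_compE feval0 [LHS](@clin0 _ _ _ e).
rewrite addr0 (seminormZ sq); apply: ler_wpM2l; first exact: modulus_ge0.
exact: sigma_ge.
Qed.

Lemma sigma_system_seminorm r : Gs r -> seminorm r.
Proof. by move=> [q Gq <-]; apply: sigma_seminorm (sG Gq) (Gle Gq). Qed.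

Lemma sigma_directed : directed Gs.
Proof.
split; first by have [[q Gq] _] := dG; exists (ssup q), q.
move=> _ _ [q1 G1 <-] [q2 G2 <-]; have [q Gq hq] := dG.2 _ _ G1 G2.
exists (ssup q); first by exists q.
move=> f; split; apply: sigma_le => e de.
  by apply: le_trans (sigma_ge f (Gle Gq) de); have [] := hq (dual_comp e f).
by apply: le_trans (sigma_ge f (Gle Gq) de); have [] := hq (dual_comp e f).
Qed.

Lemma tau_sigma_generated : generated_by (Gs : set (WE \with tau_sigma E G -> R)).
Proof.
exact: generated_seminorm_topology sigma_directed sigma_system_seminorm.
Qed.

Lemma sigma_norm_le r : Gs r -> forall f, r f <= ssup nrm f.
Proof.
move=> [q Gq <-] f; apply: sigma_le => e de; apply: le_trans (Gle Gq _) _.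
by apply: sigma_ge => // g; exact: lexx.
Qed.

Lemma sigma_sup_norm f c : c < ssup nrm f -> exists2 r, Gs r & c < r f.
Proof.
move=> cf; apply: contrapT => hn; move: cf; rewrite ltNge => /negP; apply.
apply: sigma_le => e de; rewrite leNgt; apply/negP => /Gsup[q Gq qc].
apply: hn; exists (ssup q); first by exists q.
by apply: lt_le_trans qc _; exact: sigma_ge (Gle Gq) de.
Qed.

(** Every [e] is a multiple of some [e1] in the dual ball. All [q] in [G] vanish at [e1 \o f], hence
    so does the norm, and functionals separate the points of [E]. *)
Lemma sigma_separated f : (forall r, Gs r -> r f = 0) -> f = 0.
Proof.
move=> hf; apply: weval_ext => x; apply: (dual_separates gE (@norm_hausdorff _ E)) => e.
have [_ [M [-> M0 hM]]] := dual_dominated gE e.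
have scaled : dual_comp e f = 0.
  pose e1 : dual E := embed k M^-1 *: e.
  have Mi : 0 < M^-1 by rewrite invr_gt0.
  have de1 : dual_ball e1.
    apply/dual_ballP/(polarP (@rnorm_seminorm R k E)) => z.
    rewrite /e1 dual_scaleE modulusM modulus_embed ger0_norm ?(ltW Mi)//.
    by rewrite mulrC ler_pdivrMr// mulrC.
  have e1f : dual_comp e1 f = 0.
    apply: (montel_norm_eq0 H); apply/eqP; rewrite eq_le (seminorm_ge0 snrm) andbT.
    rewrite leNgt; apply/negP => /Gsup[q Gq]; rewrite ltNge; apply/negP; rewrite negbK.
    rewrite -(hf (ssup q)); first exact: sigma_ge (Gle Gq) de1.
    by exists q.
  have eE : e = embed k M *: e1.
    by rewrite /e1 scalerA -rmorphM mulfV ?gt_eqF// rmorph1 scale1r.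
  have lf := dual_comp_linearl f (embed k M) e1 0.
  have d0 : dual_comp 0 f = 0 by apply: feval_ext => y.
  by rewrite eE -[embed k M *: e1]addr0 lf e1f d0 scaler0 addr0.
by rewrite -dual_compE scaled feval0 [RHS](@clin0 _ _ _ e).
Qed.

Lemma sigma_saks_system : saks_system (ssup nrm) (tau_sigma E G) Gs.
Proof.
split.
- split; [exact: sigma_directed | exact: sigma_system_seminorm | by []].
- move=> r Gr; exact: (generated_seminorm_continuous tau_sigma_generated).
- move=> f; apply/eqP; rewrite eq_le; apply/andP; split; last first.
    by apply: ge_ereal_sup => _ [r Gr <-]; rewrite lee_fin; exact: sigma_norm_le.
  rewrite leNgt; apply/negP; set S := ereal_sup _.
  have Sge r : Gs r -> ((r f)%:E <= S)%E.
    by move=> Gr; apply: ereal_sup_ubound; exists r.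
  have [r0 Gr0] := sigma_directed.1; have S0 := Sge _ Gr0.
  move: S Sge S0 => [s Sge _|//|//]; rewrite lte_fin.
  move=> /sigma_sup_norm[r Gr sr]; have := Sge r Gr; rewrite lee_fin.
  by rewrite leNgt sr.
Qed.

Lemma sigma_two_topology : two_topology_space (ssup nrm) (tau_sigma E G).
Proof.
have sn : seminorm (ssup nrm) by apply: sigma_seminorm => // g; exact: lexx.
split.
- split=> // f f0; apply: sigma_separated => r Gr; apply/eqP.
  rewrite eq_le (seminorm_ge0 (sigma_system_seminorm Gr)) andbT -f0.
  exact: sigma_norm_le.
- exact: generated_locally_convex tau_sigma_generated.
- exact: generated_hausdorff tau_sigma_generated sigma_separated.
- apply: coarser_generated tau_sigma_generated (norm_topology_generated sn) _.
  move=> r Gr; exists (ssup nrm), 1; split=> // f; rewrite mul1r.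
  exact: sigma_norm_le.
Qed.

(** The same [q'] and [t] work for all [e'] of the dual ball, because [submixed_mixed] is uniform
    over the unit ball of [F]. *)
Lemma gamma_sigma_mixed N : gamma_sigma_seminorms (E := E) G [set @rnorm R k E] N ->
  mixed_seminorm (ssup nrm) Gs N.
Proof.
move=> /gamma_sigma_seminormsP[_ [q [a [-> d ->]]]].
split; first exact: (gamma_sigma_is_seminorm H pg gE).
move=> e e0; have e20 : 0 < e / 2 by lra.
have [q' [t [Gq' t0 h]]] := (submixed_mixed dG sG Gle d).2 _ e20.
exists (ssup q'), t; split=> //; first by exists q'.
move=> f f1 ft; apply: (@le_lt_trans _ _ (e / 2)); last lra.
apply: (gamma_sigma_le gE) => // e' /dual_ballP de'; apply/ltW/h.
  by apply: le_trans f1; apply: sigma_ge => // g; exact: lexx.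
by apply: le_lt_trans ft; exact: sigma_ge (Gle Gq') de'.
Qed.

Lemma sigma_complete_saks :
  complete_saks_space (ssup nrm) (tau_sigma E G).
Proof.
have gs_saks := sigma_saks_system.
split; first by split; [exact: sigma_two_topology | exists Gs].
have sn : seminorm (ssup nrm) by apply: sigma_seminorm => // g; exact: lexx.
exists (seminorm_topology [set r | mixed_seminorm (ssup nrm) Gs r]).
  apply: mixed_topologyP => //.
  - exact: sigma_directed.
  - exact: sigma_system_seminorm.
  - exact: sigma_norm_le.
  - exact: tau_sigma_generated.
apply: mixed_complete => //.
- exact: sigma_directed.
- exact: sigma_system_seminorm.
- exact: sigma_norm_le.
- exact: sigma_sup_norm.
move=> FF PF Fc.
(* The filter is Cauchy for all mixed seminorms, among them those of [gamma_sigma_s], for which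
   completeness has been transported along [chi]. *)
have dE := @rnorm_directed R k E; have hE := @norm_hausdorff _ E.
have cE := @banach_complete R k E.
have cW := complete_isomorphism (chi_isomorphism H pg gE dE hE cE)
  (eps_complete H pg gE dE hE cE).
have [N e NN e0|f hf] := (generated_complete
  (gamma_sigma_generated H pg gE dE)).2 cW FF PF.
  by apply: Fc => //; exact: gamma_sigma_mixed.
exists f => _ e [q Gq <-] e0.
(* The constant sequence [q] with these weights, the first of which is 1, gives a seminorm of
   [gamma_sigma_s] above [sigma_sup q]. *)
pose a n : R := n.+1%:R^-1.
have d : submixed_data G (fun=> q) a.
  split=> [//|n|]; first by rewrite /a invr_ge0.
  exact: null_sequence_harmonic.
have NN : gamma_sigma_seminorms (E := E) G [set @rnorm R k E]
    (gamma_sigma_s_seminorm (@rnorm R k E) (fun=> q) a).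
  by apply/gamma_sigma_seminormsP; exists (@rnorm R k E), (fun=> q), a.
apply: filterS (hf _ _ NN e0) => g; apply: le_lt_trans.
apply: sigma_le => e' /dual_ballP de'.
apply: le_trans (gamma_sigma_ge H pg gE erefl d (g - f) de').
by have := submixed_ge dG sG Gle d 0%N (dual_comp e' (g - f)); rewrite /a invr1 mulr1.
Qed.

End banach_target.

Theorem theorem3p3 (R : realType) (k : scalar_kind)
    (Omega : Type) (Omega_nonempty : inhabited Omega)
    (F : submodClosed (Omega -> (scalars R k)^o))
    (nrm : subspace_type F -> R)
    (tau gamma : topology (subspace_type F))
    (Gamma_tau : set (subspace_type F -> R))
    (nrm_tau : two_topology_space nrm tau)
    (saks_tau : saks_system nrm tau Gamma_tau)
    (mixed_gamma : is_mixed_topology nrm tau gamma)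
    (Montel_gamma : semi_Montel (subspace_type F \with gamma))
    (pointwise_tau : coarser (pointwise_topology F) tau) :
  (forall (E : tvsType (scalars R k)) (Gamma_E : set (E -> R)),
     hausdorff_space E -> complete_tvs E ->
     generating_seminorms (topology_of E) Gamma_E ->
     (exists2 chi : eps_product (subspace_type F \with gamma) E ->
                    weak_space F E \with gamma_sigma_s Gamma_E Gamma_tau,
        forall (u : eps_product (subspace_type F \with gamma) E) (x : Omega),
          weval (chi u) x =
          clin_fun u (Delta (coarser_trans pointwise_tau
                               (mixed_coarser mixed_gamma)) x) &
        topological_isomorphism chi) /\
     complete_tvs (weak_space F E \with gamma_sigma_s Gamma_E Gamma_tau)) /\
  (forall E : completeNormedModType (scalars R k),
     complete_saks_space (sigma_sup (E := E) nrm) (tau_sigma E Gamma_tau)).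
Proof.
have H : montel_saks nrm tau gamma Gamma_tau by split.
pose pg := coarser_trans pointwise_tau (mixed_coarser mixed_gamma).
split=> [E GE hE cE [dGE sGE oE]|E]; last exact: sigma_complete_saks H pg E.
have gE := generated_by_open dGE sGE oE.
have iso := chi_isomorphism H pg gE dGE hE cE.
split; first by exists (chi H pg gE).
exact: complete_isomorphism iso (eps_complete H pg gE dGE hE cE).
Qed.
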